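(* Let $n\ge1$ and let $\mathfrak{g}=\mathfrak{p}(n)=[\tilde{\mathfrak{p}}(n),\tilde{\mathfrak{p}}(n)]$ over $\mathbf{k}$. Then the first super Kac-Weisfeiler conjecture holds for $\mathfrak{g}$: the maximal dimension of irreducible $\mathfrak{g}$-modules is $$\max_{\theta\in \mathfrak{g}_{\bar 0}^*}p^{\frac{b^\theta_0}{2}}2^{\lceil\frac{b^\theta_1}{2}\rceil}.$$
   Context: $\mathbf{k}$ is an algebraically closed field of characteristic $p>2$. All vector spaces, modules and subalgebras are understood in the super ($\mathbb{Z}_2$-graded) sense, and all Lie superalgebras are finite-dimensional; $\dim V=\dim V_{\bar 0}+\dim V_{\bar 1}$. $\tilde{\mathfrak{p}}(n)$ is the Lie subsuperalgebra of $\mathfrak{gl}(n|n)$ of all matrices $\begin{pmatrix} A & B\\ C & -A^{t}\end{pmatrix}$ with $A,B,C$ of size $n\times n$, $B=B^{t}$, $C=-C^{t}$; $[\tilde{\mathfrak{p}}(n),\tilde{\mathfrak{p}}(n)]$ is its derived subalgebra. It is a restricted Lie superalgebra with $p$-mapping on the even part given by the $p$-th power of matrices. For a restricted Lie superalgebra $\mathfrak{g}=\mathfrak{g}_{\bar 0}\oplus\mathfrak{g}_{\bar 1}$ and $\theta\in\mathfrak{g}_{\bar 0}^*$ (extended to $\mathfrak{g}$ by $\theta(\mathfrak{g}_{\bar 1})=0$), let $\mathfrak{g}^\theta=\{X\in\mathfrak{g}\mid\theta([X,\mathfrak{g}])=0\}=\mathfrak{g}^\theta_{\bar 0}\oplus\mathfrak{g}^\theta_{\bar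 1}$, and set $b_0^\theta=\dim\mathfrak{g}_{\bar 0}-\dim\mathfrak{g}_{\bar 0}^\theta$ (always even) and $b_1^\theta=\dim\mathfrak{g}_{\bar 1}-\dim\mathfrak{g}_{\bar 1}^\theta$. $\lceil a\rceil$ denotes the least integer $\geq a$. *)

(* Defs.v *)
From HB Require Import structures.
From mathcomp Require Import all_boot all_order all_algebra.

Set Implicit Arguments.
Unset Strict Implicit.
Unset Printing Implicit Defensive.

Import GRing.Theory.
Local Open Scope ring_scope.

(* Sub-superspaces of gl(m|n) are {vspace 'M_(m + n)}; a parity is a boolean, *)
(* with false = even and true = odd.                                          *)

Definition gl_proj (k : fieldType) (m n : nat) (i : bool)
    (X : 'M[k]_(m + n)) : 'M[k]_(m + n) :=
  if i then block_mx 0 (ursubmx X) (dlsubmx X) 0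
  else block_mx (ulsubmx X) 0 0 (drsubmx X).

Lemma gl_proj_is_linear (k : fieldType) (m n : nat) (i : bool) :
  linear (@gl_proj k m n i).
Proof.
move=> a X Y; rewrite /gl_proj /ulsubmx /ursubmx /dlsubmx /drsubmx.
by case: i; rewrite !linearP /=  scale_block_mx add_block_mx ?scaler0 ?addr0.
Qed.

HB.instance Definition _ (k : fieldType) (m n : nat) (i : bool) :=
  GRing.isLinear.Build k 'M[k]_(m + n) 'M[k]_(m + n) _ (@gl_proj k m n i)
    (@gl_proj_is_linear k m n i).

Lemma gl_proj_sum (k : fieldType) (m n : nat) (X : 'M[k]_(m + n)) :
  X = gl_proj false X + gl_proj true X.
Proof. by rewrite /gl_proj add_block_mx !addr0 !add0r submxK. Qed.

Definition gl_part (k : fieldType) (m n : nat) (i : bool) :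
    {vspace 'M[k]_(m + n)} :=
  lker (linfun (@gl_proj k m n (~~ i))).

Lemma gl_partP (k : fieldType) (m n : nat) (i : bool) (X : 'M[k]_(m + n)) :
  reflect (gl_proj i X = X) (X \in gl_part k m n i).
Proof.
rewrite memv_ker lfunE /=; have := gl_proj_sum X.
by case: i => /= e; apply: (iffP eqP) => h; move: e; rewrite h ?addr0 ?add0r //;
  [move/eqP; rewrite -subr_eq subrr | rewrite addrC => /eqP; rewrite -subr_eq subrr];
  move/eqP.
Qed.

Definition homog (k : fieldType) (m n : nat) (g : {vspace 'M[k]_(m + n)})
    (i : bool) : {vspace 'M[k]_(m + n)} :=
  (g :&: gl_part k m n i)%VS.

(* The bilinear extension of XY - (-1)^(|X||Y|) YX. *)
Definition sbracket (k : fieldType) (m n : nat)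
    (X Y : 'M[k]_(m + n)) : 'M[k]_(m + n) :=
  X *m Y - \sum_(i : bool) \sum_(j : bool)
             (-1) ^+ (i && j) *: (gl_proj j Y *m gl_proj i X).

Lemma sbracket_homog (k : fieldType) (m n : nat) (i j : bool)
    (X Y : 'M[k]_(m + n)) :
  X \in gl_part k m n i -> Y \in gl_part k m n j ->
  sbracket X Y = X *m Y - (-1) ^+ (i && j) *: (Y *m X).
Proof.
have N (l : bool) Z : Z \in gl_part k m n l ->
    forall l', gl_proj l' Z = if l' == l then Z else 0.
  move=> Zl l'; case: eqP => [->|/eqP ne]; first exact/gl_partP.
  move: Zl; rewrite memv_ker lfunE /= => /eqP.
  by case: l l' ne => [] [].
move=> Xi Yj; rewrite /sbracket; congr (_ - _).
rewrite (bigD1 i) //= [X in _ + X]big1 ?addr0 => [|i' /negPf ne]; last first.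
  by rewrite big1 // => j' _; rewrite (N _ _ Xi) ne mulmx0 scaler0.
rewrite (bigD1 j) //= [X in _ + X]big1 ?addr0 => [|j' /negPf ne].
  by rewrite (N _ _ Xi) (N _ _ Yj) !eqxx.
by rewrite (N _ _ Yj) ne mul0mx scaler0.
Qed.

Lemma sbracket_is_linear (k : fieldType) (m n : nat) (X : 'M[k]_(m + n)) :
  linear (sbracket X).
Proof.
move=> a Y Z; rewrite /sbracket mulmxDr -scalemxAr scalerBr addrACA -opprD.
congr (_ - _); rewrite scaler_sumr -big_split; apply: eq_bigr => i _ /=.
rewrite scaler_sumr -big_split; apply: eq_bigr => j _ /=.
by rewrite linearP mulmxDl -scalemxAl scalerDr !scalerA [a * _]mulrC.
Qed.

HB.instance Definition _ (k : fieldType) (m n : nat) (X : 'M[k]_(m + n)) :=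
  GRing.isLinear.Build k 'M[k]_(m + n) 'M[k]_(m + n) _ (sbracket X)
    (sbracket_is_linear X).

Definition sbracketr (k : fieldType) (m n : nat) (Y X : 'M[k]_(m + n)) :
    'M[k]_(m + n) :=
  sbracket X Y.

Lemma sbracketr_is_linear (k : fieldType) (m n : nat) (Y : 'M[k]_(m + n)) :
  linear (sbracketr Y).
Proof.
move=> a X Z; rewrite /sbracketr /sbracket mulmxDl -scalemxAl scalerBr addrACA.
rewrite -opprD; congr (_ - _).
rewrite scaler_sumr -big_split; apply: eq_bigr => i _ /=.
rewrite scaler_sumr -big_split; apply: eq_bigr => j _ /=.
by rewrite linearP mulmxDr -scalemxAr scalerDr !scalerA [a * _]mulrC.
Qed.

HB.instance Definition _ (k : fieldType) (m n : nat) (Y : 'M[k]_(m + n)) :=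
  GRing.isLinear.Build k 'M[k]_(m + n) 'M[k]_(m + n) _ (sbracketr Y)
    (sbracketr_is_linear Y).

Definition derived (k : fieldType) (m n : nat) (g : {vspace 'M[k]_(m + n)}) :
    {vspace 'M[k]_(m + n)} :=
  <<[seq sbracket X Y | X <- vbasis g, Y <- vbasis g]>>%VS.

Lemma derivedP (k : fieldType) (m n : nat) (g U : {vspace 'M[k]_(m + n)}) :
  reflect {in g &, forall X Y, sbracket X Y \in U} (derived g <= U)%VS.
Proof.
apply: (iffP span_subvP) => [h X Y Xg Yg | h Z /allpairsP [[X Y] [/= Xg Yg ->]]].
  rewrite (coord_vbasis Xg) -[sbracket _ _]/(sbracketr Y _) linear_sum memv_suml //.
  move=> i _; rewrite linearZ memvZ //= /sbracketr (coord_vbasis Yg) linear_sum.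
  rewrite memv_suml // => j _; rewrite linearZ memvZ //=.
  by apply: h; apply/allpairsP; exists ((vbasis g)`_i, (vbasis g)`_j);
    rewrite /= !mem_nth ?size_tuple.
by apply: h; apply: vbasis_mem.
Qed.

Definition periplectic_defect (k : fieldType) (n : nat) (X : 'M[k]_(n + n)) :
    'M[k]_n * 'M[k]_n * 'M[k]_n :=
  (drsubmx X + (ulsubmx X)^T, ursubmx X - (ursubmx X)^T,
   dlsubmx X + (dlsubmx X)^T).

Lemma periplectic_defect_is_linear (k : fieldType) (n : nat) :
  linear (@periplectic_defect k n).
Proof.
move=> a X Y; rewrite /periplectic_defect /ulsubmx /ursubmx /dlsubmx /drsubmx.
rewrite !linearP /=.
by congr (_, _, _); rewrite /= scalerDr ?scalerN ?opprD addrACA.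
Qed.

HB.instance Definition _ (k : fieldType) (n : nat) :=
  GRing.isLinear.Build k 'M[k]_(n + n) ('M[k]_n * 'M[k]_n * 'M[k]_n)%type _
    (@periplectic_defect k n) (@periplectic_defect_is_linear k n).

Definition ptilde (k : fieldType) (n : nat) : {vspace 'M[k]_(n + n)} :=
  lker (linfun (@periplectic_defect k n)).

Lemma ptildeP (k : fieldType) (n : nat) (X : 'M[k]_(n + n)) :
  reflect (exists A B C : 'M[k]_n,
             [/\ X = block_mx A B C (- A^T), B = B^T & C = - C^T])
          (X \in ptilde k n).
Proof.
rewrite memv_ker lfunE /=; apply: (iffP eqP) => [|[A [B [C [-> hB hC]]]]].
  case=> /eqP; rewrite addr_eq0 => /eqP hD /eqP; rewrite subr_eq0 => /eqP hB.
  move/eqP; rewrite addr_eq0 => /eqP hC.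
  exists (ulsubmx X), (ursubmx X), (dlsubmx X).
  by split=> //; rewrite -hD submxK.
rewrite /periplectic_defect block_mxKul block_mxKur block_mxKdl block_mxKdr.
by rewrite addNr -hB subrr {1}hC addNr.
Qed.

Definition periplectic (k : fieldType) (n : nat) : {vspace 'M[k]_(n + n)} :=
  derived (ptilde k n).

Definition even_dual (k : fieldType) (m n : nat)
    (g : {vspace 'M[k]_(m + n)}) : Type :=
  'Hom(subvs_of (homog g false), k^o).

(* Extension by zero on the odd part; only meant to be used on g. *)
Definition dual_ext (k : fieldType) (m n : nat) (g : {vspace 'M[k]_(m + n)})
    (theta : even_dual g) (X : 'M[k]_(m + n)) : k^o :=
  theta (vsproj (homog g false) (gl_proj false X)).

Lemma dual_ext_is_linear (k : fieldType) (m n : nat)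
    (g : {vspace 'M[k]_(m + n)}) (theta : even_dual g) :
  linear (dual_ext theta).
Proof. by move=> a X Y; rewrite /dual_ext !linearP. Qed.

HB.instance Definition _ (k : fieldType) (m n : nat)
    (g : {vspace 'M[k]_(m + n)}) (theta : even_dual g) :=
  GRing.isLinear.Build k 'M[k]_(m + n) k^o _ (dual_ext theta)
    (dual_ext_is_linear theta).

Definition theta_stab (k : fieldType) (m n : nat)
    (g : {vspace 'M[k]_(m + n)}) (theta : even_dual g) :
    {vspace 'M[k]_(m + n)} :=
  (g :&: \bigcap_(Y <- vbasis g)
           lker (linfun (dual_ext theta \o sbracketr Y)))%VS.

Lemma theta_stabP (k : fieldType) (m n : nat) (g : {vspace 'M[k]_(m + n)})
    (theta : even_dual g) (X : 'M[k]_(m + n)) :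
  reflect (X \in g /\ {in g, forall Y, dual_ext theta (sbracket X Y) = 0})
          (X \in theta_stab theta).
Proof.
have bigcapP (s : seq 'M[k]_(m + n)) :
    (X \in (\bigcap_(Y <- s) lker (linfun (dual_ext theta \o sbracketr Y)))%VS)
      = all (fun Y => dual_ext theta (sbracket X Y) == 0) s.
  elim: s => [|Y s IH]; first by rewrite big_nil memvf.
  by rewrite big_cons memv_cap IH memv_ker lfunE.
rewrite memv_cap bigcapP; apply: (iffP andP) => -[Xg h]; split=> //.
  move=> Y Yg; rewrite (coord_vbasis Yg) !linear_sum big1 // => i _.
  rewrite !linearZ /= (eqP (allP h _ _)) ?scaler0 //.
  by rewrite mem_nth ?size_tuple.
by apply/allP => Y /vbasis_mem Yg; rewrite h.
Qed.

Definition b_theta (k : fieldType) (m n : nat) (g : {vspace 'M[k]_(m + n)})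
    (theta : even_dual g) (i : bool) : nat :=
  (\dim (homog g i) - \dim (homog (theta_stab theta) i))%N.

(* ./2 is exact, as b_0 is the rank of an alternating form; uphalf is the     *)
(* ceiling of the half.                                                       *)
Definition kw_value (k : fieldType) (p m n : nat) (g : {vspace 'M[k]_(m + n)})
    (theta : even_dual g) : nat :=
  (p ^ (b_theta theta false)./2 * 2 ^ uphalf (b_theta theta true))%N.

(* A superspace is a product V0 * V1, with even part V0 and odd part V1.      *)
Definition in_parity (k : fieldType) (V0 V1 : lmodType k) (i : bool)
    (v : V0 * V1) : Prop :=
  if i then v.1 = 0 else v.2 = 0.

(* rho is unconstrained outside of g. *)
Record supermodule (k : fieldType) (m n : nat) (g : {vspace 'M[k]_(m + n)})
    (V0 V1 : lmodType k) (rho : 'M[k]_(m + n) -> V0 * V1 -> V0 * V1) : Prop :=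
  Supermodule {
    supermod_linear : {in g, forall X, linear (rho X)};
    supermod_linearl : {in g &, forall X Y, forall (a : k) (v : V0 * V1),
      rho (a *: X + Y) v = a *: rho X v + rho Y v};
    supermod_parity : forall (i j : bool) (v : V0 * V1),
      {in homog g i, forall X,
        in_parity j v -> in_parity (i (+) j) (rho X v)};
    supermod_bracket : forall i j : bool,
      {in homog g i & homog g j, forall X Y, forall v : V0 * V1,
        rho (sbracket X Y) v
          = rho X (rho Y v) - (-1) ^+ (i && j) *: rho Y (rho X v)}
  }.

Record subsupermodule (k : fieldType) (m n : nat)
    (g : {vspace 'M[k]_(m + n)}) (V0 V1 : lmodType k)
    (rho : 'M[k]_(m + n) -> V0 * V1 -> V0 * V1) (W : V0 * V1 -> Prop) : Prop :=
  Subsupermodule {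
    subsuper_0 : W 0;
    subsuper_linear : forall (a : k) (v w : V0 * V1),
      W v -> W w -> W (a *: v + w);
    subsuper_graded : forall v : V0 * V1, W v -> W (v.1, 0) /\ W (0, v.2);
    subsuper_stable : {in g, forall X, forall v : V0 * V1, W v -> W (rho X v)}
  }.

Definition irreducible_supermodule (k : fieldType) (m n : nat)
    (g : {vspace 'M[k]_(m + n)}) (V0 V1 : lmodType k)
    (rho : 'M[k]_(m + n) -> V0 * V1 -> V0 * V1) : Prop :=
  [/\ supermodule g rho,
      exists v : V0 * V1, v != 0
    & forall W : V0 * V1 -> Prop, subsupermodule g rho W ->
        (forall v, W v -> v = 0) \/ (forall v, W v)].

Definition has_dim (k : fieldType) (V : lmodType k) (d : nat) : Prop :=
  exists f : {linear V -> 'rV[k]_d}, bijective f.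

(* Irreducible modules are not assumed finite-dimensional: finiteness is part *)
(* of the second clause.                                                      *)
Definition max_irreducible_dim (k : fieldType) (m n : nat)
    (g : {vspace 'M[k]_(m + n)}) (M : nat) : Prop :=
  (exists (V0 V1 : lmodType k) (rho : 'M[k]_(m + n) -> V0 * V1 -> V0 * V1),
     irreducible_supermodule g rho /\ has_dim (V0 * V1)%type M) /\
  (forall (V0 V1 : lmodType k) (rho : 'M[k]_(m + n) -> V0 * V1 -> V0 * V1),
     irreducible_supermodule g rho ->
     exists2 d : nat, has_dim (V0 * V1)%type d & (d <= M)%N).

Definition max_kw_value (k : fieldType) (p m n : nat)
    (g : {vspace 'M[k]_(m + n)}) (M : nat) : Prop :=
  (exists theta : even_dual g, kw_value p theta = M) /\
  (forall theta : even_dual g, (kw_value p theta <= M)%N).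

(* Main.v *)
Require Import Defs.
From HB Require Import structures.
From mathcomp Require Import all_boot all_order all_algebra.
From mathcomp Require Import boolp zify.
From mathcomp.real_closed Require Import mxtens.
From mathcomp Require mpoly.

Set Implicit Arguments.
Unset Strict Implicit.
Unset Printing Implicit Defensive.

Import GRing.Theory.
Local Open Scope ring_scope.

(* The even part of p(n) is sl(n), acting on the odd part Sym + Alt. Put
   N = n(n-1)/2; both sides of the theorem equal (2p)^N.

   Let theta = tr(Theta _). If Theta is upper triangular, the upper triangular
   matrices are isotropic for theta([_, _]) on sl(n), and Sym is isotropic on
   the odd part; hence b_0 and b_1 are at most 2N, and equality holds for Theta
   diagonal with distinct entries.

   An irreducible module is finitely generated over the central operators
   E_ij^p - E_ij^[p], and by Noether normalization and Nakayama's lemma it is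
   finite-dimensional, so that these operators are scalars. By Jacobson's
   formula they are given by a matrix Theta, which may be taken triangular. Then
   there is a common eigenvector of the diagonal killed by Sym and by all E_ij
   with i < j, and the (2p)^N ordered monomials in Alt and the E_ij with i > j
   applied to it span the module.

   Conversely, tensor products of oscillator representations give a module on
   which E_ij^p is 1 for i = j + 1 and 0 for i > j + 1. Order the N odd and N even
   lowering operators by columns. Each of them has a partner, preserving the
   vectors singled out by the previous ones, whose bracket with it is invertible
   there; imposing it thus divides the dimension by at least 2 or p. So every
   nonzero submodule has dimension at least (2p)^N. *)

(** * Endomorphism rings *)

(** Modules are arbitrary, possibly infinite-dimensional, so finiteness has to be produced: by
    Schur's argument a central operator is zero or surjective, and surjectivity of one operator
    yields a polynomial relation among all of them. The grading is absorbed by adjoining the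
    projection onto the even part to the operators, so that graded submodules become plain stable
    subspaces. The two maxima are linked only through the number (2p)^N: the form theta reaching it
    is regular semisimple, whereas the module of that dimension has a p-character supported on the
    subdiagonal, because E_{j+1,j}^p = 1 is what makes the brackets with the partners invertible.
    The obstacle is the last even operator, whose partner should be the diagonal unit at the last
    index, up to a scalar matrix. No such element has trace zero when p divides the matrix size. The
    identity is then a central element of sl, and a quadratic Casimir element divided by it takes
    over. The division needs the identity to act invertibly; one additional oscillator factor
    arranges this by imposing a(1)^p - a(1) = 1. *)

(* The index v0 != 0 makes the endomorphism ring nontrivial. *)
Record lin_end (k : fieldType) (V : lmodType k) (v0 : V) (nz : v0 != 0) :=
  LinEnd { lin_end_fun :> V -> V; lin_endP : linear lin_end_fun }.

Section LinEnd.
Variables (k : fieldType) (V : lmodType k) (v0 : V) (nz : v0 != 0).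
Notation E := (lin_end nz).
Implicit Types f g h : E.

HB.instance Definition _ := gen_eqMixin E.
HB.instance Definition _ := gen_choiceMixin E.
HB.instance Definition _ f :=
  GRing.isLinear.Build k V V _ (lin_end_fun f) (lin_endP f).

Lemma lin_end_ext f g : (forall v, f v = g v) -> f = g.
Proof.
case: f g => [f fl] [g gl] /= /funext efg; move: fl gl; rewrite efg => fl gl.
by congr LinEnd; apply: Prop_irrelevance.
Qed.

Fact lin_end0_linear : linear (fun _ : V => 0 : V).
Proof. by move=> a u v; rewrite scaler0 addr0. Qed.
Fact lin_end1_linear : linear (@id V).
Proof. by []. Qed.
Fact lin_endD_linear f g : linear (fun v => f v + g v).
Proof. by move=> a u v; rewrite !linearP scalerDr addrACA. Qed.
Fact lin_endN_linear f : linear (fun v => - f v).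
Proof. by move=> a u v; rewrite linearP opprD scalerN. Qed.
Fact lin_endM_linear f g : linear (fun v => f (g v)).
Proof. by move=> a u v; rewrite !linearP. Qed.
Fact lin_endZ_linear a f : linear (fun v => a *: f v).
Proof. by move=> b u v; rewrite linearP scalerDr !scalerA mulrC. Qed.

Definition lin_end0 : E := LinEnd nz lin_end0_linear.
Definition lin_end1 : E := LinEnd nz lin_end1_linear.
Definition lin_endD f g : E := LinEnd nz (lin_endD_linear f g).
Definition lin_endN f : E := LinEnd nz (lin_endN_linear f).
Definition lin_endM f g : E := LinEnd nz (lin_endM_linear f g).
Definition lin_endZ a f : E := LinEnd nz (lin_endZ_linear a f).

Fact lin_endDA : associative lin_endD.
Proof. by move=> f g h; apply: lin_end_ext => v /=; rewrite addrA. Qed.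
Fact lin_endDC : commutative lin_endD.
Proof. by move=> f g; apply: lin_end_ext => v /=; rewrite addrC. Qed.
Fact lin_endD0 : left_id lin_end0 lin_endD.
Proof. by move=> f; apply: lin_end_ext => v /=; rewrite add0r. Qed.
Fact lin_endDN : left_inverse lin_end0 lin_endN lin_endD.
Proof. by move=> f; apply: lin_end_ext => v /=; rewrite addNr. Qed.
HB.instance Definition _ :=
  GRing.isZmodule.Build E lin_endDA lin_endDC lin_endD0 lin_endDN.

Fact lin_endMA : associative lin_endM.
Proof. by move=> f g h; apply: lin_end_ext. Qed.
Fact lin_end1M : left_id lin_end1 lin_endM.
Proof. by move=> f; apply: lin_end_ext. Qed.
Fact lin_endM1 : right_id lin_end1 lin_endM.
Proof. by move=> f; apply: lin_end_ext. Qed.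
Fact lin_endMDl : left_distributive lin_endM lin_endD.
Proof. by move=> f g h; apply: lin_end_ext. Qed.
Fact lin_endMDr : right_distributive lin_endM lin_endD.
Proof. by move=> f g h; apply: lin_end_ext => v /=; rewrite linearD. Qed.
Fact lin_end1_neq0 : lin_end1 != 0.
Proof. by apply/eqP => /(congr1 (fun f : E => f v0)) /= /eqP; apply/negP. Qed.
HB.instance Definition _ := GRing.Zmodule_isNzRing.Build E
  lin_endMA lin_end1M lin_endM1 lin_endMDl lin_endMDr lin_end1_neq0.

Fact lin_endZA a b f : lin_endZ a (lin_endZ b f) = lin_endZ (a * b) f.
Proof. by apply: lin_end_ext => v /=; rewrite scalerA. Qed.
Fact lin_end1Z : left_id 1 lin_endZ.
Proof. by move=> f; apply: lin_end_ext => v /=; rewrite scale1r. Qed.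
Fact lin_endZDr : right_distributive lin_endZ +%R.
Proof. by move=> a f g; apply: lin_end_ext => v /=; rewrite scalerDr. Qed.
Fact lin_endZDl f : {morph lin_endZ^~ f : a b / a + b}.
Proof. by move=> a b; apply: lin_end_ext => v /=; rewrite scalerDl. Qed.
HB.instance Definition _ := GRing.Zmodule_isLmodule.Build k E
  lin_endZA lin_end1Z lin_endZDr lin_endZDl.
Fact lin_endZAl (a : k) f g : a *: (f * g) = (a *: f) * g.
Proof. by apply: lin_end_ext. Qed.
HB.instance Definition _ := GRing.Lmodule_isLalgebra.Build k E lin_endZAl.
Fact lin_endZAr (a : k) f g : a *: (f * g) = f * (a *: g).
Proof. by apply: lin_end_ext => v /=; rewrite linearZ. Qed.
HB.instance Definition _ := GRing.Lalgebra_isAlgebra.Build k E lin_endZAr.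

Lemma addEv f g v : (f + g) v = f v + g v. Proof. by []. Qed.
Lemma oppEv f v : (- f) v = - f v. Proof. by []. Qed.
Lemma mulEv f g v : (f * g) v = f (g v). Proof. by []. Qed.
Lemma scaleEv (a : k) f v : (a *: f) v = a *: f v. Proof. by []. Qed.
Lemma zeroEv v : (0 : E) v = 0. Proof. by []. Qed.
Lemma oneEv v : (1 : E) v = v. Proof. by []. Qed.
Lemma appDE f u v : f (u + v) = f u + f v. Proof. exact: linearD. Qed.
Lemma appBE f u v : f (u - v) = f u - f v. Proof. exact: linearB. Qed.
Lemma appZE f (a : k) v : f (a *: v) = a *: f v. Proof. exact: linearZ. Qed.
Lemma appE0 f : f 0 = 0. Proof. exact: linear0. Qed.
Lemma sumEv I (r : seq I) P (F : I -> E) v :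
  (\sum_(i <- r | P i) F i) v = \sum_(i <- r | P i) F i v.
Proof. by elim/big_rec2: _ => [|i u f _ <-]. Qed.
End LinEnd.
Arguments LinEnd {k V v0 nz} _ _.

(** * Jacobson's formula *)

(** Left multiplication by [A] and right multiplication by [A'] commute, so this is the binomial
    theorem for their sum. *)
Lemma iter_two_sided (S : nzRingType) (A A' B : S) m :
  iter m (fun X => A * X + X * A') B
    = \sum_(i < m.+1) (A ^+ (m - i) * B * A' ^+ i) *+ 'C(m, i).
Proof.
elim: m => [|m IH]; first by rewrite big_ord1 /= bin0 expr0 mulr1 mul1r.
rewrite iterS IH big_distrr big_distrl /=.
rewrite [RHS]big_ord_recl [in X in X + _]big_ord_recl /=.
rewrite !bin0 !subn0 !expr0 !mulr1 !mulr1n mulrA -exprS -addrA; congr (_ + _).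
transitivity (\sum_(i < m.+1) ((A ^+ (m - i) * B * A' ^+ i.+1) *+ 'C(m, i.+1)
                              + (A ^+ (m - i) * B * A' ^+ i.+1) *+ 'C(m, i))).
  rewrite big_split /=; congr (_ + _).
    rewrite big_ord_recr /= bin_small // mulr0n addr0; apply: eq_bigr => i _.
    by rewrite /bump /= add1n mulrnAr !mulrA -exprS subnSK.
  by apply: eq_bigr => i _; rewrite mulrnAl -mulrA -exprSr.
by apply: eq_bigr => i _; rewrite /bump /= add1n subSS binS mulrnDr.
Qed.

Section CharP.
Variables (p : nat) (S : nzRingType).
Hypothesis charS : p \in [pchar S].

Let p_pr : prime p. Proof. exact: pcharf_prime charS. Qed.

Lemma iter_two_sided_pchar (A A' B : S) :
  iter p (fun X => A * X + X * A') B = A ^+ p * B + B * A' ^+ p.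
Proof.
rewrite iter_two_sided big_ord_recr /= subnn binn expr0 mul1r mulr1n; congr (_ + _).
rewrite -[in LHS](prednK (prime_gt0 p_pr)) big_ord_recl /= bin0 subn0 expr0.
rewrite mulr1 mulr1n prednK ?prime_gt0 // big1 ?addr0 // => i _.
rewrite -mulr_natr (_ : 'C(_, _)%:R = 0) ?mulr0 //.
apply/eqP; rewrite -(dvdn_pcharf charS) prime_dvd_bin // /bump /= add1n.
by rewrite -ltn_predRL ltn_ord.
Qed.

(** By Pascal's rule two neighbours in row p - 1 add up to an inner entry of row p, which vanishes
    in characteristic p. *)
Lemma binSp_pchar i : (i < p)%N -> ('C(p.-1, i))%:R = (-1) ^+ i :> S.
Proof.
elim: i => [|i IH] lt_i; first by rewrite bin0.
have := dvdn_pcharf charS 'C(p, i.+1).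
rewrite prime_dvd_bin // -[p in X in _ = X](prednK (prime_gt0 p_pr)) binS natrD.
rewrite IH 1?ltnW // => /esym; rewrite addr_eq0 => /eqP ->.
by rewrite exprS mulN1r.
Qed.

(** The binomial signs of row p - 1 cancel those of the powers of [- u]. The right-hand side is the
    derivative of the p-th power at [u] in the direction [x]. *)
Lemma iter_ad_pred_pchar (u x : S) :
  iter p.-1 (fun X => u * X - X * u) x
    = \sum_(i < p) u ^+ (p.-1 - i) * x * u ^+ i.
Proof.
have -> : iter p.-1 (fun X => u * X - X * u) x
        = iter p.-1 (fun X => u * X + X * (- u)) x.
  by apply: eq_iter => X; rewrite mulrN.
rewrite iter_two_sided prednK ?prime_gt0 //; apply: eq_bigr => i _.
rewrite -mulr_natr binSp_pchar // -mulrA -exprMn_comm; last exact: commrN1.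
by rewrite mulrN1 opprK.
Qed.
End CharP.

Definition comm_br (S : pzRingType) (x y : S) : S := x * y - y * x.

(* The coefficient of t^j in ad(t x + y)^m (x). *)
Fixpoint jacobson_coef (S : pzRingType) (x y : S) (m j : nat) : S :=
  if m is m'.+1 then
    (if j is j'.+1 then comm_br x (jacobson_coef x y m' j') else 0)
      + comm_br y (jacobson_coef x y m' j)
  else if j is 0 then x else 0.

Lemma coef_iter_ad_linear (S : nzRingType) (x y : S) m j :
  (iter m (fun q => (x%:P * 'X + y%:P) * q - q * (x%:P * 'X + y%:P)) x%:P)`_j
    = jacobson_coef x y m j.
Proof.
elim: m j => [|m IH] j; first by rewrite /= coefC; case: j.
rewrite iterS; set q := iter m _ _ in IH *.
rewrite mulrDl mulrDr coefB !coefD coefMC coefCM -mulrA -commr_polyX mulrA.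
rewrite !coefMX mulrA coefMX coefMC coefCM /=.
case: j => [|j] /=; rewrite !IH /comm_br ?add0r //.
by rewrite opprD addrACA.
Qed.

Lemma deriv_exp_noncomm (S : nzRingType) (q : {poly S}) m :
  (q ^+ m)^`() = \sum_(i < m) q ^+ (m.-1 - i) * q^`() * q ^+ i.
Proof.
elim: m => [|m IH]; first by rewrite big_ord0 expr0 derivC.
rewrite exprS derivM IH big_distrr /= big_ord_recr /= subnn expr0 mul1r addrC.
congr (_ + _); apply: eq_bigr => i _; rewrite !mulrA -exprS.
by case: m i {IH} => [[]|m i] //=; rewrite subSn // -ltnS.
Qed.

(** The derivative of (x t + y)^p in t is ad(x t + y)^(p-1) applied to x. Hence j + 1 times its
    coefficient of degree j + 1 is a Jacobson coefficient, and j + 1 is invertible for j + 1 < p.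
    Setting t = 1 gives the formula. *)
Lemma jacobson_formula (k : fieldType) (p : nat) (E : algType k) (x y : E) :
  p \in [pchar k] ->
  (x + y) ^+ p = x ^+ p + y ^+ p
    + \sum_(0 <= j < p.-1) (j.+1%:R : k)^-1 *: jacobson_coef x y p.-1 j.
Proof.
move=> chark.
have p_pr : prime p := pcharf_prime chark.
have charE : p \in [pchar E] by rewrite pchar_lalg.
have charP : p \in [pchar {poly E}].
  rewrite inE p_pr /=; apply/eqP/polyP => i.
  by rewrite -polyC_natr coefC coef0 (pcharf0 charE); case: ifP.
set u : {poly E} := x%:P * 'X + y%:P.
have u' : u^`() = x%:P by rewrite derivD derivM derivX !derivC mul0r mulr1 addr0 add0r.
have coefu j : ((u ^+ p)`_j.+1) *+ j.+1 = jacobson_coef x y p.-1 j.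
  rewrite -coef_deriv deriv_exp_noncomm u' -coef_iter_ad_linear -/u.
  by rewrite iter_ad_pred_pchar.
have rec m j : (u ^+ m.+1)`_j
    = (if j is j'.+1 then x * (u ^+ m)`_j' else 0) + y * (u ^+ m)`_j.
  rewrite exprS mulrDl coefD coefCM -mulrA -commr_polyX mulrA coefMX coefCM.
  by case: j.
have u0 m : (u ^+ m)`_0 = y ^+ m.
  by elim: m => [|m IH]; rewrite ?expr0 ?coefC // rec add0r IH exprS.
have ubig m j : (m < j)%N -> (u ^+ m)`_j = 0.
  elim: m j => [|m IH] [|j] // lt_mj; first by rewrite expr0 coefC.
  by rewrite rec !IH ?mulr0 ?addr0 // ltnW.
have ulead m : (u ^+ m)`_m = x ^+ m.
  elim: m => [|m IH]; first by rewrite !expr0 coefC.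
  by rewrite rec IH ubig // mulr0 addr0 exprS.
(* Evaluation at t = 1, written as the sum of the coefficients. *)
have sumu m : \sum_(j < m.+1) (u ^+ m)`_j = (x + y) ^+ m.
  elim: m => [|m IH]; first by rewrite big_ord1 !expr0 coefC.
  under eq_bigr do rewrite rec.
  rewrite big_split /=.
  rewrite big_ord_recl add0r [X in _ + X]big_ord_recr /= [X in _ + X]addrC.
  rewrite ubig // mulr0 add0r.
  by rewrite exprS mulrDl -IH !big_distrr.
rewrite -sumu -(big_mkord xpredT (fun j => (u ^+ p)`_j)) big_nat_recr //= ulead.
rewrite big_ltn ?prime_gt0 // big_add1 u0 addrC addrA; congr (_ + _).
rewrite !big_mkord; apply: eq_bigr => i _; rewrite -coefu.
rewrite -scaler_nat scalerA mulVf ?scale1r // -(dvdn_pcharf chark).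
by apply/negP => /(dvdn_leq (ltn0Sn i)); rewrite leqNgt -ltn_predRL ltn_ord.
Qed.

(** * Representations of p(n) *)

Section Elementary.
Variables (k : fieldType) (n : nat).
Notation M := 'M[k]_n.+1.
Notation E_ i j := (delta_mx i j : M).

Lemma delta_mulE (i j l m : 'I_n.+1) :
  E_ i j * E_ l m = (j == l)%:R *: E_ i m.
Proof. by rewrite -mulmxE mul_delta_mx_cond scaler_nat. Qed.

Lemma mxtrace_delta (i j : 'I_n.+1) : \tr (E_ i j) = (i == j)%:R.
Proof.
rewrite /mxtrace (bigD1 i) //= big1 => [|l /negPf ne]; rewrite mxE ?ne //.
by rewrite eqxx addr0.
Qed.

Lemma mxtrace_mul_delta (A : M) i j : \tr (A * E_ i j) = A j i.
Proof.
rewrite -mulmxE /mxtrace (bigD1 j) //= big1 => [|l ne].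
  rewrite mxE (bigD1 i) //= big1 => [|m ne]; first by rewrite mxE !eqxx mulr1 !addr0.
  by rewrite mxE (negPf ne) mulr0.
by rewrite mxE big1 // => m _; rewrite mxE (negPf ne) andbF mulr0.
Qed.

Lemma mxtraceM_comm (A B : M) : \tr (A * B - B * A) = 0.
Proof. by rewrite linearB /= (mxtrace_mulC A B : \tr (A * B) = \tr (B * A)) subrr. Qed.

(** Transposition turns this trace into its opposite. *)
Lemma mxtrace_symM_alt (B C : M) : 2%:R != 0 :> k ->
  \tr ((B + B^T) * (C - C^T)) = 0.
Proof.
move=> two; set T := \tr _.
have TN : T = - T.
  rewrite {1}/T -mxtrace_tr [_^T](trmx_mul (B + B^T) (C - C^T)) linearB linearD /=.
  by rewrite !trmxK [B^T + B]addrC -(opprB C) mulNmx linearN /= mxtrace_mulC.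
apply/eqP; move/eqP: TN; rewrite -subr_eq0 opprK -mulr2n -mulr_natr mulf_eq0.
by rewrite (negPf two) orbF.
Qed.

(* E_ij corrected to trace zero; it vanishes at i = j = ord_max. *)
Definition sl_delta (i j : 'I_n.+1) : M :=
  E_ i j - (i == j)%:R *: E_ ord_max ord_max.

Lemma mxtrace_sl_delta i j : \tr (sl_delta i j) = 0.
Proof. by rewrite linearB linearZ /= !mxtrace_delta eqxx mulr1 subrr. Qed.

Lemma sl_delta_offdiag i j : i != j -> sl_delta i j = E_ i j.
Proof. by move=> /negPf ne; rewrite /sl_delta ne scale0r subr0. Qed.

Lemma delta_diag_mulE l x y : E_ l l * E_ x y = (l == x)%:R *: E_ x y.
Proof. by rewrite delta_mulE; case: eqP => [->|]; rewrite ?scale0r. Qed.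

Lemma delta_mul_diagE l x y : E_ x y * E_ l l = (l == y)%:R *: E_ x y.
Proof. by rewrite delta_mulE eq_sym; case: eqP => [->|]; rewrite ?scale0r. Qed.

Lemma sl_delta_diag_br l x y : exists r : k,
  sl_delta l l * E_ x y - E_ x y * sl_delta l l = r *: E_ x y.
Proof.
rewrite /sl_delta eqxx scale1r mulrBl mulrBr !delta_diag_mulE !delta_mul_diagE.
by rewrite -!scalerBl; eexists.
Qed.

Lemma sl_delta_diag_comm i j : sl_delta i i * sl_delta j j = sl_delta j j * sl_delta i i.
Proof.
have cD (x y : 'I_n.+1) : GRing.comm (E_ x x) (E_ y y).
  by rewrite /GRing.comm !delta_mulE [y == x]eq_sym; case: eqP => [->|] //; rewrite !scale0r.
rewrite /sl_delta !eqxx !scale1r.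
by apply: commrB; apply/commr_sym/commrB; apply: cD.
Qed.

Lemma sl_sum (A : M) : \tr A = 0 -> A = \sum_i \sum_j A i j *: sl_delta i j.
Proof.
move=> A0; rewrite /sl_delta; under eq_bigr => i _ do
  (under eq_bigr do rewrite scalerBr; rewrite sumrB).
rewrite sumrB -matrix_sum_delta.
rewrite [X in _ - X](_ : _ = \tr A *: E_ ord_max ord_max); last first.
  rewrite scaler_suml; apply: eq_bigr => i _; rewrite (bigD1 i) //= eqxx scale1r.
  rewrite big1 ?addr0 // => j /negPf ne.
  by rewrite eq_sym ne scale0r scaler0.
by rewrite A0 scale0r subr0.
Qed.
End Elementary.

Definition low_pair (n : nat) : finType :=
  {ij : 'I_n.+1 * 'I_n.+1 | (ij.2 < ij.1)%N}.

(* The PBW generators of the negative part: odd ones (true) and even ones. *)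
Definition neg_index (n : nat) : finType := (bool * low_pair n)%type.

Definition neg_bound (p n : nat) (t : neg_index n) : nat := if t.1 then 2 else p.

Definition kw_bound (p n : nat) : nat := (\prod_(t : neg_index n) neg_bound p t)%N.

(* a is only meaningful on trace zero matrices; b and c encode the symmetric
   matrix B + B^T and the alternating matrix C - C^T. *)
Record periplectic_rep (k : fieldType) (n : nat) (E : algType k)
    (a b c : {linear 'M[k]_n.+1 -> E}) : Prop := PeriplecticRep {
  rep_aa : forall A A', \tr A = 0 -> \tr A' = 0 ->
    a A * a A' - a A' * a A = a (A * A' - A' * A);
  rep_ab : forall A B, \tr A = 0 ->
    a A * b B - b B * a A = b (A * B + B * A^T);
  rep_ac : forall A C, \tr A = 0 ->
    a A * c C - c C * a A = - c (A^T * C + C * A);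
  rep_bb : forall B B', b B * b B' + b B' * b B = 0;
  rep_cc : forall C C', c C * c C' + c C' * c C = 0;
  rep_bc : forall B C, b B * c C + c C * b B = a ((B + B^T) * (C - C^T));
  rep_bT : forall B, b B^T = b B;
  rep_cT : forall C, c C^T = - c C
}.

Section RepTheory.
Variables (k : fieldType) (n : nat) (E : algType k).
Variables (a b c : {linear 'M[k]_n.+1 -> E}).
Hypothesis rep : periplectic_rep a b c.
Hypothesis two : 2%:R != 0 :> k.

Lemma rep_sqr0 (x : E) : x * x + x * x = 0 -> x * x = 0.
Proof.
rewrite -mulr2n -scaler_nat => /eqP; rewrite scaler_eq0 (negPf two) /=.
by move/eqP.
Qed.

Lemma rep_b2 B : b B * b B = 0. Proof. exact/rep_sqr0/(rep_bb rep). Qed.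
Lemma rep_c2 C : c C * c C = 0. Proof. exact/rep_sqr0/(rep_cc rep). Qed.

Lemma rep_c_diag i : c (delta_mx i i) = 0.
Proof.
have := rep_cT rep (delta_mx i i); rewrite trmx_delta => /eqP.
rewrite -subr_eq0 opprK -mulr2n -scaler_nat scaler_eq0 (negPf two) /=.
by move/eqP.
Qed.

Lemma rep_a_sum A : \tr A = 0 -> a A = \sum_i \sum_j A i j *: a (sl_delta k i j).
Proof.
move=> A0; rewrite {1}(sl_sum A0) linear_sum; apply: eq_bigr => i _.
by rewrite linear_sum; apply: eq_bigr => j _; rewrite linearZ.
Qed.

Lemma rep_lin_sum (f : {linear 'M[k]_n.+1 -> E}) B :
  f B = \sum_i \sum_j B i j *: f (delta_mx i j).
Proof.
rewrite {1}[B]matrix_sum_delta linear_sum; apply: eq_bigr => i _.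
by rewrite linear_sum; apply: eq_bigr => j _; rewrite linearZ.
Qed.

(** Jacobson coefficients are Lie polynomials, hence transported by [a]. The trace is carried along
    because [rep_aa] only speaks of trace zero matrices. *)
Lemma jacobson_coef_rep A A' m j : \tr A = 0 -> \tr A' = 0 ->
  a (jacobson_coef A A' m j) = jacobson_coef (a A) (a A') m j
  /\ \tr (jacobson_coef A A' m j) = 0.
Proof.
move=> A0 A'0; elim: m j => [|m IH] [|j] /=; rewrite ?linear0 //.
  have [<- t] := IH 0%N; rewrite !add0r /comm_br (rep_aa rep) //.
  by split=> //; apply: mxtraceM_comm.
have [<- t] := IH j; have [<- t'] := IH j.+1.
rewrite /comm_br linearD /= -!(rep_aa rep) //.
by rewrite mxtraceD !mxtraceM_comm addr0.
Qed.
End RepTheory.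

(** * Triangularization *)

(** A left eigenvector, taken as first row of the base change, clears the first row of the conjugate
    beyond its diagonal entry; the lower right block is left to induction. *)
Lemma lower_triangularizable (k : closedFieldType) n (A : 'M[k]_n) :
  exists P P' : 'M_n, P *m P' = 1%:M /\
    forall i j : 'I_n, (i < j)%N -> (P *m A *m P') i j = 0.
Proof.
elim: n A => [|n IH] A; first by exists 1%:M, 1%:M; split=> [|[]]; rewrite ?mulmx1.
have /closed_rootP [a] : size (char_poly A) != 1%N by rewrite size_char_poly.
rewrite -eigenvalue_root_char => /eigenvalueP [u uA u0].
(* [row_ebase u] completes the eigenvector to a basis: it is invertible and its first row is
   proportional to [u]. *)
pose P := row_ebase u; have Pu : P \in unitmx := row_ebase_unit u.
have Pa : row 0 P *m A = a *: row 0 P.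
  have [c [c0 ->]] : exists c, c != 0 /\ row 0 P = c *: u; last first.
    by rewrite -scalemxAl uA !scalerA mulrC.
  have r1 : \rank u = 1%N by rewrite rank_rV u0.
  have := mulmx_ebase u; rewrite r1 [col_ebase u]mx11_scalar mul_scalar_mx.
  have -> : pid_mx 1 = delta_mx 0 0 :> 'rV[k]_n.+1.
    by apply/rowP => j; rewrite !mxE eqxx andbT eq_sym -val_eqE; case: j => [[|j] ?].
  rewrite -scalemxAl -rowE -/P => <-; exists ((col_ebase u) 0 0)^-1.
  have c0 : (col_ebase u) 0 0 != 0.
    have := col_ebase_unit u; rewrite unitmxE det_mx11.
    by rewrite unitfE.
  by rewrite invr_eq0 c0 scalerA mulVf ?scale1r.
have [B eB] : exists B, B = P *m A *m invmx P by exists (P *m A *m invmx P).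
have B0 : row 0 B = a *: delta_mx 0 0.
  by rewrite eB !row_mul Pa -scalemxAl -row_mul mulmxV // row1.
have [Q [Q' [QQ' QB]]] := IH (@drsubmx _ 1 n 1 n B).
pose R : 'M[k]_(1 + n) := block_mx 1%:M 0 0 Q.
pose R' : 'M[k]_(1 + n) := block_mx 1%:M 0 0 Q'.
exists (R *m P), (invmx P *m R'); split.
  rewrite mulmxA -[R *m P *m _]mulmxA mulmxV // mulmx1.
  rewrite [LHS](@mulmx_block _ 1 n 1 n 1 n) !mulmx0 !mul0mx !addr0 !add0r mulmx1 QQ'.
  exact/esym/(@scalar_mx_block _ 1 n).
have ur0 : @ursubmx _ 1 n 1 n B = 0.
  apply/matrixP => i j; rewrite !mxE (_ : lshift n i = 0); last by apply/val_inj; rewrite ord1.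
  by have := congr1 (fun r : 'rV_n.+1 => r 0 (rshift 1 j)) B0; rewrite !mxE mulr0.
move=> i j lt_ij.
have -> : R *m P *m A *m (invmx P *m R') = R *m B *m R' by rewrite eB !mulmxA.
rewrite -[B](@submxK _ 1 n 1 n) ur0.
rewrite (@mulmx_block _ 1 n 1 n 1 n) (@mulmx_block _ 1 n 1 n 1 n).
rewrite !(mulmx0, mul0mx, addr0, add0r).
case: (@split_ordP 1 n i) lt_ij => i' ->; case: (@split_ordP 1 n j) => j' -> /=.
- by rewrite !ord1.
- by rewrite (@block_mxEur _ 1 n 1 n) mxE.
- by rewrite ord1.
by rewrite (@block_mxEdr _ 1 n 1 n) ltn_add2l; apply: QB.
Qed.

Lemma upper_triangularizable (k : closedFieldType) n (A : 'M[k]_n) :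
  exists P P' : 'M_n, P *m P' = 1%:M /\
    forall i j : 'I_n, (j < i)%N -> (P *m A *m P') i j = 0.
Proof.
have [P [P' [PP' PA]]] := lower_triangularizable A^T.
exists P'^T, P^T; split; first by rewrite -trmx_mul PP' trmx1.
move=> i j /PA <-.
by rewrite -[in LHS](trmxK (_ *m P^T)) mxE trmx_mul trmxK trmx_mul trmxK mulmxA.
Qed.

(** * Noether normalization *)

(** The submodule generated by [S] under the operators [Z]. Being an inductive predicate, it accepts
    any collection of maps as [Z], including the empty one, where it is the linear span. *)
Inductive gen_by (k : fieldType) (V : lmodType k) (Z : (V -> V) -> Prop)
    (S : V -> Prop) : V -> Prop :=
| gen_by_in v : S v -> gen_by Z S v
| gen_by_0 : gen_by Z S 0
| gen_by_lin (a : k) u v : gen_by Z S u -> gen_by Z S v -> gen_by Z S (a *: u + v)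
| gen_by_op z v : Z z -> gen_by Z S v -> gen_by Z S (z v).

Section GenBy.
Variables (k : fieldType) (V : lmodType k).
Implicit Types (Z : (V -> V) -> Prop) (S : V -> Prop).

Lemma gen_byD Z S u v : gen_by Z S u -> gen_by Z S v -> gen_by Z S (u + v).
Proof. by move=> gu gv; rewrite -[u]scale1r; apply: gen_by_lin. Qed.

Lemma gen_byZ Z S a v : gen_by Z S v -> gen_by Z S (a *: v).
Proof. by move=> gv; rewrite -[_ *: _]addr0; apply: gen_by_lin gv (gen_by_0 _ _). Qed.

Lemma gen_byN Z S v : gen_by Z S v -> gen_by Z S (- v).
Proof. by move=> gv; rewrite -scaleN1r; apply: gen_byZ. Qed.

Lemma gen_byB Z S u v : gen_by Z S u -> gen_by Z S v -> gen_by Z S (u - v).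
Proof. by move=> gu gv; apply: gen_byD => //; apply: gen_byN. Qed.

Lemma gen_by_sum Z S I (r : seq I) (P : pred I) (F : I -> V) :
  (forall i, P i -> gen_by Z S (F i)) -> gen_by Z S (\sum_(i <- r | P i) F i).
Proof.
by move=> gF; elim/big_rec: _ => [|i x Pi gx]; [apply: gen_by_0 | apply: gen_byD; auto].
Qed.

Lemma gen_by_trans Z S Z' S' v :
  (forall u, S u -> gen_by Z' S' u) ->
  (forall z u, Z z -> gen_by Z' S' u -> gen_by Z' S' (z u)) ->
  gen_by Z S v -> gen_by Z' S' v.
Proof.
move=> hS hZ; elim=> {v} [v /hS //| | a u v _ gu _ gv | z v Zz _ /hZ]; last exact.
  exact: gen_by_0.
exact: gen_by_lin.
Qed.

Lemma gen_byS Z S Z' S' v :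
  (forall u, S u -> S' u) -> (forall z, Z z -> Z' z) ->
  gen_by Z S v -> gen_by Z' S' v.
Proof.
move=> hS hZ; apply: gen_by_trans => [u /hS|z u /hZ Zz gu]; first exact: gen_by_in.
exact: gen_by_op.
Qed.
End GenBy.

Section DigitSum.
Variables (D m : nat).

(** Uniqueness of base [D] digits; it separates the monomials of bounded degree by their weights in
    Noether's substitution. *)
Lemma digit_sum_inj (a b : 'I_m -> nat) :
  (forall i, a i < D)%N -> (forall i, b i < D)%N ->
  (\sum_(i < m) a i * D ^ i = \sum_(i < m) b i * D ^ i)%N -> a =1 b.
Proof.
elim: m a b => [|m' IH] a b aD bD; first by move=> _ [].
rewrite !big_ord_recl /= !expn0 !muln1.
have E (c : 'I_m'.+1 -> nat) : (\sum_(i < m') c (lift ord0 i) * D ^ bump 0 i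
    = (\sum_(i < m') c (lift ord0 i) * D ^ i) * D)%N.
  by rewrite big_distrl; apply: eq_bigr => i _; rewrite /bump /= add1n expnSr mulnA.
rewrite !E => e.
have D0 : (0 < D)%N by apply: leq_trans (aD ord0).
have e0 : a ord0 = b ord0.
  have := congr1 (modn^~ D) e.
  by rewrite ![(_ ord0 + _)%N]addnC !modnMDl !modn_small.
move: e; rewrite e0 => /addnI/eqP; rewrite eqn_pmul2r // => /eqP e.
have {}IH := IH _ _ (fun i => aD (lift ord0 i)) (fun i => bD (lift ord0 i)) e.
by move=> i; case: (unliftP ord0 i) => [j|] -> //; apply: IH.
Qed.
End DigitSum.

Section Noether.
Import mpoly.
Variables (k : fieldType) (V : lmodType k) (v0 : V) (nz : v0 != 0).
Notation E := (lin_end nz).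
Variable C : E -> Prop.
Hypothesis C1 : C 1.
Hypothesis CD : forall x y, C x -> C y -> C (x + y).
Hypothesis CM : forall x y, C x -> C y -> C (x * y).
Hypothesis CZ : forall a x, C x -> C (a *: x).
Hypothesis C_comm : forall x y, C x -> C y -> x * y = y * x.
Hypothesis C_surj : forall x, C x -> x = 0 \/ forall v, exists u, v = x u.

Lemma CX x i : C x -> C (x ^+ i).
Proof. by move=> Cx; elim: i => [|i IH]; rewrite ?expr0 // exprS; apply: CM. Qed.

Lemma CB x y : C x -> C y -> C (x - y).
Proof. by move=> Cx Cy; rewrite -scaleN1r; apply: CD => //; apply: CZ. Qed.

Section Eval.
Variables (m : nat) (h : 'I_m -> E).
Hypothesis Ch : forall i, C (h i).

Definition ev (f : {mpoly k[m]}) : E := mmap (GRing.in_alg E) h f.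

Lemma evE f : ev f = \sum_(a <- msupp f) f@_a *: mmap1 h a.
Proof. by apply: eq_bigr => a _; rewrite /= -scalerAl mul1r. Qed.

Lemma evD f g : ev (f + g) = ev f + ev g.
Proof. exact: mmapD. Qed.

Lemma evB f g : ev (f - g) = ev f - ev g.
Proof. exact: mmapB. Qed.

Lemma ev_sum I (r : seq I) P (F : I -> {mpoly k[m]}) :
  ev (\sum_(i <- r | P i) F i) = \sum_(i <- r | P i) ev (F i).
Proof. by rewrite /ev raddf_sum. Qed.

Lemma mmap1_mul a b : mmap1 h (a + b)%MM = mmap1 h a * mmap1 h b.
Proof.
rewrite /mmap1.
suff [] : \prod_(i < m) h i ^+ (a + b)%MM i
        = (\prod_(i < m) h i ^+ a i) * (\prod_(i < m) h i ^+ b i)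
        /\ C (\prod_(i < m) h i ^+ a i) by [].
elim/big_rec3: _ => [|i x y z _ [-> Cx]]; first by rewrite mulr1.
split; last by apply: CM => //; apply: CX.
rewrite mnmDE exprD -!mulrA; congr (_ * _); rewrite !mulrA; congr (_ * _).
exact: C_comm (CX _ _) _.
Qed.

Lemma evM f g : ev (f * g) = ev f * ev g.
Proof.
rewrite {1}[f]mpolyE {1}[g]mpolyE big_distrlr /= ev_sum !evE big_distrlr /=.
apply: eq_bigr => a _; rewrite ev_sum; apply: eq_bigr => b _.
rewrite -scalerAl -scalerAr -mpolyXD scalerA /ev mmapZ mmapX mmap1_mul.
by rewrite -scalerAl mul1r -scalerAl -scalerAr scalerA.
Qed.

Lemma evX i : ev 'X_i = h i.
Proof. by rewrite /ev mmapX mmap1U. Qed.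

Lemma evC c : ev c%:MP = c *: 1.
Proof. by rewrite /ev mmapC. Qed.

End Eval.

Definition ops m (h : 'I_m -> E) (f : V -> V) : Prop := exists i, f = h i.

Section Normalize.
Variables (m : nat) (h : 'I_m.+1 -> E).
Hypothesis Ch : forall i, C (h i).
Variable D : nat.
Hypothesis D0 : (0 < D)%N.

(** Noether's change of variables. The exponent is [i.+1] because [lift ord0 i] has index i + 1, so
    the weight of the variable of index i is D^i, including index 0. *)
Definition shifted (i : 'I_m) : E := h (lift ord0 i) - h ord0 ^+ (D ^ i.+1).

Lemma C_shifted i : C (shifted i).
Proof. by apply: CB => //; apply: CX. Qed.

Definition low_powers (w : nat) (s : V) (u : V) : Prop :=
  exists2 j, (j < w)%N & u = (h ord0 ^+ j) s.

Notation G w s := (gen_by (ops shifted) (low_powers w s)).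

Lemma low_powers_shift j w s v : G w s v -> G (w + j) s ((h ord0 ^+ j) v).
Proof.
elim=> {v} [v [i lt_iw ->]| |a u v _ gu _ gv|z v [i ->] _ gv].
- by apply: gen_by_in; exists (j + i)%N; rewrite ?exprD // addnC ltn_add2r.
- by rewrite linear0; apply: gen_by_0.
- by rewrite linearP; apply: gen_by_lin.
rewrite -mulEv (C_comm (CX j (Ch _)) (C_shifted i)) mulEv.
by apply: gen_by_op gv; exists i.
Qed.

Lemma low_powersW w w' s v : (w <= w')%N -> G w s v -> G w' s v.
Proof.
move=> le_ww'; apply: gen_byS => // u [j lt_jw ->].
by exists j => //; apply: leq_trans le_ww'.
Qed.

Lemma monomial_leading (s : V) (a : 'X_{1..m.+1}) :
  G (\sum_(i < m.+1) a i * D ^ i) s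
    (mmap1 h a s - (h ord0 ^+ (\sum_(i < m.+1) a i * D ^ i)%N) s).
Proof.
rewrite /mmap1; elim/big_rec2: _ => [|i T w _].
  by rewrite expr0 subrr; apply: gen_by_0.
elim: (a i) => [|c IH] GT; first by rewrite expr0 mul1r mul0n add0n.
have {IH} := IH GT; move=> {}GT; set w' := (c * D ^ i + w)%N in GT.
rewrite mulSn -addnA -/w' exprS -mulrA mulEv; set T' := h i ^+ c * T in GT *.
have [i0|[i' ei]] : i = ord0 \/ exists i', i = lift ord0 i'.
  by case: (unliftP ord0 i) => [j|] ->; [right; exists j | left].
  rewrite i0 expn0 add1n exprS mulEv -linearB -[h ord0]expr1 -addn1.
  exact: low_powers_shift.
have -> : h i = shifted i' + h ord0 ^+ (D ^ i).
  by rewrite /shifted {2}ei /= /bump /= add1n subrK ei.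
rewrite addEv exprD mulEv -addrA -linearB; apply: gen_byD; last first.
  by rewrite addnC; apply: low_powers_shift.
have -> : T' s = (T' s - (h ord0 ^+ w') s) + (h ord0 ^+ w') s by rewrite subrK.
rewrite linearD; apply: gen_byD; (apply: gen_by_op; first by exists i').
  by apply: low_powersW GT; rewrite leq_addl.
apply: gen_by_in; exists w' => //.
by rewrite -[ltnLHS]add0n ltn_add2r expn_gt0 D0.
Qed.

(** The monomials of [f] have exponents below [D], hence distinct weights. The one of largest weight
    is then the only source of the top power of [h ord0], and its nonzero coefficient can be divided
    out. *)
Lemma top_power_low (f : {mpoly k[m.+1]}) (s : V) :
  f != 0 -> (msize f <= D)%N -> ev h f s = 0 ->
  exists w, G w s ((h ord0 ^+ w) s).
Proof.
move=> f0 fD fs; pose wt (a : 'X_{1..m.+1}) := (\sum_(i < m.+1) a i * D ^ i)%N.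
have wt_inj : {in msupp f &, injective wt}.
  move=> a b af bf e; apply/mnmP; apply: (digit_sum_inj (D := D)) e => i.
    apply: leq_trans fD; apply: leq_ltn_trans (msize_mdeg_lt af).
    by rewrite mdegE (bigD1 i) //= leq_addr.
  apply: leq_trans fD; apply: leq_ltn_trans (msize_mdeg_lt bf).
  by rewrite mdegE (bigD1 i) //= leq_addr.
have [a af amax] : exists2 a, a \in msupp f & {in msupp f, forall b, (wt b <= wt a)%N}.
  have : msupp f != [::] by rewrite -msupp_eq0 in f0.
  elim: (msupp f) => // b l IH _; case: l IH => [|c l] IH.
    by exists b; rewrite ?mem_head // => c; rewrite inE => /eqP ->.
  have [a al amax] := IH isT; have [le_ab|lt_ba] := leqP (wt b) (wt a).
    exists a; first by rewrite inE al orbT.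
    by move=> d; rewrite inE => /predU1P [->|/amax].
  exists b; first by rewrite mem_head.
  move=> d; rewrite inE => /predU1P [->//|/amax]; move/leq_trans; apply; exact: ltnW.
exists (wt a); have fa : f@_a != 0 by rewrite -mcoeff_msupp.
rewrite -[X in gen_by _ _ X]scale1r -(mulVf fa) -scalerA; apply: gen_byZ.
have : f@_a *: mmap1 h a s + \sum_(b <- msupp f | b != a) f@_b *: mmap1 h b s = 0.
  by move: fs; rewrite evE sumEv (bigD1_seq a) ?msupp_uniq.
move/eqP; rewrite addr_eq0 => /eqP e.
have -> : f@_a *: (h ord0 ^+ wt a) s = - (f@_a *: (mmap1 h a s - (h ord0 ^+ wt a) s))
    - \sum_(b <- msupp f | b != a) f@_b *: mmap1 h b s.
  by rewrite -e scalerBr opprB addrNK.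
apply: gen_byB; first by apply/gen_byN/gen_byZ/monomial_leading.
rewrite big_seq_cond; apply: gen_by_sum => b /andP [bf ne_ba]; apply: gen_byZ.
have lt_ba : (wt b < wt a)%N.
  by rewrite ltn_neqAle amax // andbT; apply: contra ne_ba => /eqP /wt_inj -> //.
rewrite -[X in gen_by _ _ X](subrK ((h ord0 ^+ wt b) s)); apply: gen_byD.
  by apply: low_powersW (monomial_leading s b); apply: ltnW.
by apply: gen_by_in; exists (wt b).
Qed.

(** The hypothesis is a monic relation of degree [w], so the one power that leaves the allowed range
    is brought back. *)
Lemma low_powers_stable w s v :
  G w s ((h ord0 ^+ w) s) -> G w s v -> G w s (h ord0 v).
Proof.
move=> top; elim=> {v} [v [i lt_iw ->]| |a u v _ gu _ gv|z v [i ->] _ gv].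
- rewrite -mulEv -exprS; move: lt_iw; rewrite leq_eqVlt => /predU1P [->//|lt_iw].
  by apply: gen_by_in; exists i.+1.
- by rewrite linear0; apply: gen_by_0.
- by rewrite linearP; apply: gen_by_lin.
rewrite -mulEv (C_comm (Ch _) (C_shifted i)) mulEv.
by apply: gen_by_op gv; exists i.
Qed.
End Normalize.

Lemma gen_by_ev m (h : 'I_m -> E) (s : seq V) v :
  (forall i, C (h i)) -> gen_by (ops h) (fun u => u \in s) v ->
  exists a : 'I_(size s) -> {mpoly k[m]}, v = \sum_i ev h (a i) s`_i.
Proof.
move=> Ch; elim=> {v} [v vs| |c u v _ [a ->] _ [b ->]|z v [i ->] _ [a ->]].
- have lt_v : (index v s < size s)%N by rewrite index_mem.
  exists (fun i => if i == Ordinal lt_v then 1 else 0).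
  rewrite (bigD1 (Ordinal lt_v)) //= eqxx big1 => [|i /negPf ->].
    by rewrite (evC h 1) scale1r addr0 nth_index.
  by rewrite (evC h 0) scale0r.
- exists (fun=> 0); rewrite big1 // => i _.
  by rewrite (evC h 0) scale0r.
- exists (fun i => c%:MP * a i + b i).
  rewrite scaler_sumr -big_split; apply: eq_bigr => i _.
  by rewrite evD evM // evC addEv -scalerAl mul1r.
exists (fun j => 'X_i * a j); rewrite linear_sum; apply: eq_bigr => j _.
by rewrite evM // evX.
Qed.

(* Nakayama: h 0 V = V makes det (1 - 'X_0 A) kill V, and this polynomial is 1 at 0. *)
Lemma surjective_relation m (h : 'I_m.+1 -> E) (s : seq V) :
  (forall i, C (h i)) ->
  (forall v, gen_by (ops h) (fun u => u \in s) v) ->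
  (forall v, exists u, v = h ord0 u) ->
  exists2 f : {mpoly k[m.+1]}, f != 0 & forall i : 'I_(size s), ev h f s`_i = 0.
Proof.
move=> Ch sV surj; set r := size s.
have /fin_all_exists [A hA] : forall i : 'I_r, exists a : 'I_r -> {mpoly k[m.+1]},
    s`_i = h ord0 (\sum_j ev h (a j) s`_j).
  move=> i; have [u ->] := surj s`_i; have [a ua] := gen_by_ev Ch (sV u).
  by exists a; rewrite -ua.
pose M : 'M_r := 1%:M - 'X_ord0 *: \matrix_(i, j) A i j.
have Ms i : \sum_j ev h (M i j) s`_j = 0.
  transitivity (\sum_j (ev h (i == j)%:R s`_j - h ord0 (ev h (A i j) s`_j))).
    apply: eq_bigr => j _; by rewrite !mxE evB evM // evX.
  rewrite sumrB (_ : \sum_j h ord0 _ = s`_i); last by rewrite -linear_sum [RHS]hA.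
  rewrite (bigD1 i) //= eqxx big1 => [|j /negPf ne].
    by rewrite (evC h 1) scale1r addr0 subrr.
  by rewrite eq_sym ne (evC h 0) scale0r.
exists (\det M) => [|l].
  apply/eqP => /(congr1 (meval (fun=> 0))); rewrite -det_map_mx.
  suff -> : map_mx (meval (fun=> 0)) M = 1%:M by rewrite det1 meval0 => /eqP; rewrite oner_eq0.
  apply/matrixP => i j; rewrite !mxE mevalB mevalM mevalXU mul0r subr0.
  exact: rmorph_nat.
have -> : ev h (\det M) s`_l = \sum_j ev h ((\adj M *m M) l j) s`_j.
  rewrite (bigD1 l) //= big1 => [|j /negPf ne]; rewrite mul_adj_mx mxE.
    by rewrite eqxx mulr1n addr0.
  by rewrite eq_sym ne mulr0n (evC h 0) scale0r.
under eq_bigr do rewrite mxE ev_sum sumEv.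
rewrite exchange_big big1 // => i _ /=.
under eq_bigr do rewrite evM // mulEv.
by rewrite -linear_sum Ms linear0.
Qed.

(** Induction on the number of operators. If [h ord0] is zero it is dropped. Otherwise it is
    surjective, the resulting relation makes every generator integral over the shifted operators,
    and finitely many powers of [h ord0] applied to the generators suffice. *)
Lemma noether_finite m (h : 'I_m -> E) (s : seq V) :
  (forall i, C (h i)) ->
  (forall v, gen_by (ops h) (fun u => u \in s) v) ->
  exists t : seq V, forall v, gen_by (fun=> False) (fun u => u \in t) v.
Proof.
elim: m h s => [|m IH] h s Ch sV.
  by exists s => v; apply: gen_byS (sV v) => // z [[]].
have [h0|surj] := C_surj (Ch ord0).
  apply: (IH (fun i => h (lift ord0 i)) s) => // v.
  apply: gen_by_trans (sV v) => [u|z u]; first exact: gen_by_in.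
  case=> i ->; case: (unliftP ord0 i) => [j|] -> gu.
    by apply: gen_by_op gu; exists j.
  by rewrite h0 zeroEv; apply: gen_by_0.
have [f f0 fs] := surjective_relation Ch sV surj.
pose D := (msize f).+1.
have /fin_all_exists [w hw] : forall i : 'I_(size s), exists w,
    gen_by (ops (shifted h D)) (low_powers h w s`_i) ((h ord0 ^+ w) s`_i).
  by move=> i; apply: (@top_power_low m h Ch D _ f).
pose t := flatten [seq [seq (h ord0 ^+ j) s`_i | j <- iota 0 (w i)] | i : 'I_(size s)].
apply: (IH (shifted h D) t (C_shifted Ch D)).
have sub (i : 'I_(size s)) u : gen_by (ops (shifted h D)) (low_powers h (w i) s`_i) u ->
    gen_by (ops (shifted h D)) (fun u => u \in t) u.
  apply: gen_byS => // {}u [j lt_j ->]; apply/flattenP.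
  exists [seq (h ord0 ^+ j) s`_i | j <- iota 0 (w i)]; last first.
    by apply: map_f; rewrite mem_iota.
  by apply: map_f; rewrite mem_enum.
have st0 u : gen_by (ops (shifted h D)) (fun u => u \in t) u ->
    gen_by (ops (shifted h D)) (fun u => u \in t) (h ord0 u).
  elim=> {u} [u /flattenP [_ /mapP [i _ ->] /mapP [j]]| |a u v _ gu _ gv|z u [i ->] _ gu].
  - rewrite mem_iota => /= lt_j ->; apply: (sub i); apply: low_powers_stable => //.
    by apply: gen_by_in; exists j.
  - by rewrite linear0; apply: gen_by_0.
  - by rewrite linearP; apply: gen_by_lin.
  rewrite -mulEv (C_comm (Ch _) (C_shifted Ch D i)) mulEv.
  by apply: gen_by_op gu; exists i.
move=> v; apply: gen_by_trans (sV v) => [u us|z u [i ->] gu].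
  have lt_u : (index u s < size s)%N by rewrite index_mem.
  rewrite -(nth_index 0 us); apply: (sub (Ordinal lt_u)) => /=.
  (* For exponent 0 the list of powers is empty, and the integrality relation itself already places
     the generator in the span. *)
  case: (posnP (w (Ordinal lt_u))) => [w0|w0].
    by have := hw (Ordinal lt_u); rewrite w0 expr0.
  by apply: gen_by_in; exists 0.
case: (unliftP ord0 i) => [j|] -> ; last exact: st0.
have -> : h (lift ord0 j) = shifted h D j + h ord0 ^+ (D ^ j.+1) by rewrite subrK.
rewrite addEv; apply: gen_byD; first by apply: gen_by_op gu; exists j.
by elim: (D ^ _)%N => // c IHc; rewrite exprS; apply: st0.
Qed.
End Noether.

(** * Ordered monomials *)

Section Words.
Variables (k : fieldType) (V : lmodType k) (v0 : V) (nz : v0 != 0).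
Notation E := (lin_end nz).
Variables (I : finType) (x : I -> E) (e : I -> nat) (Z : E -> Prop) (v : V).
Hypothesis Zx : forall z i, Z z -> z * x i = x i * z.
Hypothesis e_gt1 : forall i, (1 < e i)%N.
Hypothesis x_swap : forall i j, exists (a : k) (c : I -> k),
  x i * x j = a *: (x j * x i) + \sum_l c l *: x l.
Hypothesis x_pow : forall i, exists (z : E) (c : I -> k),
  Z z /\ x i ^+ e i = z + \sum_l c l *: x l.

Definition word (w : seq I) : V := foldr (fun i u => x i u) v w.

Definition Zop (f : V -> V) : Prop := exists2 z : E, Z z & f = z.

(** The PBW filtration by word length, with coefficients in [Z]. By [x_swap] the generators commute
    up to a scalar modulo lower degree, which treats even and odd generators alike. *)
Definition filt (d : nat) : V -> Prop :=
  gen_by Zop (fun u => exists2 w, (size w <= d)%N & u = word w).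

Lemma filt_x d i u : filt d u -> filt d.+1 (x i u).
Proof.
elim=> {u} [_ [w sw ->]| |a u u' _ gu _ gu'|_ u [z Zz ->] _ gu].
- by apply: gen_by_in; exists (i :: w).
- by rewrite linear0; apply: gen_by_0.
- by rewrite linearP; apply: gen_by_lin.
by rewrite -mulEv -Zx // mulEv; apply: gen_by_op gu; exists z.
Qed.

Lemma filt_sum d (c : I -> k) u : filt d u -> filt d.+1 ((\sum_l c l *: x l) u).
Proof.
by move=> gu; rewrite sumEv; apply: gen_by_sum => l _; apply/gen_byZ/filt_x.
Qed.

Lemma filt_word w : filt (size w) (word w).
Proof. by apply: gen_by_in; exists w. Qed.

(** Each exchange of [i] with its left neighbour costs a scalar and a combination of words shorter
    by one. *)
Lemma word_front w i : i \in w ->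
  exists a : k, filt (size w).-1 (word w - a *: word (i :: rem i w)).
Proof.
elim: w => // j w IH; rewrite inE eq_sym /=.
case: eqVneq => [->|ne] /=; first by exists 1; rewrite scale1r subrr; apply: gen_by_0.
move=> iw; have [a ga] := IH iw; have w0 : (0 < size w)%N by case: (w) iw.
have [b [c bc]] := x_swap j i; exists (a * b).
have -> : x j (word w) - (a * b) *: x i (x j (word (rem i w)))
        = x j (word w - a *: word (i :: rem i w))
          + a *: (\sum_l c l *: x l) (word (rem i w)).
  have -> : (\sum_l c l *: x l) (word (rem i w))
      = x j (x i (word (rem i w))) - b *: x i (x j (word (rem i w))).
    by rewrite -mulEv bc addEv scaleEv mulEv addrC addKr.
  rewrite appBE appZE scalerBr scalerA addrA.
  by rewrite subrK.
have sz : (size (rem i w)).+1 = size w by rewrite size_rem // prednK.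
apply: gen_byD; first by rewrite -[size w]prednK //; apply: filt_x.
by apply: gen_byZ; rewrite -sz; apply/filt_sum/filt_word.
Qed.

Lemma word_perm w w' : perm_eq w w' ->
  exists a : k, filt (size w).-1 (word w - a *: word w').
Proof.
elim: w' w => [|i t IH] w pw.
  by exists 1; rewrite (perm_nilP pw) scale1r subrr; apply: gen_by_0.
have iw : i \in w by rewrite (perm_mem pw) mem_head.
have [a ga] := word_front iw.
have pr : perm_eq (rem i w) t.
  by rewrite -(perm_cons i) -(permPl (perm_to_rem iw)).
case: t IH pw pr => [|j t] IH pw pr.
  by exists a; rewrite (perm_nilP pr) in ga.
have [b gb] := IH _ pr; exists (a * b).
have -> : word w - (a * b) *: word (i :: j :: t)
  = (word w - a *: word (i :: rem i w))
    + a *: x i (word (rem i w) - b *: word (j :: t)).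
  by rewrite appBE appZE scalerBr scalerA addrA subrK.
apply: gen_byD => //; apply: gen_byZ.
have sr : size (rem i w) = (size t).+1 by rewrite (perm_size pr).
have -> : (size w).-1 = (size (rem i w)).-1.+1 by rewrite sr (perm_size pw).
exact: filt_x.
Qed.

Definition canonical_word (m : I -> nat) : seq I :=
  flatten [seq nseq (m i) i | i <- enum I].

Lemma perm_canonical_word w :
  perm_eq w (canonical_word (fun i => count_mem i w)).
Proof.
apply/allP => i _ /=; rewrite /canonical_word count_flatten -map_comp sumnE big_map.
rewrite big_enum /= (bigD1 i) //= count_nseq /= eqxx mul1n big1 ?addn0 // => j ne.
by rewrite count_nseq /= (negPf ne).
Qed.

Definition restricted_words : seq V :=
  [seq word (canonical_word (fun i => m i : nat)) | m : {dffun forall i, 'I_(e i)}].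

Lemma size_restricted_words : size restricted_words = (\prod_i e i)%N.
Proof.
rewrite size_image card_dep_ffun foldrE big_image /=.
by apply: eq_bigr => i _; rewrite card_ord.
Qed.

(** Induction on the length. If a letter [i] occurs at least [e i] times, these occurrences are
    gathered in front and [x_pow] replaces them by an element of [Z] and a linear term, both shorter
    since [e i > 1]. Otherwise sorting gives a restricted word modulo shorter words. *)
Lemma gen_restricted_words w : gen_by Zop (fun u => u \in restricted_words) (word w).
Proof.
have [d] := ubnP (size w); elim: d w => // d IH w lt_wd.
have sub u d' : (d' < d)%N -> filt d' u ->
    gen_by Zop (fun u => u \in restricted_words) u.
  move=> lt_d'd; apply: gen_by_trans => [_ [w' sw' ->]|z {}u]; last exact: gen_by_op.
  by apply: IH; apply: leq_ltn_trans lt_d'd.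
case: (boolP [exists i, e i <= count_mem i w]%N) => [/existsP [i ci]|/existsPn small].
  have [w' pw] : exists w', perm_eq w (nseq (e i) i ++ w').
    exists (nseq (count_mem i w - e i) i ++ [seq j <- w | predC1 i j]).
    rewrite catA -nseqD subnKC //; apply/permP => a.
    rewrite count_cat count_nseq count_filter.
    elim: (w) => [|j s IHs] /=; first by rewrite muln0.
    by rewrite IHs; case: eqVneq => [->|_] /=; rewrite ?andbF ?andbT; lia.
  have sw : size w = (e i + size w')%N by rewrite (perm_size pw) size_cat size_nseq.
  have [a ga] := word_perm pw.
  have lt_pred : ((size w).-1 < d)%N.
    by rewrite -ltnS prednK // sw addn_gt0 (ltnW (e_gt1 i)).
  rewrite -[word w](subrK (a *: word (nseq (e i) i ++ w'))).
  apply: gen_byD; first exact: sub ga.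
  apply: gen_byZ; have -> : word (nseq (e i) i ++ w') = (x i ^+ e i) (word w').
    by elim: (e i) => [|c IHc] //=; rewrite exprS mulEv -IHc.
  have [z [c [Zz ->]]] := x_pow i; rewrite addEv; apply: gen_byD.
    apply: gen_by_op; first by exists z.
    by apply: IH; have := e_gt1 i; lia.
  apply: (sub _ (size w').+1); last exact/filt_sum/filt_word.
  by have := e_gt1 i; lia.
have [a ga] := word_perm (perm_canonical_word w).
have canS : word (canonical_word (fun i => count_mem i w)) \in restricted_words.
  have lt_i i : (count_mem i w < e i)%N by rewrite ltnNge.
  apply/imageP; exists [ffun i => Ordinal (lt_i i)] => //.
  by congr (word (flatten _)); apply: eq_map => i; rewrite ffunE.
case: (posnP (size w)) => [/size0nil w0|w_gt0].
  have c0 := size0nil (etrans (esym (perm_size (perm_canonical_word w))) (congr1 size w0)).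
  by apply: gen_by_in; rewrite c0 -w0 in canS.
rewrite -[word w](subrK (a *: word (canonical_word (fun i => count_mem i w)))).
apply: gen_byD; last by apply/gen_byZ/gen_by_in.
by apply: sub ga; rewrite -ltnS prednK.
Qed.
End Words.

(** * Eigenvectors and dimensions *)

Lemma gen_by_none_coord (k : fieldType) (V : lmodType k) (s : seq V) v :
  gen_by (fun=> False) (fun u => u \in s) v ->
  exists c : 'I_(size s) -> k, v = \sum_i c i *: s`_i.
Proof.
elim=> {v} [v vs| |a u v _ [c ->] _ [d ->]|z v []].
- have lt_v : (index v s < size s)%N by rewrite index_mem.
  exists (fun i => (i == Ordinal lt_v)%:R).
  rewrite (bigD1 (Ordinal lt_v)) //= eqxx big1 => [|i /negPf ->]; last by rewrite scale0r.
  by rewrite scale1r addr0 nth_index.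
- by exists (fun=> 0); rewrite big1 // => i _; rewrite scale0r.
exists (fun i => a * c i + d i); rewrite scaler_sumr -big_split.
by apply: eq_bigr => i _; rewrite scalerDl scalerA.
Qed.

(** A dependent family loses a member and induction applies; an independent one provides coordinates
    by choice. Dependence is decided classically, as [V] is an arbitrary module. *)
Lemma has_dim_of_family (k : fieldType) (V : lmodType k) n (b : 'I_n -> V) :
  (forall v, exists c : 'I_n -> k, v = \sum_i c i *: b i) ->
  exists2 d, has_dim V d & (d <= n)%N.
Proof.
elim: n b => [|n IH] b bV.
  exists 0%N => //; pose f (v : V) : 'rV[k]_0 := 0.
  have fl : linear f by move=> a u v; rewrite /f scaler0 addr0.
  pose F := HB.pack_for {linear V -> 'rV[k]_0} f (GRing.isLinear.Build _ _ _ _ f fl).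
  exists F; exists (fun=> 0) => [v|r]; last by rewrite [r]thinmx0.
  by have [c ->] := bV v; rewrite big_ord0.
case: (pselect (exists2 c : 'I_n.+1 -> k, (exists i, c i != 0) & \sum_i c i *: b i = 0)).
  case=> c [i ci] c0; have [|d dV le_d] := IH (fun j => b (lift i j)).
    move=> v; have [a ->] := bV v.
    exists (fun j => a (lift i j) - a i * (c i)^-1 * c (lift i j)).
    have D F : \sum_j F j = F i + \sum_j F (lift i j) :> V.
      by rewrite (bigD1_ord i).
    rewrite D; move: c0; rewrite D => /eqP; rewrite addr_eq0 => /eqP e.
    have -> : b i = - (c i)^-1 *: \sum_j c (lift i j) *: b (lift i j).
      by rewrite scaleNr -scalerN -e scalerA mulVf ?scale1r.
    rewrite scalerA scaler_sumr -big_split; apply: eq_bigr => j _ /=.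
    by rewrite scalerA -scalerDl mulrN mulNr addrC.
  by exists d => //; apply: leqW.
move=> free; pose g (c : 'rV[k]_n.+1) := \sum_i c 0 i *: b i.
have gl a c d : g (a *: c + d) = a *: g c + g d.
  rewrite /g scaler_sumr -big_split; apply: eq_bigr => i _.
  by rewrite !mxE scalerDl scalerA.
have g_inj : injective g.
  move=> c d e; apply/rowP => i; apply/eqP; rewrite -subr_eq0; apply: contrapT => ne.
  apply: free; exists (fun j => c 0 j - d 0 j); first by exists i; apply/negP.
  apply/eqP; under eq_bigr do rewrite scalerBl.
  by rewrite sumrB subr_eq0; apply/eqP.
have gV v : exists c, g c == v.
  have [c ->] := bV v; exists (\row_i c i); apply/eqP.
  by apply: eq_bigr => i _; rewrite mxE.
pose f v := xchoose (gV v); have gf v : g (f v) = v := eqP (xchooseP (gV v)).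
have fl : linear f by move=> a u v; apply: g_inj; rewrite gl !gf.
pose F := HB.pack_for {linear V -> 'rV[k]_n.+1} f (GRing.isLinear.Build _ _ _ _ f fl).
exists n.+1 => //; exists F; exists g => // c; exact: g_inj (gf _).
Qed.

Section Eigen.
Variables (k : closedFieldType) (V : lmodType k) (v0 : V) (nz : v0 != 0).
Notation E := (lin_end nz).

(** The linear factors of [q] are applied to [v] one at a time, and the last nonzero vector is an
    eigenvector. The invariant [Q] keeps it inside a prescribed set, so that simultaneous
    eigenvectors can be built up. *)
Lemma eigenvector_in (T : E) (q : {poly k}) (Q : V -> Prop) v :
  (forall u, Q u -> forall r, Q (T u - r *: u)) ->
  Q v -> v != 0 -> q != 0 -> horner_alg T q v = 0 ->
  exists r u, [/\ Q u, u != 0, T u = r *: u & root q r].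
Proof.
move=> QT Qv vn0 q0 qv; have [rs qE] := closed_field_poly_normal q.
have lc : lead_coef q != 0 by rewrite lead_coef_eq0.
have {qv} : horner_alg T (\prod_(r <- rs) ('X - r%:P)) v = 0.
  move: qv; rewrite {1}qE linearZ /= => /eqP; rewrite scaler_eq0 (negPf lc).
  by move/eqP.
have : {subset rs <= root q}.
  move=> r rr; rewrite -[_ \in _]/(root q r) qE rootZ // root_prod_XsubC.
  by [].
elim/last_ind: rs {qE} v Qv vn0 => [|rs r IH] v Qv vn0 sub.
  by rewrite big_nil rmorph1 oneEv => /eqP; rewrite (negPf vn0).
rewrite -cats1 big_cat big_seq1 rmorphM mulEv rmorphB /= horner_algX horner_algC.
rewrite [X in _ - X](_ : _ = r *: v) // => e.
have [/eqP|ne] := eqVneq (T v - r *: v) 0.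
  rewrite subr_eq0 => /eqP eTv; exists r, v; split=> //.
  by apply: sub; rewrite mem_rcons mem_head.
apply: IH e => //; first exact: QT.
by move=> r' r'rs; apply: sub; rewrite mem_rcons inE r'rs orbT.
Qed.

(** Schur's lemma: the first n + 1 vectors [T ^+ i] applied to [v0] are dependent, which gives a
    polynomial killing [v0], hence an eigenvalue [r]; then [T - r *: 1] is not injective. *)
Lemma finite_span_scalar (s : seq V) (T : E) :
  (forall v, gen_by (fun=> False) (fun u => u \in s) v) ->
  (forall r, T - r *: 1 = 0 \/ injective (T - r *: 1)) ->
  exists r, T = r *: 1.
Proof.
move=> sV Tinj; pose n := size s.
have /fin_all_exists [c hc] : forall i : 'I_n.+1, exists c : 'I_n -> k,
    (T ^+ i) v0 = \sum_j c j *: s`_j.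
  by move=> i; apply: gen_by_none_coord.
pose M := \matrix_(i < n.+1, j < n) c i j.
have : kermx M != 0.
  rewrite kermx_eq0 /row_free neq_ltn; apply/orP; left.
  exact: leq_ltn_trans (rank_leq_col _) _.
case/rowV0Pn => a /sub_kermxP aM a0.
pose q : {poly k} := \poly_(i < n.+1) (a 0 (inord i)).
have q0 : q != 0.
  apply: contra a0 => /eqP q0; apply/eqP/rowP => i.
  have := congr1 (fun q : {poly k} => q`_i) q0.
  by rewrite /q coef_poly ltn_ord inord_val coef0 mxE.
have qv : horner_alg T q v0 = 0.
  rewrite /q poly_def linear_sum sumEv /=.
  transitivity (\sum_(i < n.+1) \sum_(j < n) (a 0 i * M i j) *: s`_j).
    apply: eq_bigr => i _; rewrite linearZ /= rmorphXn /= horner_algX inord_val.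
    rewrite hc scaler_sumr; apply: eq_bigr => j _.
    by rewrite scalerA mxE.
  rewrite exchange_big big1 // => j _ /=; rewrite -scaler_suml.
  by have := congr1 (fun A : 'rV_n => A 0 j) aM; rewrite mxE mxE => ->; rewrite scale0r.
have [||r [u [_ u0 Tu _]]] := @eigenvector_in T q (fun=> True) v0 _ _ nz q0 qv => //.
exists r; case: (Tinj r) => [/eqP|inj]; first by rewrite subr_eq0 => /eqP.
case/negP: u0; apply/eqP; apply: inj; rewrite appE0.
by rewrite addEv oppEv scaleEv oneEv Tu subrr.
Qed.
End Eigen.

(** * Central reduction *)

Section LinearSpan.
Variables (k : fieldType) (E : lmodType k) (I : finType) (op : I -> E).

Definition in_lin_span (T : E) : Prop := exists r : I -> k, T = \sum_l r l *: op l.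

Lemma lin_span_op l : in_lin_span (op l).
Proof.
exists (fun l' => (l' == l)%:R); rewrite (bigD1 l) //= eqxx scale1r big1 ?addr0 //.
by move=> l' /negPf ->; rewrite scale0r.
Qed.

Lemma lin_span0 : in_lin_span 0.
Proof. by exists (fun=> 0); rewrite big1 // => l _; rewrite scale0r. Qed.

Lemma lin_spanZ r T : in_lin_span T -> in_lin_span (r *: T).
Proof.
case=> s ->; exists (fun l => r * s l); rewrite scaler_sumr.
by apply: eq_bigr => l _; rewrite scalerA.
Qed.

Lemma lin_spanD S T : in_lin_span S -> in_lin_span T -> in_lin_span (S + T).
Proof.
case=> s -> [t ->]; exists (fun l => s l + t l); rewrite -big_split.
by apply: eq_bigr => l _; rewrite scalerDl.
Qed.

Lemma lin_span_sum J (s : seq J) (P : pred J) (F : J -> E) :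
  (forall j, P j -> in_lin_span (F j)) -> in_lin_span (\sum_(j <- s | P j) F j).
Proof.
by move=> h; elim/big_rec: _ => [|j x Pj]; [apply: lin_span0 | apply/lin_spanD/h].
Qed.
End LinearSpan.
Arguments lin_span_op {k E I} op l.
Arguments lin_span0 {k E I} op.

Lemma mulrB_comm (S : pzRingType) (P Q x : S) :
  P * x - x * P = Q * x - x * Q -> (P - Q) * x = x * (P - Q).
Proof.
move=> h; have e : P * x = x * P + (Q * x - x * Q) by rewrite -h addrC subrK.
by rewrite mulrBl mulrBr e addrA addrAC addrK.
Qed.

Section PthPowers.
Variables (k : fieldType) (p : nat) (n : nat) (E : algType k).
Variables (a b c : {linear 'M[k]_n.+1 -> E}).
Hypothesis chark : p \in [pchar k].
Hypothesis p_gt2 : (2 < p)%N.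
Hypothesis rep : periplectic_rep a b c.

Lemma pchar_two : 2%:R != 0 :> k.
Proof.
rewrite -(dvdn_pcharf chark) (dvdn_prime2 (pcharf_prime chark)) //.
by rewrite neq_ltn p_gt2 orbT.
Qed.

Lemma pchar_odd : odd p.
Proof. by case: (even_prime (pcharf_prime chark)) p_gt2 => [->|]. Qed.

Lemma exprN_odd (S : pzRingType) (x : S) : (- x) ^+ p = - x ^+ p.
Proof. by rewrite exprNn -signr_odd pchar_odd expr1 mulN1r. Qed.

Lemma pcharE : p \in [pchar E]. Proof. by rewrite pchar_lalg. Qed.

Lemma pchar_mx : p \in [pchar 'M[k]_n.+1]. Proof. by rewrite pchar_lalg. Qed.

(** In characteristic p the p-th iterate of ad T is ad T^p, and that of X -> LX + XR is X -> L^p X +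
    X R^p. Suitable [L] and [R] give the action of sl on each of the three blocks; [D] carries the
    trace condition of the even one. *)
Lemma pth_power_intertwines (T : E) (phi : 'M[k]_n.+1 -> E) (L R : 'M[k]_n.+1)
    (D : 'M[k]_n.+1 -> Prop) (B : 'M[k]_n.+1) :
  (forall X, D X -> D (L * X + X * R)) ->
  (forall X, D X -> T * phi X - phi X * T = phi (L * X + X * R)) -> D B ->
  T ^+ p * phi B - phi B * T ^+ p = phi (L ^+ p * B + B * R ^+ p).
Proof.
move=> Dst h DB; rewrite -(iter_two_sided_pchar pchar_mx).
rewrite -mulrN -exprN_odd -(iter_two_sided_pchar pcharE).
suff : forall m, D (iter m (fun X => L * X + X * R) B) /\
  iter m (fun X => T * X + X * - T) (phi B) = phi (iter m (fun X => L * X + X * R) B).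
  by move=> /(_ p) [].
elim=> [|m [Dm IH]] //=; split; first exact: Dst.
by rewrite IH mulrN h.
Qed.

Variable A : 'M[k]_n.+1.
Hypotheses (A0 : \tr A = 0) (Ap0 : \tr (A ^+ p) = 0).

Definition central_power : E := a A ^+ p - a (A ^+ p).

Lemma central_power_a X : \tr X = 0 -> central_power * a X = a X * central_power.
Proof.
move=> X0; apply: mulrB_comm; rewrite (rep_aa rep) //.
rewrite (@pth_power_intertwines _ a A (- A) (fun X => \tr X = 0)) //.
- by rewrite exprN_odd mulrN.
- by move=> Y Y0; rewrite mulrN mxtraceM_comm.
by move=> Y Y0; rewrite mulrN (rep_aa rep).
Qed.

Lemma trmx_exp (m : nat) (B : 'M[k]_n.+1) : (B ^+ m)^T = B^T ^+ m.
Proof.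
elim: m => [|m IH]; first by rewrite !expr0 trmx1.
by rewrite exprS exprSr -IH; apply: trmx_mul.
Qed.

Lemma central_power_b B : central_power * b B = b B * central_power.
Proof.
apply: mulrB_comm; rewrite (rep_ab rep) // trmx_exp.
by rewrite (@pth_power_intertwines _ b A A^T (fun=> True)) // => Y _; rewrite (rep_ab rep).
Qed.

Lemma central_power_c C : central_power * c C = c C * central_power.
Proof.
apply: mulrB_comm; rewrite (rep_ac rep) // trmx_exp.
rewrite (@pth_power_intertwines _ c (- A^T) (- A) (fun=> True)) // => [|Y _].
  by rewrite !exprN_odd mulNr mulrN -opprD linearN.
by rewrite (rep_ac rep) // mulNr mulrN -opprD linearN.
Qed.
End PthPowers.

(** * Schur's lemma and the p-character of an irreducible module *)

Section UpperBound.
Variables (k : closedFieldType) (p : nat) (n : nat) (V : lmodType k) (v0 : V).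
Variable (nz : v0 != 0).
Notation E := (lin_end nz).
Hypothesis chark : p \in [pchar k].
Hypothesis p_gt2 : (2 < p)%N.

Let two : 2%:R != 0 :> k := pchar_two chark p_gt2.
Let p_pr : prime p := pcharf_prime chark.
Let p_neq0 : (p == 0%N) = false. Proof. by rewrite eqn0Ngt prime_gt0. Qed.

(** [pr] stands for the projection onto the even part. Stability under [pr] replaces gradedness, so
    irreducibility quantifies over plain subspaces. *)
Record graded_irreducible (a b c : {linear 'M[k]_n.+1 -> E}) (pr : E) : Prop := {
  gi_rep : periplectic_rep a b c;
  gi_pr : pr * pr = pr;
  gi_pr_a : forall A, pr * a A = a A * pr;
  gi_pr_b : forall B, pr * b B + b B * pr = b B;
  gi_pr_c : forall C, pr * c C + c C * pr = c C;
  gi_irr : forall W : V -> Prop, W 0 ->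
    (forall r u v, W u -> W v -> W (r *: u + v)) ->
    (forall A v, \tr A = 0 -> W v -> W (a A v)) ->
    (forall B v, W v -> W (b B v)) -> (forall C v, W v -> W (c C v)) ->
    (forall v, W v -> W (pr v)) ->
    (forall v, W v -> v = 0) \/ (forall v, W v)
}.

Section Center.
Variables (a b c : {linear 'M[k]_n.+1 -> E}) (pr : E).
Hypothesis gi : graded_irreducible a b c pr.
Let rep := gi_rep gi.

Definition commutes_with_rep (x : E) : Prop :=
  [/\ forall A, \tr A = 0 -> x * a A = a A * x,
      forall B, x * b B = b B * x,
      forall C, x * c C = c C * x
    & x * pr = pr * x].

(** The center of the commutant. The second clause makes it commutative, as Noether normalization
    requires; central powers satisfy it, being polynomials in the operators [a A]. *)
Definition rep_center (x : E) : Prop :=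
  commutes_with_rep x /\ forall y, commutes_with_rep y -> x * y = y * x.

Lemma rep_center_lin (r : k) x y : rep_center x -> rep_center y -> rep_center (r *: x + y).
Proof.
have L u v w : u * w = w * u -> v * w = w * v ->
    (r *: u + v : E) * w = w * (r *: u + v).
  by move=> e f; rewrite mulrDl mulrDr -scalerAl -scalerAr e f.
move=> [[xa xb xc xp] xy] [[ya yb yc yp] yy]; split; first by split=> *; apply: L; auto.
by move=> z zc; apply: L; auto.
Qed.

Lemma rep_center1 : rep_center 1.
Proof. by split; first split; move=> *; rewrite mul1r mulr1. Qed.

Lemma rep_center0 : rep_center 0.
Proof. by split; first split; move=> *; rewrite mul0r mulr0. Qed.

Lemma rep_centerZ (r : k) x : rep_center x -> rep_center (r *: x).
Proof. by move=> xc; rewrite -[_ *: _]addr0; apply: rep_center_lin rep_center0. Qed.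

Lemma rep_centerD x y : rep_center x -> rep_center y -> rep_center (x + y).
Proof. by move=> xc yc; rewrite -[x]scale1r; apply: rep_center_lin. Qed.

Lemma rep_centerM x y : rep_center x -> rep_center y -> rep_center (x * y).
Proof.
have L (u v w : E) : u * w = w * u -> v * w = w * v -> u * v * w = w * (u * v).
  by move=> e f; rewrite -mulrA f !mulrA e.
move=> [[xa xb xc xp] xy] [[ya yb yc yp] yy]; split; first by split=> *; apply: L; auto.
by move=> z zc; apply: L; auto.
Qed.

Lemma rep_center_comm x y : rep_center x -> rep_center y -> x * y = y * x.
Proof. by move=> [_ h] [yc _]; apply: h. Qed.

Lemma central_power_center A : \tr A = 0 -> \tr (A ^+ p) = 0 ->
  rep_center (central_power p a A).
Proof.
move=> A0 Ap0; split; first split.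
- by move=> X; apply: (central_power_a chark p_gt2 rep).
- by move=> X; apply: (central_power_b chark p_gt2 rep).
- by move=> X; apply: (central_power_c chark p_gt2 rep).
- rewrite /central_power mulrBl mulrBr -(gi_pr_a gi); congr (_ - _).
  by elim: (p) => [|m IH]; rewrite ?expr0 ?mul1r ?mulr1 // exprS -mulrA IH !mulrA (gi_pr_a gi).
move=> y [ya _ _ _]; rewrite /central_power mulrBl mulrBr ya //; congr (_ - _).
by elim: (p) => [|m IH]; rewrite ?expr0 ?mul1r ?mulr1 // exprS -mulrA IH !mulrA ya.
Qed.

(** Schur's argument applied to the image; the next lemma applies it to the kernel. *)
Lemma rep_center_surj x : rep_center x -> x = 0 \/ forall v, exists u, v = x u.
Proof.
move=> [[xa xb xc xp] _].
have [||||||h|h] := gi_irr gi (W := fun v => exists u, v = x u); last by right.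
- by exists 0; rewrite appE0.
- by move=> r _ _ [u ->] [v ->]; exists (r *: u + v); rewrite appDE appZE.
- by move=> A _ A0 [u ->]; exists (a A u); rewrite -!mulEv xa.
- by move=> B _ [u ->]; exists (b B u); rewrite -!mulEv xb.
- by move=> B _ [u ->]; exists (c B u); rewrite -!mulEv xc.
- by move=> _ [u ->]; exists (pr u); rewrite -!mulEv xp.
by left; apply: lin_end_ext => v; apply: h; exists v.
Qed.

Lemma rep_center_inj x : rep_center x -> x = 0 \/ injective x.
Proof.
move=> [[xa xb xc xp] _].
have [||||||h|h] := gi_irr gi (W := fun v => x v = 0).
- by rewrite appE0.
- by move=> r u v xu xv; rewrite appDE appZE xu xv scaler0 addr0.
- by move=> A v A0 xv; rewrite -mulEv xa // mulEv xv appE0.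
- by move=> B v xv; rewrite -mulEv xb // mulEv xv appE0.
- by move=> B v xv; rewrite -mulEv xc // mulEv xv appE0.
- by move=> v xv; rewrite -mulEv xp // mulEv xv appE0.
- right=> u v e; apply/eqP; rewrite -subr_eq0; apply/eqP/h.
  by rewrite appBE e subrr.
by left; apply: lin_end_ext => v; apply: h.
Qed.

Definition gen_index : finType :=
  ('I_n.+1 * 'I_n.+1 + 'I_n.+1 * 'I_n.+1 + 'I_n.+1 * 'I_n.+1 + unit)%type.

Definition gen_op (l : gen_index) : E :=
  match l with
  | inl (inl (inl ij)) => a (sl_delta k ij.1 ij.2)
  | inl (inl (inr ij)) => b (delta_mx ij.1 ij.2)
  | inl (inr ij) => c (delta_mx ij.1 ij.2)
  | inr _ => pr
  end.

(** The exponents from which powers reduce: operators [b] and [c] have square zero, [pr] is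
    idempotent, and the p-th power of an operator [a] is central up to a linear term. *)
Definition gen_bound (l : gen_index) : nat :=
  if l is inl (inl (inl _)) then p else 2.

Notation in_gen_span := (in_lin_span gen_op).

Lemma in_gen_span_a A : \tr A = 0 -> in_gen_span (a A).
Proof.
move=> A0; rewrite (rep_a_sum a A0).
do 2![apply: lin_span_sum => ? _]; apply: lin_spanZ.
exact: (lin_span_op gen_op (inl (inl (inl (_, _))))).
Qed.

Lemma in_gen_span_b B : in_gen_span (b B).
Proof.
rewrite (rep_lin_sum b B).
do 2![apply: lin_span_sum => ? _]; apply: lin_spanZ.
exact: (lin_span_op gen_op (inl (inl (inr (_, _))))).
Qed.

Lemma in_gen_span_c C : in_gen_span (c C).
Proof.
rewrite (rep_lin_sum c C).
do 2![apply: lin_span_sum => ? _]; apply: lin_spanZ.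
exact: (lin_span_op gen_op (inl (inr (_, _)))).
Qed.

Lemma in_gen_span_pr : in_gen_span pr.
Proof. exact: (lin_span_op gen_op (inr tt)). Qed.

Lemma gen_op_swap l l' : exists r (s : gen_index -> k),
  gen_op l * gen_op l' = r *: (gen_op l' * gen_op l) + \sum_i s i *: gen_op i.
Proof.
have plus S T U : in_gen_span U -> S * T - T * S = U ->
    exists r (s : gen_index -> k), S * T = r *: (T * S) + \sum_i s i *: gen_op i.
  by case=> s -> e; exists 1, s; rewrite scale1r -e addrC subrK.
have minus S T U : in_gen_span U -> S * T + T * S = U ->
    exists r (s : gen_index -> k), S * T = r *: (T * S) + \sum_i s i *: gen_op i.
  by case=> s -> e; exists (-1), s; rewrite scaleN1r -e addrC addrK.
have swap (S T U : E) : T * S - S * T = U -> S * T - T * S = - 1 *: U.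
  by move=> <-; rewrite scaleN1r opprB.
have trS i j := mxtrace_sl_delta k i j.
case: l => [[[[i j]|[i j]]|[i j]]|[]]; case: l' => [[[[i' j']|[i' j']]|[i' j']]|[]] /=.
- by apply: plus (rep_aa rep _ _) => //; apply: in_gen_span_a; apply: mxtraceM_comm.
- by apply: plus (rep_ab rep _ _) => //; apply: in_gen_span_b.
- apply: plus (rep_ac rep _ _) => //; rewrite -scaleN1r.
  exact/lin_spanZ/in_gen_span_c.
- by apply: plus (lin_span0 gen_op) _; rewrite (gi_pr_a gi) subrr.
- apply: plus (swap _ _ _ (rep_ab rep _ _)) => //.
  exact/lin_spanZ/in_gen_span_b.
- by apply: minus (lin_span0 gen_op) (rep_bb rep _ _).
- apply: minus (rep_bc rep _ _); apply: in_gen_span_a; exact: mxtrace_symM_alt.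
- by apply: minus (in_gen_span_b _) _; rewrite addrC; apply: (gi_pr_b gi).
- apply: plus (swap _ _ _ (rep_ac rep _ _)) => //; rewrite scaleN1r opprK.
  exact: in_gen_span_c.
- apply: minus (etrans (addrC _ _) (rep_bc rep _ _)).
  apply: in_gen_span_a; exact: mxtrace_symM_alt.
- by apply: minus (lin_span0 gen_op) (rep_cc rep _ _).
- by apply: minus (in_gen_span_c _) _; rewrite addrC; apply: (gi_pr_c gi).
- by apply: plus (lin_span0 gen_op) _; rewrite (gi_pr_a gi) subrr.
- by apply: minus (in_gen_span_b _) (gi_pr_b gi _).
- by apply: minus (in_gen_span_c _) (gi_pr_c gi _).
by apply: plus (lin_span0 gen_op) _; rewrite subrr.
Qed.

(** On the diagonal the eigenvalues are 0, 1 and -1, so the cube, and with it every odd power, is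
    the matrix itself. Off the diagonal the square vanishes. *)
Lemma sl_delta_pth i j : sl_delta k i j ^+ p = (i == j)%:R *: sl_delta k i j :> 'M_n.+1.
Proof.
have [<-|ne] := eqVneq i j; last first.
  rewrite sl_delta_offdiag // scale0r -(subnKC (ltnW p_gt2)) exprD expr2.
  by rewrite delta_mulE eq_sym (negPf ne) scale0r mul0r.
rewrite scale1r; have cube : sl_delta k i i ^+ 3 = sl_delta k i i.
  rewrite /sl_delta eqxx scale1r; have [->|ne] := eqVneq i ord_max.
    by rewrite subrr expr0n.
  have sq : (delta_mx i i - delta_mx ord_max ord_max : 'M[k]_n.+1) ^+ 2
      = delta_mx i i + delta_mx ord_max ord_max.
    rewrite expr2 mulrBl !mulrBr !delta_mulE [ord_max == i]eq_sym !eqxx (negPf ne).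
    by rewrite !scale0r !scale1r subr0 sub0r opprK.
  rewrite exprS sq mulrBl !mulrDr !delta_mulE [ord_max == i]eq_sym !eqxx (negPf ne).
  by rewrite !scale0r !scale1r addr0 add0r.
have odd_pow m : sl_delta k i i ^+ m.*2.+1 = sl_delta k i i.
  elim: m => [|m IH]; first by rewrite expr1.
  by rewrite doubleS (_ : m.*2.+3 = 2 + m.*2.+1)%N ?exprD ?IH -?exprSr.
by rewrite -(odd_double_half p) (pchar_odd chark p_gt2) odd_pow.
Qed.

Lemma mxtrace_sl_delta_pth i j : \tr (sl_delta k i j ^+ p : 'M_n.+1) = 0.
Proof. by rewrite sl_delta_pth linearZ /= mxtrace_sl_delta mulr0. Qed.

(** Zero is included for the generators whose power has no central term. *)
Definition gen_central (z : E) : Prop :=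
  z = 0 \/ exists i j, z = central_power p a (sl_delta k i j).

Lemma gen_central_center z : gen_central z -> rep_center z.
Proof.
case=> [->|[i [j ->]]]; first exact: rep_center0.
apply: central_power_center; first exact: mxtrace_sl_delta.
exact: mxtrace_sl_delta_pth.
Qed.

Lemma gen_op_pow l : exists (z : E) (s : gen_index -> k),
  gen_central z /\ gen_op l ^+ gen_bound l = z + \sum_i s i *: gen_op i.
Proof.
case: l => [[[[i j]|[i j]]|[i j]]|[]] /=.
- have [s es] : in_gen_span (a (sl_delta k i j ^+ p)).
    exact/in_gen_span_a/mxtrace_sl_delta_pth.
  exists (central_power p a (sl_delta k i j)), s; split; first by right; exists i, j.
  by rewrite -es subrK.
- have [s es] := (lin_span0 gen_op); exists 0, s; split; first by left.
  by rewrite add0r -es expr2 (rep_b2 rep two).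
- have [s es] := (lin_span0 gen_op); exists 0, s; split; first by left.
  by rewrite add0r -es expr2 (rep_c2 rep two).
have [s es] := in_gen_span_pr; exists 0, s; split; first by left.
by rewrite add0r -es expr2 (gi_pr gi).
Qed.

Lemma gen_op_word_span v : v != 0 ->
  forall u, gen_by (Zop gen_central) (fun u => exists w, u = word gen_op v w) u.
Proof.
move=> vn0; set W := gen_by _ _.
have Wop l u : W u -> W (gen_op l u).
  elim=> {u} [_ [w ->]| |r u u' _ gu _ gu'|_ u [z Zz ->] _ gu].
  - by apply: gen_by_in; exists (l :: w).
  - by rewrite appE0; apply: gen_by_0.
  - by rewrite appDE appZE; apply: gen_by_lin.
  have [[za zb zc zp] _] := gen_central_center Zz.
  have -> : gen_op l (z u) = z (gen_op l u).
    rewrite -!mulEv; congr ((_ : E) _).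
    case: l {gu} => [[[[i j]|[i j]]|[i j]]|[]] /=; last by rewrite zp.
    + by rewrite za // mxtrace_sl_delta.
    + by rewrite zb.
    by rewrite zc.
  by apply: gen_by_op gu; exists z.
have Wspan T u : in_gen_span T -> W u -> W (T u).
  case=> s -> Wu; rewrite sumEv; apply: gen_by_sum => l _.
  by rewrite scaleEv; apply: gen_byZ; apply: Wop.
have [||||||h|//] := gi_irr gi (W := W).
- exact: gen_by_0.
- exact: gen_by_lin.
- by move=> A u A0; apply/Wspan/in_gen_span_a.
- by move=> B u; apply/Wspan/in_gen_span_b.
- by move=> C u; apply/Wspan/in_gen_span_c.
- by move=> u; apply/Wspan/in_gen_span_pr.
by case/eqP: vn0; apply: h; apply: gen_by_in; exists [::].
Qed.

(** Restricted words generate the module over the central powers, and these lie in a commutative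
    algebra whose elements are zero or surjective. *)
Lemma rep_finite_span : exists t : seq V,
  forall u, gen_by (fun=> False) (fun u => u \in t) u.
Proof.
pose h (ij : 'I_#|{: 'I_n.+1 * 'I_n.+1}|) : E :=
  central_power p a (sl_delta k (enum_val ij).1 (enum_val ij).2).
have Ch ij : rep_center (h ij).
  by apply: gen_central_center; right; exists (enum_val ij).1, (enum_val ij).2.
apply: (noether_finite (C := rep_center) _ _ _ _ _ _ Ch
         (s := restricted_words gen_op gen_bound v0)).
- exact: rep_center1.
- exact: rep_centerD.
- exact: rep_centerM.
- exact: rep_centerZ.
- exact: rep_center_comm.
- exact: rep_center_surj.
move=> u; have := gen_op_word_span nz u.
apply: gen_by_trans => [{}u [w ->]|_ {}u [z [->|[i [j ->]]] ->] gu]; last 2 first.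
- by rewrite zeroEv; apply: gen_by_0.
- apply: gen_by_op gu; exists (enum_rank (i, j)).
  by rewrite /h enum_rankK.
have := @gen_restricted_words _ _ _ _ _ gen_op gen_bound gen_central v0 _ _ gen_op_swap
  gen_op_pow w.
have Zx z i : gen_central z -> z * gen_op i = gen_op i * z.
  move=> /gen_central_center [[za zb zc zp] _].
  case: i => [[[[i j]|[i j]]|[i j]]|[]] /=; last by rewrite zp.
  + by rewrite za // mxtrace_sl_delta.
  + by rewrite zb.
  by rewrite zc.
have b1 l : (1 < gen_bound l)%N by case: l => [[[]|]|] //= _; apply: ltnW.
move=> /(_ Zx b1); apply: gen_by_trans => [{}u|_ {}u [z [->|[i [j ->]]] ->] gu].
- exact: gen_by_in.
- by rewrite zeroEv; apply: gen_by_0.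
apply: gen_by_op gu; exists (enum_rank (i, j)).
by rewrite /h enum_rankK.
Qed.

Lemma rep_center_scalar x : rep_center x -> exists r, x = r *: 1.
Proof.
move=> xc; have [t tV] := rep_finite_span.
apply: (finite_span_scalar tV) => r; apply: rep_center_inj.
rewrite addrC -scaleNr; apply: rep_center_lin xc; exact: rep_center1.
Qed.

Lemma pth_root (x : k) : exists r, r ^+ p = x.
Proof.
have /closed_rootP [r] : size ('X^p - x%:P) != 1%N.
  by rewrite size_XnsubC ?prime_gt0 // eqSS -lt0n prime_gt0.
by rewrite /root !hornerE subr_eq0 => /eqP <-; exists r; rewrite ?hornerXn.
Qed.

(** By Jacobson's formula A -> a(A)^p - a(A^p) is p-semilinear. Its values on the spanning matrices
    [sl_delta] are scalars, and their p-th roots define the linear form given by [Theta]. The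
    vanishing of the trace of A^p joins the induction, because [a] is only meaningful on trace zero
    matrices. *)
Lemma p_character_exists : exists Theta : 'M[k]_n.+1, forall A, \tr A = 0 ->
  \tr (A ^+ p) = 0 /\ a A ^+ p = a (A ^+ p) + (\tr (Theta * A)) ^+ p *: 1.
Proof.
have /fin_all_exists2 [t _ ht] : forall ij : 'I_n.+1 * 'I_n.+1,
    exists2 t, True & central_power p a (sl_delta k ij.1 ij.2) = t ^+ p *: 1.
  move=> [i j] /=; have [|r ->] := @rep_center_scalar (central_power p a (sl_delta k i j)).
    by apply: gen_central_center; right; exists i, j.
  by have [t <-] := pth_root r; exists t.
(* The indices are swapped because the trace of Theta E_ij is the entry [Theta j i]. *)
pose Theta := \matrix_(i, j) t (j, i); exists Theta.
(* [sl_delta] vanishes at the last diagonal position, so the correction term of [sl_delta i i]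
   contributes nothing to the linear form. *)
have tmm : t (ord_max, ord_max) = 0.
  have := ht (ord_max, ord_max); rewrite /central_power /= sl_delta_pth.
  rewrite (_ : sl_delta k _ _ = 0) ?scaler0 ?linear0 ?expr0n.
    rewrite p_neq0 addr0 => /esym/eqP.
    by rewrite scaler_eq0 oner_eq0 orbF expf_eq0 prime_gt0 //= => /eqP.
  by rewrite /sl_delta eqxx scale1r subrr.
pose Q A := [/\ \tr A = 0, \tr (A ^+ p) = 0 &
  a A ^+ p = a (A ^+ p) + (\tr (Theta * A)) ^+ p *: 1].
suff QA A : \tr A = 0 -> Q A by move=> A /QA [].
have trMZ r (B : 'M[k]_n.+1) : \tr (Theta * (r *: B)) = r * \tr (Theta * B).
  by rewrite -scalerAr linearZ.
have trMD (B C : 'M[k]_n.+1) : \tr (Theta * (B + C)) = \tr (Theta * B) + \tr (Theta * C).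
  by rewrite mulrDr linearD.
have Q0 : Q 0.
  by split; rewrite ?mulr0 ?linear0 ?expr0n ?p_neq0 ?linear0 // scale0r addr0.
have QZ r B : Q B -> Q (r *: B).
  move=> [B0 Bp0 hB]; split; first by rewrite linearZ /= B0 mulr0.
    by rewrite exprZn linearZ /= Bp0 mulr0.
  rewrite (_ : a (r *: B) = r *: a B); last exact: linearZ.
  rewrite [LHS]exprZn [in RHS]exprZn trMZ hB scalerDr exprMn -scalerA; congr (_ + _).
  by apply/esym; apply: linearZ.
have QD B C : Q B -> Q C -> Q (B + C).
  move=> [B0 Bp0 hB] [C0 Cp0 hC]; have J j := jacobson_coef_rep rep p.-1 j B0 C0.
  split; first by rewrite linearD /= B0 C0 addr0.
    rewrite (jacobson_formula _ _ chark) !linearD /= Bp0 Cp0 !add0r linear_sum big1 // => j _.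
    by rewrite linearZ /= (J j).2 mulr0.
  rewrite (_ : a (B + C) = a B + a C); last exact: linearD.
  rewrite !(jacobson_formula _ _ chark) hB hC trMD -!(pFrobenius_autE chark) rmorphD /=.
  rewrite scalerDl [in RHS]linearD [in RHS]linearD linear_sum /=.
  rewrite [RHS]addrAC; congr (_ + _); first by rewrite addrACA.
  by apply: eq_bigr => j _; rewrite linearZ /= (J j).1.
move=> A0; rewrite (sl_sum A0).
elim/big_rec: _ => // i B _ QB; apply: (QD _ _ _ QB).
elim/big_rec: _ => // j B' _ QB'; apply: (QD _ _ _ QB'); apply: QZ.
split; [exact: mxtrace_sl_delta | exact: mxtrace_sl_delta_pth |].
have /= := ht (i, j); rewrite /central_power => /eqP; rewrite subr_eq addrC => /eqP ->.
congr (_ + _ ^+ _ *: _); rewrite /sl_delta mulrBr linearB /= -scalerAr linearZ /=.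
by rewrite !mxtrace_mul_delta !mxE tmm mulr0 subr0.
Qed.
End Center.
End UpperBound.

(** * Change of basis and triangular p-characters *)

Section Adapted.
Variables (k : closedFieldType) (p : nat) (n : nat) (V : lmodType k) (v0 : V).
Variable (nz : v0 != 0).
Notation E := (lin_end nz).
Notation M := 'M[k]_n.+1.
Hypothesis chark : p \in [pchar k].
Hypothesis p_gt2 : (2 < p)%N.

Let two : 2%:R != 0 :> k := pchar_two chark p_gt2.

Definition has_p_character (a : M -> E) (Theta : M) : Prop :=
  forall A, \tr A = 0 ->
    \tr (A ^+ p) = 0 /\ a A ^+ p = a (A ^+ p) + (\tr (Theta * A)) ^+ p *: 1.

(** Conjugation by the block diagonal matrix with blocks P' and P^T is an automorphism of p(n).
    Invariance of the trace moves it from A to [Theta]. *)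
Lemma conjugate_rep (a b c : {linear M -> E}) (pr : E) (Theta P P' : M) :
  P * P' = 1 -> graded_irreducible a b c pr -> has_p_character a Theta ->
  exists a' b' c' : {linear M -> E},
    graded_irreducible a' b' c' pr /\ has_p_character a' (P * Theta * P').
Proof.
move=> PP' gi hT; have P'P : P' * P = 1 := mulmx1C PP'.
have tPP' : P'^T * P^T = 1 by rewrite -[LHS]trmx_mul [P *m P']PP' trmx1.
have tP'P : P^T * P'^T = 1 by rewrite -[LHS]trmx_mul [P' *m P]P'P trmx1.
pose a' : {linear M -> E} := (a \o (mulmxr P \o mulmx P'))%FUN.
pose b' : {linear M -> E} := (b \o (mulmxr P'^T \o mulmx P'))%FUN.
pose c' : {linear M -> E} := (c \o (mulmxr P \o mulmx P^T))%FUN.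
have aE A : a' A = a (P' * A * P) by [].
have bE B : b' B = b (P' * B * P'^T) by [].
have cE C : c' C = c (P^T * C * P) by [].
have trE A : \tr (P' * A * P) = \tr A.
  by rewrite [LHS]mxtrace_mulC [P *m _]mulrA PP' mul1r.
have trT (A B : M) : (A * B)^T = B^T * A^T by exact: trmx_mul.
have rep := gi_rep gi.
exists a', b', c'; split; last first.
  move=> A A0; have [] := hT (P' * A * P); first by rewrite trE.
  have -> : (P' * A * P) ^+ p = P' * A ^+ p * P.
    elim: (p) => [|m IH]; first by rewrite !expr0 mulr1 P'P.
    by rewrite !exprS IH -!mulrA (mulrA P P') PP' mul1r.
  rewrite trE => Ap0; rewrite !aE => ->; split=> //; congr (_ + _ ^+ _ *: _).
  by rewrite !mulrA [LHS]mxtrace_mulC [P *m _]mulrA -!mulrA.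
split.
- split.
  + move=> A A' A0 A'0; rewrite !aE (rep_aa rep) ?trE //; congr (a _).
    by rewrite mulrBr mulrBl -!mulrA; congr (_ - _); rewrite !(mulrA P P') PP' mul1r.
  + move=> A B A0; rewrite aE !bE (rep_ab rep) ?trE //; congr (b _).
    rewrite mulrDr mulrDl; congr (_ + _); first by rewrite -!mulrA !(mulrA P P') PP' mul1r.
    by rewrite !trT -!mulrA !(mulrA P'^T P^T) tPP' mul1r.
  + move=> A C A0; rewrite aE !cE (rep_ac rep) ?trE //; congr (- c _).
    rewrite mulrDr mulrDl; congr (_ + _); last by rewrite -!mulrA !(mulrA P P') PP' mul1r.
    by rewrite !trT -!mulrA !(mulrA P'^T P^T) tPP' mul1r.
  + by move=> B B'; rewrite !bE (rep_bb rep).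
  + by move=> C C'; rewrite !cE (rep_cc rep).
  + move=> B C; rewrite bE cE aE (rep_bc rep) !trT !trmxK; congr (a _).
    rewrite mulrA -mulrDl -mulrDr mulrA -mulrBl -mulrBr.
    by rewrite -!mulrA !(mulrA P'^T P^T) tPP' mul1r.
  + by move=> B; rewrite !bE -(rep_bT rep (P' * B * _)) !trT trmxK mulrA.
  + by move=> C; rewrite !cE -(rep_cT rep (P^T * C * _)) !trT trmxK mulrA.
- exact: (gi_pr gi).
- by move=> A; rewrite aE (gi_pr_a gi).
- by move=> B; rewrite bE (gi_pr_b gi).
- by move=> C; rewrite cE (gi_pr_c gi).
move=> W W0 Wl Wa Wb Wc Wp; apply: (gi_irr gi) => // [A v A0|B v|C v].
- have -> : a A = a' (P * A * P').
    by rewrite aE !mulrA P'P mul1r -mulrA P'P mulr1.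
  by apply: Wa; rewrite [LHS]mxtrace_mulC [P' *m _]mulrA P'P mul1r.
- have -> : b B = b' (P * B * P^T); last exact: Wb.
  by rewrite bE !mulrA P'P mul1r -mulrA tP'P mulr1.
have -> : c C = c' (P'^T * C * P'); last exact: Wc.
by rewrite cE !mulrA tP'P mul1r -mulrA P'P mulr1.
Qed.

Lemma triangular_p_character (a b c : {linear M -> E}) (pr : E) :
  graded_irreducible a b c pr ->
  exists (a' b' c' : {linear M -> E}) (Theta : M),
    [/\ graded_irreducible a' b' c' pr, has_p_character a' Theta
      & forall i j : 'I_n.+1, (j < i)%N -> Theta i j = 0].
Proof.
move=> gi; have [Theta hT] := p_character_exists chark p_gt2 gi.
have [P [P' [PP' up]]] := upper_triangularizable Theta.
have [a' [b' [c' [gi' hT']]]] := conjugate_rep PP' gi hT.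
by exists a', b', c', (P * Theta * P').
Qed.
End Adapted.

(** * Highest weight vectors *)

Section HighestWeight.
Variables (k : closedFieldType) (p : nat) (n : nat) (V : lmodType k) (v0 : V).
Variable (nz : v0 != 0).
Notation E := (lin_end nz).
Notation M := 'M[k]_n.+1.
Notation E_ i j := (delta_mx i j : M).
Hypothesis chark : p \in [pchar k].
Hypothesis p_gt2 : (2 < p)%N.

Let two : 2%:R != 0 :> k := pchar_two chark p_gt2.
Let p_pr : prime p := pcharf_prime chark.

Lemma nilpotent_kernel (T : E) m (Q : V -> Prop) v :
  (forall u, Q u -> Q (T u)) -> Q v -> v != 0 -> (T ^+ m) v = 0 ->
  exists2 u, u != 0 & Q u /\ T u = 0.
Proof.
move=> QT; elim: m v => [|m IH] v Qv vn0; first by rewrite expr0 => /eqP; rewrite (negPf vn0).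
have [Tv0|Tv] := eqVneq (T v) 0; first by exists v.
by rewrite exprSr mulEv => /IH; apply=> //; apply: QT.
Qed.

Variables (a b c : {linear M -> E}) (pr : E) (Theta : M).
Hypothesis gi : graded_irreducible a b c pr.
Hypothesis hT : has_p_character p a Theta.
Hypothesis upper : forall i j : 'I_n.+1, (j < i)%N -> Theta i j = 0.

Let rep := gi_rep gi.

Lemma a_delta_pth i j : i != j -> a (E_ i j) ^+ p = (Theta j i) ^+ p *: 1.
Proof.
move=> ne; have [] := hT (A := E_ i j); first by rewrite mxtrace_delta (negPf ne).
rewrite -(sl_delta_offdiag k ne) => _ ->.
rewrite (sl_delta_pth chark p_gt2) (negPf ne) scale0r linear0 add0r.
by rewrite sl_delta_offdiag // mxtrace_mul_delta.
Qed.

Lemma a_delta_upper_nil (i j : 'I_n.+1) : (i < j)%N -> a (E_ i j) ^+ p = 0.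
Proof.
move=> lt_ij; rewrite a_delta_pth ?neq_ltn ?lt_ij // upper //.
by rewrite expr0n eqn0Ngt prime_gt0 //= scale0r.
Qed.

Definition homogeneous (v : V) : Prop := exists eps : k, pr v = eps *: v.

Lemma pr_eigen_a A v eps : pr v = eps *: v -> pr (a A v) = eps *: a A v.
Proof. by move=> h; rewrite -mulEv (gi_pr_a gi) mulEv h appZE. Qed.

Lemma homogeneous_a A v : homogeneous v -> homogeneous (a A v).
Proof. by case=> eps h; exists eps; apply: pr_eigen_a. Qed.

Lemma homogeneous_b B v : homogeneous v -> homogeneous (b B v).
Proof.
case=> eps h; have := congr1 (fun T : E => T v) (gi_pr_b gi B).
rewrite addEv !mulEv h appZE => /(canRL (addrK _)) e.
by exists (1 - eps); rewrite e scalerBl scale1r.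
Qed.

Definition killed_b (v : V) : Prop := forall B, b B v = 0.

Lemma killed_b_a A v : \tr A = 0 -> killed_b v -> killed_b (a A v).
Proof.
move=> A0 kv B; have := congr1 (fun T : E => T v) (rep_ab rep B A0).
by rewrite addEv oppEv !mulEv !kv appE0 sub0r => /eqP; rewrite oppr_eq0 => /eqP.
Qed.

(** The operators [b] anticommute and have square zero, so their kernels can be intersected one
    after the other without reaching zero. *)
Lemma exists_killed_b : exists2 v, v != 0 & homogeneous v /\ killed_b v.
Proof.
have [u u0 hu] : exists2 u, u != 0 & homogeneous u.
  have [pv0|pv] := eqVneq (pr v0) 0; first by exists v0 => //; exists 0; rewrite pv0 scale0r.
  by exists (pr v0) => //; exists 1; rewrite -mulEv (gi_pr gi) scale1r.
have /(_ (enum {: 'I_n.+1 * 'I_n.+1})) : forall l : seq ('I_n.+1 * 'I_n.+1),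
    exists2 v, v != 0 & homogeneous v /\ {in l, forall ij, b (E_ ij.1 ij.2) v = 0}.
  elim=> [|[i j] l [v vn0 [hv kv]]]; first by exists u.
  have [|||w w0 [[hw kw] bw]] := @nilpotent_kernel (b (E_ i j)) 2
    (fun v => homogeneous v /\ {in l, forall ij, b (E_ ij.1 ij.2) v = 0}) v _ _ vn0.
  - move=> w [hw kw]; split; first exact: homogeneous_b.
    move=> ij /kw e; have := congr1 (fun T : E => T w) (rep_bb rep (E_ ij.1 ij.2) (E_ i j)).
    by rewrite addEv !mulEv e appE0 addr0.
  - by [].
  - by rewrite expr2 (rep_b2 rep two).
  exists w => //; split=> // ij; rewrite inE => /predU1P [->|/kw] //.
case=> v vn0 [hv kv]; exists v => //; split=> // B.
rewrite (rep_lin_sum b B) sumEv big1 // => i _; rewrite sumEv big1 // => j _.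
by rewrite scaleEv (kv (i, j)) ?mem_enum // scaler0.
Qed.

Definition killed_upper (d : nat) (v : V) : Prop :=
  forall i j : 'I_n.+1, (i + d <= j)%N -> a (E_ i j) v = 0.

Lemma a_comm_v A B v : \tr A = 0 -> \tr B = 0 ->
  a A (a B v) = a B (a A v) + a (A * B - B * A) v.
Proof.
move=> A0 B0; have := congr1 (fun T : E => T v) (rep_aa rep A0 B0).
by rewrite addEv oppEv !mulEv => <-; rewrite addrC subrK.
Qed.

Lemma lin_combB_v (f : {linear M -> E}) r s X Y v :
  f (r *: X - s *: Y) v = r *: f X v - s *: f Y v.
Proof. by rewrite linearB !linearZ. Qed.

Lemma tr_delta_lt (i j : 'I_n.+1) : (i < j)%N -> \tr (E_ i j) = 0.
Proof. by move=> lt_ij; rewrite mxtrace_delta -val_eqE ltn_eqF. Qed.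

(** Descending induction on the height j - i. A unit of height h and one of height at least h have a
    bracket of height above h, so imposing the units of height h one by one preserves the conditions
    already met. Each step finds a vector because these operators are nilpotent, [Theta] being upper
    triangular. *)
Lemma exists_killed_upper :
  exists2 v, v != 0 & [/\ homogeneous v, killed_b v & killed_upper 1 v].
Proof.
suff /(_ n.+1) : forall d, exists2 v, v != 0 &
    [/\ homogeneous v, killed_b v & killed_upper (n.+1 - d).+1 v].
  by rewrite subnn.
elim=> [|d [v vn0 [hv bv uv]]].
  have [v vn0 [hv kv]] := exists_killed_b; exists v => //; split=> // i j.
  by rewrite leqNgt subn0 addnS ltnS; case/negP; apply: leq_trans (ltnW (ltn_ord j)) (leq_addl _ _).
(* Truncated subtraction: the height bound has already reached its final value 1. *)
have [le_nd|lt_dn] := leqP n.+1 d.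
  exists v => //; split=> // i j le; apply: uv; apply: leq_trans le.
  by lia.
set h := (n.+1 - d)%N in uv; have h0 : (0 < h)%N by rewrite subn_gt0.
have eh : (n.+1 - d.+1).+1 = h by rewrite subnSK.
rewrite eh.
have /(_ (enum {: 'I_n.+1 * 'I_n.+1})) : forall l : seq ('I_n.+1 * 'I_n.+1),
    exists2 v, v != 0 & [/\ homogeneous v, killed_b v, killed_upper h.+1 v &
      forall ij : 'I_n.+1 * 'I_n.+1, ij \in l -> (ij.1 + h)%N = ij.2 -> a (E_ ij.1 ij.2) v = 0].
  elim=> [|[i j] l [w wn0 [hw bw uw lw]]]; first by exists v.
  have [e|ne] := eqVneq (i + h)%N j; last first.
    exists w => //; split=> // ij; rewrite inE => /predU1P [-> /= e|/lw //].
    by rewrite e eqxx in ne.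
  have lt_ij : (i < j)%N by rewrite -e -[ltnLHS]addn0 ltn_add2l.
  have [|||x x0 [[hx bx ux lx] ax]] := @nilpotent_kernel (a (E_ i j)) p
    (fun v => [/\ homogeneous v, killed_b v, killed_upper h.+1 v &
      forall ij : 'I_n.+1 * 'I_n.+1, ij \in l -> (ij.1 + h)%N = ij.2 -> a (E_ ij.1 ij.2) v = 0]) w _ _ wn0.
  - have comm0 x (i' j' : 'I_n.+1) : killed_upper h.+1 x -> (i' + h <= j')%N ->
        a (E_ i' j') x = 0 -> a (E_ i' j') (a (E_ i j) x) = 0.
      move=> ux le0 e0; have lt' : (i' < j')%N by lia.
      rewrite a_comm_v ?tr_delta_lt // e0 appE0 add0r !delta_mulE lin_combB_v.
      have -> : (j' == i)%:R *: a (E_ i' j) x = 0.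
        by case: eqP => [ej|_]; rewrite ?scale0r // ux ?scaler0 //; move/(congr1 val): ej => /=; lia.
      have -> : (j == i')%:R *: a (E_ i j') x = 0.
        by case: eqP => [ej|_]; rewrite ?scale0r // ux ?scaler0 //; move/(congr1 val): ej => /=; lia.
      by rewrite subr0.
    move=> x [hx bx ux lx]; split; first exact: homogeneous_a.
    + by apply: killed_b_a; rewrite ?tr_delta_lt.
    + by move=> i' j' le; apply: comm0 => //; [lia | apply: ux].
    by move=> ij ijl eij; apply: comm0 => //; [lia | apply: lx].
  - by [].
  - by rewrite a_delta_upper_nil.
  exists x => //; split=> // ij; rewrite inE => /predU1P [-> //|/lx //].
case=> w wn0 [hw bw uw lw]; exists w => //; split=> // i j.
rewrite leq_eqVlt => /predU1P [e|lt]; last by apply: uw; rewrite addnS.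
by apply: (lw (i, j)); rewrite ?mem_enum.
Qed.

(** For T = [a (sl_delta k i i)] the operator T^p - T is a scalar, so T is killed by a polynomial of
    degree p. Diagonal matrices commute with each other and preserve the remaining conditions, hence
    a common eigenvector. *)
Lemma exists_highest_weight :
  exists2 v, v != 0 & [/\ homogeneous v, killed_b v, killed_upper 1 v &
    forall i, exists r, a (sl_delta k i i) v = r *: v].
Proof.
have [u u0 [hu bu uu]] := exists_killed_upper.
have [eps hpr] := hu.
have /(_ (enum 'I_n.+1)) : forall l : seq 'I_n.+1,
    exists2 v, v != 0 & [/\ pr v = eps *: v, killed_b v, killed_upper 1 v &
      {in l, forall i, exists r, a (sl_delta k i i) v = r *: v}].
  elim=> [|i l [v vn0 [hv bv uv lv]]]; first by exists u.
  set T := a (sl_delta k i i).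
  have [s hs] : exists s, T ^+ p = T + s *: 1.
    have [|_ ->] := hT (A := sl_delta k i i); first exact: mxtrace_sl_delta.
    rewrite (sl_delta_pth chark p_gt2) eqxx scale1r.
    by exists (\tr (Theta * sl_delta k i i) ^+ p).
  pose q : {poly k} := 'X^p - 'X - s%:P.
  have q0 : q != 0.
    apply/eqP => /(congr1 (fun q : {poly k} => q`_p)); rewrite /q !coefB coefXn coefX coefC.
    rewrite eqxx coef0 gtn_eqF ?(ltnW p_gt2) // eqn0Ngt prime_gt0 // !subr0.
    by apply/eqP; rewrite oner_eq0.
  have qv : horner_alg T q v = 0.
    rewrite /q !rmorphB /= rmorphXn /= horner_algX horner_algC hs.
    by rewrite [T + _]addrC addrK subrr.
  have [||r [w [[hw bw uw lw] w0 Tw _]]] := @eigenvector_in _ _ _ nz T q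
    (fun v => [/\ pr v = eps *: v, killed_b v, killed_upper 1 v &
      {in l, forall i, exists r, a (sl_delta k i i) v = r *: v}]) v _ _ vn0 q0 qv.
  - move=> w [hw bw uw lw] r; split.
    + by rewrite appBE appZE /T (pr_eigen_a _ hw) hw !scalerA scalerBr scalerA mulrC.
    + by move=> B; rewrite appBE appZE bw killed_b_a ?mxtrace_sl_delta // scaler0 subrr.
    + move=> i' j' lt; rewrite appBE appZE uw // scaler0 subr0 /T.
      have lt' : (i' < j')%N by rewrite -addn1.
      rewrite a_comm_v ?mxtrace_sl_delta ?tr_delta_lt // uw // appE0 add0r.
      have [z ez] := sl_delta_diag_br k i i' j'.
      rewrite -opprB ez linearN oppEv (_ : a (z *: _) = z *: a (E_ i' j')).
        by rewrite scaleEv uw // scaler0 oppr0.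
      exact: linearZ.
    move=> j jl; have [s' es] := lw j jl; exists s'.
    rewrite appBE appZE es scalerBr !scalerA [s' * r]mulrC; congr (_ - _).
    rewrite /T a_comm_v ?mxtrace_sl_delta // es appZE sl_delta_diag_comm subrr.
    by rewrite linear0 addr0.
  - by split.
  exists w => //; split=> // j; rewrite inE => /predU1P [->|/lw //].
  by exists r.
case=> v vn0 [hv bv uv lv]; exists v => //; split=> //; first by exists eps.
by move=> i; apply: lv; rewrite mem_enum.
Qed.

Definition neg_op (t : neg_index n) : E :=
  let: (odd, ij) := t in
  if odd then c (E_ (val ij).1 (val ij).2) else a (E_ (val ij).1 (val ij).2).

Notation in_neg_span := (in_lin_span neg_op).

Lemma in_neg_span_low (i j : 'I_n.+1) : (j < i)%N -> in_neg_span (a (E_ i j)).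
Proof. by move=> lt; apply: (lin_span_op neg_op (false, exist _ (i, j) lt)). Qed.

Lemma in_neg_span_c_delta i j : in_neg_span (c (E_ i j)).
Proof.
case: (ltngtP i j) => [lt|lt|/val_inj ->].
- rewrite -[E_ i j]trmxK trmx_delta (rep_cT rep) -scaleN1r; apply: lin_spanZ.
  by apply: (lin_span_op neg_op (true, exist _ (j, i) lt)).
- by apply: (lin_span_op neg_op (true, exist _ (i, j) lt)).
by rewrite (rep_c_diag rep two); apply: (lin_span0 neg_op).
Qed.

Lemma in_neg_span_c C : in_neg_span (c C).
Proof.
rewrite (rep_lin_sum c C).
by do 2![apply: lin_span_sum => ? _]; apply/lin_spanZ/in_neg_span_c_delta.
Qed.

Lemma in_neg_span_low_br (i j l m : 'I_n.+1) : (j < i)%N -> (m < l)%N ->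
  in_neg_span (a (E_ i j * E_ l m - E_ l m * E_ i j)).
Proof.
move=> lt_ji lt_ml; rewrite !delta_mulE.
rewrite (_ : a _ = (j == l)%:R *: a (E_ i m) + - (m == i)%:R *: a (E_ l j)).
  apply: lin_spanD.
    case: eqP => [e|_]; last by rewrite scale0r; apply: (lin_span0 neg_op).
    by apply/lin_spanZ/in_neg_span_low; rewrite (ltn_trans lt_ml) // -e.
  case: eqP => [e|_]; last by rewrite oppr0 scale0r; apply: (lin_span0 neg_op).
  by apply/lin_spanZ/in_neg_span_low; rewrite (ltn_trans _ lt_ml) // e.
by rewrite -scaleNr linearD !linearZ.
Qed.

Lemma tr_low_pair (ij : low_pair n) : \tr (E_ (val ij).1 (val ij).2) = 0.
Proof. by case: ij => [[i j] /= lt]; rewrite mxtrace_delta -val_eqE gtn_eqF. Qed.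

Lemma neg_op_swap l l' : exists r (s : neg_index n -> k),
  neg_op l * neg_op l' = r *: (neg_op l' * neg_op l) + \sum_i s i *: neg_op i.
Proof.
have plus (S T U : E) : in_neg_span U -> S * T - T * S = U ->
    exists r (s : neg_index n -> k), S * T = r *: (T * S) + \sum_i s i *: neg_op i.
  by case=> s -> e; exists 1, s; rewrite scale1r -e addrC subrK.
have minus (S T : E) : S * T + T * S = 0 ->
    exists r (s : neg_index n -> k), S * T = r *: (T * S) + \sum_i s i *: neg_op i.
  move=> e; have [s es] := (lin_span0 neg_op); exists (-1), s.
  by rewrite -es addr0 scaleN1r; apply/eqP; rewrite -subr_eq0 opprK e.
case: l => [[] [[i j] lt]]; case: l' => [[] [[i' j'] lt']] /=.
- exact/minus/(rep_cc rep).
- have tr0 : \tr (E_ i' j') = 0 by rewrite mxtrace_delta -val_eqE gtn_eqF.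
  have := rep_ac rep (E_ i j) tr0; move/(congr1 -%R); rewrite opprB opprK.
  by apply: plus; apply: in_neg_span_c.
- have tr0 : \tr (E_ i j) = 0 by rewrite mxtrace_delta -val_eqE gtn_eqF.
  apply: plus (rep_ac rep (E_ i' j') tr0).
  by rewrite -scaleN1r; apply/lin_spanZ/in_neg_span_c.
have tr0 : \tr (E_ i' j') = 0 by rewrite mxtrace_delta -val_eqE gtn_eqF.
have tr0' : \tr (E_ i j) = 0 by rewrite mxtrace_delta -val_eqE gtn_eqF.
by apply: plus (rep_aa rep tr0' tr0); apply: in_neg_span_low_br.
Qed.

Definition scalar_op (z : E) : Prop := exists r : k, z = r *: 1.

Lemma neg_op_pow l : exists (z : E) (s : neg_index n -> k),
  scalar_op z /\ neg_op l ^+ neg_bound p l = z + \sum_i s i *: neg_op i.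
Proof.
have [s es] := (lin_span0 neg_op); case: l => [[] [[i j] /= lt]].
  exists 0, s; rewrite -es addr0; split; first by exists 0; rewrite scale0r.
  by rewrite /neg_bound /= expr2 (rep_c2 rep two).
exists ((Theta j i) ^+ p *: 1), s; rewrite -es addr0; split; first by exists (Theta j i ^+ p).
by rewrite /neg_bound /= a_delta_pth // -val_eqE gtn_eqF.
Qed.

Section NegativeSpan.
Variable v : V.
Hypotheses (vn0 : v != 0) (hv : homogeneous v) (bv : killed_b v) (uv : killed_upper 1 v).
Hypothesis dv : forall i, exists r, a (sl_delta k i i) v = r *: v.

Definition neg_words (u : V) : Prop :=
  gen_by (fun=> False) (fun u => exists w, u = word neg_op v w) u.

Lemma neg_words_op l u : neg_words u -> neg_words (neg_op l u).
Proof.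
elim=> {u} [_ [w ->]| |r u u' _ gu _ gu'|_ u []].
- by apply: gen_by_in; exists (l :: w).
- by rewrite appE0; apply: gen_by_0.
by rewrite appDE appZE; apply: gen_by_lin.
Qed.

Lemma neg_words_span T u : in_neg_span T -> neg_words u -> neg_words (T u).
Proof.
case=> s -> gu; rewrite sumEv; apply: gen_by_sum => l _.
by rewrite scaleEv; apply/gen_byZ/neg_words_op.
Qed.

Lemma neg_words_v : neg_words v.
Proof. by apply: gen_by_in; exists [::]. Qed.

Lemma neg_words_base A : \tr A = 0 -> neg_words (a A v).
Proof.
move=> A0; rewrite (rep_a_sum a A0) sumEv; apply: gen_by_sum => i _.
rewrite sumEv; apply: gen_by_sum => j _; rewrite scaleEv; apply: gen_byZ.
case: (ltngtP i j) => [lt|lt|/val_inj ->].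
- rewrite sl_delta_offdiag -?val_eqE ?ltn_eqF // uv; first exact: gen_by_0.
  by rewrite addn1.
- rewrite sl_delta_offdiag -?val_eqE ?gtn_eqF //.
  by apply: neg_words_span neg_words_v; apply: in_neg_span_low.
by have [r ->] := dv j; apply/gen_byZ/neg_words_v.
Qed.

(** Induction on the word: an operator is moved past the first letter, and the bracket, again an
    operator of the representation, acts on the shorter word. The brackets mix the types of
    operators, so the four statements are proved together. *)
Lemma neg_words_stable u : neg_words u ->
  [/\ forall A, \tr A = 0 -> neg_words (a A u), forall B, neg_words (b B u),
      forall C, neg_words (c C u) & neg_words (pr u)].
Proof.
elim=> {u} [_ [w ->]| |r u u' _ [ua ub uc up] _ [ua' ub' uc' up']|_ u []]; last 2 first.
- by split=> *; rewrite appE0; apply: gen_by_0.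
- have L x y : neg_words x -> neg_words y -> neg_words (r *: x + y) by exact: gen_by_lin.
  by split=> *; rewrite appDE appZE; apply: L; auto.
elim: w => [|l w [wa wb wc wp]].
  split=> /=; [exact: neg_words_base | | |].
  - by move=> B; rewrite bv; apply: gen_by_0.
  - by move=> C; apply: neg_words_span neg_words_v; apply: in_neg_span_c.
  by have [r ->] := hv; apply/gen_byZ/neg_words_v.
rewrite /= -/(word neg_op v w) in wa wb wc wp *; set u := word neg_op v w in wa wb wc wp *.
have ev (S T U : E) : S * T - T * S = U -> S (T u) = T (S u) + U u.
  by move/(congr1 (fun T : E => T u)); rewrite addEv oppEv !mulEv => <-; rewrite addrC subrK.
have od (S T U : E) : S * T + T * S = U -> S (T u) = U u - T (S u).
  by move/(congr1 (fun T : E => T u)); rewrite addEv !mulEv => <-; rewrite addrK.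
have opw l' u' : neg_words u' -> neg_words (neg_op l' u') by exact: neg_words_op.
case: l => [[] ij]; rewrite /= -?/(neg_op (true, ij)) -?/(neg_op (false, ij)).
  split.
  - move=> A A0; rewrite (ev _ _ _ (rep_ac rep _ A0)); apply: gen_byD.
      by apply: (opw (true, ij)); apply: wa.
    by rewrite oppEv; apply/gen_byN/wc.
  - move=> B; rewrite (od _ _ _ (rep_bc rep _ _)); apply: gen_byB.
      by apply: wa; apply: mxtrace_symM_alt.
    by apply: (opw (true, ij)); apply: wb.
  - move=> C; rewrite (od _ _ _ (rep_cc rep _ _)) zeroEv sub0r; apply: gen_byN.
    by apply: (opw (true, ij)); apply: wc.
  rewrite (od _ _ _ (gi_pr_c gi _)); apply: gen_byB; first exact: wc.
  exact: (opw (true, ij)).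
have t0 := tr_low_pair ij; split.
- move=> A A0; rewrite (ev _ _ _ (rep_aa rep A0 t0)); apply: gen_byD.
    by apply: (opw (false, ij)); apply: wa.
  by apply: wa; apply: mxtraceM_comm.
- move=> B; have := ev _ _ _ (rep_ab rep B t0) => /esym/(canRL (addrK _)) ->.
  by apply: gen_byB; [apply: (opw (false, ij)); apply: wb | apply: wb].
- move=> C; have := ev _ _ _ (rep_ac rep C t0) => /esym/(canRL (addrK _)) ->.
  rewrite oppEv opprK.
  by apply: gen_byD; [apply: (opw (false, ij)); apply: wc | apply: wc].
by rewrite -mulEv (gi_pr_a gi) mulEv; apply: (opw (false, ij)).
Qed.

Lemma neg_words_full u : neg_words u.
Proof.
move: u; have [||||||h|//] := gi_irr gi (W := neg_words).
- exact: gen_by_0.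
- by move=> r u u'; apply: gen_by_lin.
- by move=> A u A0 /neg_words_stable [h _ _ _]; apply: h.
- by move=> B u /neg_words_stable [].
- by move=> C u /neg_words_stable [].
- by move=> u /neg_words_stable [].
by case/eqP: vn0; apply: h; apply: neg_words_v.
Qed.

Lemma neg_words_has_dim : exists2 d, has_dim V d & (d <= kw_bound p n)%N.
Proof.
have sz := size_restricted_words neg_op (@neg_bound p n) v.
rewrite /kw_bound -sz; set s := restricted_words _ _ _.
apply: (has_dim_of_family (b := fun i : 'I_(size s) => s`_i)) => u.
apply: gen_by_none_coord.
have := neg_words_full u; apply: gen_by_trans => [{}u [w ->]|z _ []].
have Zx z i : scalar_op z -> z * neg_op i = neg_op i * z.
  by case=> r ->; rewrite -scalerAl -scalerAr mul1r mulr1.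
have b1 (l : neg_index n) : (1 < neg_bound p l)%N by rewrite /neg_bound; case: ifP => // _; apply: ltnW.
have := gen_restricted_words (Z := scalar_op) v Zx b1 neg_op_swap neg_op_pow w.
apply: gen_by_trans => [{}u us|_ {}u [_ [r ->] ->] gu]; first exact: gen_by_in.
by rewrite scaleEv oneEv; apply: gen_byZ.
Qed.
End NegativeSpan.
End HighestWeight.

Lemma graded_irreducible_dim (k : closedFieldType) (p n : nat) (V : lmodType k) (v0 : V)
    (nz : v0 != 0) (a b c : {linear 'M[k]_n.+1 -> lin_end nz}) (pr : lin_end nz) :
  p \in [pchar k] -> (2 < p)%N -> graded_irreducible a b c pr ->
  exists2 d, has_dim V d & (d <= kw_bound p n)%N.
Proof.
move=> chark p_gt2 gi.
have [a' [b' [c' [Theta [gi' hT up]]]]] := triangular_p_character chark p_gt2 gi.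
have [v vn0 [hv bv uv dv]] := exists_highest_weight chark p_gt2 gi' hT up.
exact: (neg_words_has_dim chark p_gt2 gi' hT vn0 hv bv uv dv).
Qed.

(** * Block description of p(n) *)

Section Periplectic.
Variables (k : fieldType) (n : nat).
Notation M := 'M[k]_n.+1.
Hypothesis two : 2%:R != 0 :> k.

Definition pblock (A B C : M) : 'M[k]_(n.+1 + n.+1) := block_mx A B C (- A^T).

Lemma pblock_lin r A B C A' B' C' :
  pblock (r *: A + A') (r *: B + B') (r *: C + C') = r *: pblock A B C + pblock A' B' C'.
Proof. by rewrite /pblock scale_block_mx add_block_mx linearP opprD scalerN. Qed.

Lemma pblock0 : pblock 0 0 0 = 0.
Proof. by rewrite /pblock trmx0 oppr0 block_mx0. Qed.

Lemma gl_proj_pblock i A B C :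
  gl_proj i (pblock A B C) = if i then pblock 0 B C else pblock A 0 0.
Proof.
by rewrite /gl_proj /pblock !(block_mxKul, block_mxKur, block_mxKdl, block_mxKdr) trmx0 oppr0.
Qed.

Lemma sbracket_pblock A B C A' B' C' :
  B = B^T -> C = - C^T -> B' = B'^T -> C' = - C'^T ->
  sbracket (pblock A B C) (pblock A' B' C')
    = pblock (A * A' - A' * A + (B * C' + B' * C))
             (A * B' + B' * A^T - (A' * B + B * A'^T))
             (A'^T * C + C * A' - (A^T * C' + C' * A)).
Proof.
move=> hB hC hB' hC'; rewrite /sbracket !big_bool !gl_proj_pblock /=.
rewrite expr1 !expr0 scaleN1r !scale1r /pblock !trmx0 oppr0 !mulmx_block.
rewrite !(mulmx0, mul0mx, addr0, add0r) !(add_block_mx, opp_block_mx, oppr0, addr0, add0r).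
have tr (X Y : M) : (X * Y)^T = Y^T * X^T by exact: trmx_mul.
rewrite !mulmxE !(mulrN, mulNr, opprK).
congr block_mx.
- by rewrite opprD !opprK [RHS]addrAC !addrA.
- by rewrite !opprD opprK addrACA [RHS]addrACA; congr (_ + _); rewrite addrC.
- by rewrite !opprD opprK addrACA; congr (_ + _); rewrite addrC.
have tC (X Y : M) : X = X^T -> Y = - Y^T -> (X * Y)^T = - (Y * X).
  by move=> hX hY; rewrite tr -hX {2}hY mulNr opprK.
have -> : (A * A' - A' * A + (B * C' + B' * C))^T
    = A'^T * A^T - A^T * A'^T - (C' * B + C * B').
  have tD (X Y : M) : (X + Y)^T = X^T + Y^T by exact: linearD.
  have tN (X : M) : (- X)^T = - X^T by exact: linearN.
  by rewrite !tD tN (tC B C') // (tC B' C) // !tr opprD.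
rewrite !opprD !opprK addrACA [RHS]addrC [C * B' + _]addrC [C' * B + _]addrC.
rewrite addrACA [C * B' + _]addrC [A^T * _ + _]addrC addrACA.
by congr (_ + _); rewrite addrC.
Qed.

Let trM (X Y : M) : (X * Y)^T = Y^T * X^T. Proof. exact: trmx_mul. Qed.
Let trD (X Y : M) : (X + Y)^T = X^T + Y^T. Proof. exact: linearD. Qed.
Let trN (X : M) : (- X)^T = - X^T. Proof. exact: linearN. Qed.

Lemma symD_act (A B : M) : A * (B + B^T) + (B + B^T) * A^T
  = (A * B + B * A^T) + (A * B + B * A^T)^T.
Proof.
by rewrite trD !trM trmxK mulrDr mulrDl addrACA [A * B^T + _]addrC.
Qed.

Lemma altB_act (A C : M) : A^T * (C - C^T) + (C - C^T) * A
  = (A^T * C + C * A) - (A^T * C + C * A)^T.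
Proof.
by rewrite trD !trM trmxK mulrBr mulrBl addrACA -opprD [C^T * A + _]addrC.
Qed.

Lemma sym_act (A B : M) : B = B^T -> A * B + B * A^T = (A * B + B * A^T)^T.
Proof. by move=> hB; rewrite trD !trM trmxK -hB addrC. Qed.

Lemma alt_act (A C : M) : C = - C^T -> A^T * C + C * A = - (A^T * C + C * A)^T.
Proof.
move=> hC; have hC' : C^T = - C by rewrite {2}hC opprK.
by rewrite trD !trM trmxK hC' mulNr mulrN -opprD opprK addrC.
Qed.

Lemma mxtraceM_sym_alt (B C : M) : B = B^T -> C = - C^T -> \tr (B * C) = 0.
Proof.
move=> hB hC; have := mxtrace_symM_alt B C two; rewrite -hB -hC.
rewrite -!mulr2n mulrnAr mulrnAl -mulrnA raddfMn /= -mulr_natr => /eqP.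
by rewrite mulf_eq0 natrM mulf_eq0 (negPf two) !orbF => /eqP.
Qed.

Definition in_periplectic (X : 'M[k]_(n.+1 + n.+1)) : Prop :=
  exists A B C : M, [/\ X = pblock A B C, \tr A = 0, B = B^T & C = - C^T].

Lemma in_periplectic_lin r X Y :
  in_periplectic X -> in_periplectic Y -> in_periplectic (r *: X + Y).
Proof.
move=> [A [B [C [-> tA hB hC]]]] [A' [B' [C' [-> tA' hB' hC']]]].
exists (r *: A + A'), (r *: B + B'), (r *: C + C'); split.
- by rewrite pblock_lin.
- by rewrite linearP /= tA tA' mulr0 addr0.
- by rewrite linearP /= -hB -hB'.
by rewrite linearP /= opprD -scalerN -hC -hC'.
Qed.

(** The upper left block of a bracket has trace zero: commutators have, and so has the product of a
    symmetric and a skew-symmetric matrix. *)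
Lemma in_periplectic_derived X : X \in periplectic k n.+1 -> in_periplectic X.
Proof.
have in0 : in_periplectic 0.
  by exists 0, 0, 0; rewrite pblock0 linear0 trmx0 oppr0.
rewrite /periplectic /derived; set s := [seq _ | _ <- _, _ <- _] => Xs.
rewrite (coord_span (X := in_tuple s) Xs) /=; elim/big_rec: _ => // i Y _ inY.
apply: in_periplectic_lin inY; have : (in_tuple s)`_i \in s by rewrite mem_nth.
case/allpairsP => -[Z Z'] [/= /vbasis_mem/ptildeP [A [B [C [-> hB hC]]]]].
move=> /vbasis_mem/ptildeP [A' [B' [C' [-> hB' hC']]]] ->.
rewrite -/(pblock A B C) -/(pblock A' B' C') sbracket_pblock //.
eexists _, _, _; split; first by [].
- by rewrite linearD /= mxtraceM_comm linearD /= !mxtraceM_sym_alt // !addr0.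
- by rewrite trD trN -!sym_act.
have altB (U W : M) : U = - U^T -> W = - W^T -> U - W = - (U - W)^T.
  by move=> hU hW; rewrite trD trN opprD -hU -hW.
by apply: altB; apply: alt_act.
Qed.

Lemma bracket_in_periplectic A B C A' B' C' :
  B = B^T -> C = - C^T -> B' = B'^T -> C' = - C'^T ->
  pblock (A * A' - A' * A + (B * C' + B' * C))
         (A * B' + B' * A^T - (A' * B + B * A'^T))
         (A'^T * C + C * A' - (A^T * C' + C' * A)) \in periplectic k n.+1.
Proof.
move=> hB hC hB' hC'; rewrite -sbracket_pblock //.
have /derivedP := subvv (periplectic k n.+1); apply.
  by apply/ptildeP; exists A, B, C.
by apply/ptildeP; exists A', B', C'.
Qed.

Let sym0 : (0 : M) = 0^T. Proof. by rewrite trmx0. Qed.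
Let alt0 : (0 : M) = - 0^T. Proof. by rewrite trmx0 oppr0. Qed.

(** Every [sl_delta i j] is a commutator of matrix units: of [E_(j,max)] and [E_(max,j)] on the
    diagonal, of E_ii and E_ij off it. *)
Lemma periplectic_even A : \tr A = 0 -> pblock A 0 0 \in periplectic k n.+1.
Proof.
move=> A0; have br (A1 A2 : M) : pblock (A1 * A2 - A2 * A1) 0 0 \in periplectic k n.+1.
  have := @bracket_in_periplectic A1 0 0 A2 0 0 sym0 alt0 sym0 alt0.
  by rewrite !(mulr0, mul0r, addr0, subr0).
have sl i j : pblock (sl_delta k i j) 0 0 \in periplectic k n.+1.
  have [->|ne] := eqVneq i j.
    rewrite /sl_delta eqxx scale1r; have := br (delta_mx j ord_max) (delta_mx ord_max j).
    by rewrite !delta_mulE !eqxx !scale1r.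
  rewrite sl_delta_offdiag //; have := br (delta_mx i i) (delta_mx i j).
  by rewrite !delta_mulE eqxx eq_sym (negPf ne) scale1r scale0r subr0.
have lin r (X Y : M) : pblock X 0 0 \in periplectic k n.+1 ->
    pblock Y 0 0 \in periplectic k n.+1 -> pblock (r *: X + Y) 0 0 \in periplectic k n.+1.
  move=> hX hY; have := pblock_lin r X 0 0 Y 0 0; rewrite !scaler0 !addr0 => ->.
  by rewrite memvD ?memvZ.
have p0 : pblock 0 0 0 \in periplectic k n.+1 by rewrite pblock0 mem0v.
rewrite (sl_sum A0); elim/big_rec: _ => // i X _ hX.
rewrite -[X in X + _]scale1r; apply: (lin) => //.
elim/big_rec: _ => // j Y _ hY.
exact: lin.
Qed.

(** The bracket with [pblock 1 0 0] multiplies B by 2 and C by -2. *)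
Lemma periplectic_odd B C : B = B^T -> C = - C^T -> pblock 0 B C \in periplectic k n.+1.
Proof.
move=> hB hC; have hC' : - C = - (- C)^T by rewrite trN -hC.
have := @bracket_in_periplectic 1 0 0 1 B (- C) sym0 alt0 hB hC'.
rewrite !(mulr0, mul0r, addr0, subr0, mulr1, mul1r, trmx1, subrr, sub0r) -!mulr2n.
have -> : pblock 0 (B *+ 2) (- (- C *+ 2)) = 2%:R *: pblock 0 B C.
  have := pblock_lin 2%:R 0 B C 0 0 0; rewrite !scaler0 pblock0 !addr0 => <-.
  by rewrite !scaler_nat mulNrn opprK.
by move/(memvZ (2%:R)^-1); rewrite scalerA mulVf // scale1r.
Qed.

Lemma periplecticP X : X \in periplectic k n.+1 <-> in_periplectic X.
Proof.
split; first exact: in_periplectic_derived.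
case=> A [B [C [-> A0 hB hC]]].
have := pblock_lin 1 A 0 0 0 B C; rewrite !scaler0 !scale1r !addr0 !add0r => ->.
by rewrite memvD ?periplectic_even ?periplectic_odd.
Qed.

Lemma homog_periplecticP X i : X \in homog (periplectic k n.+1) i <->
  exists A B C : M, [/\ X = if i then pblock 0 B C else pblock A 0 0,
    \tr A = 0, B = B^T & C = - C^T].
Proof.
rewrite memv_cap; split.
  case/andP=> /periplecticP [A [B [C [-> A0 hB hC]]]] /gl_partP <-.
  by exists A, B, C; rewrite gl_proj_pblock.
case=> A [B [C [-> A0 hB hC]]]; apply/andP; split.
  by apply/periplecticP; case: i; [exists 0, B, C | exists A, 0, 0]; rewrite ?linear0.
by apply/gl_partP; case: i; rewrite gl_proj_pblock.
Qed.
End Periplectic.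

(** * From supermodules to operators *)

Section FromSupermodule.
Variables (k : closedFieldType) (n : nat) (V0 V1 : lmodType k).
Notation V := (V0 * V1)%type.
Notation M := 'M[k]_n.+1.
Notation g := (periplectic k n.+1).
Variables (rho : 'M[k]_(n.+1 + n.+1) -> V -> V) (v0 : V) (nz : v0 != 0).
Notation E := (lin_end nz).
Hypothesis two : 2%:R != 0 :> k.
Hypothesis irr : irreducible_supermodule g rho.

Let sm : supermodule g rho. Proof. by case: irr. Qed.

(** [rho] is arbitrary outside of [g], so its linearity is decided; the default value 0 is never met
    on [g]. *)
Definition rho_end (X : 'M[k]_(n.+1 + n.+1)) : E :=
  match pselect (linear (rho X)) with
  | left h => LinEnd (rho X) h
  | right _ => 0
  end.

Lemma rho_endE X v : X \in g -> rho_end X v = rho X v.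
Proof.
move=> /(supermod_linear sm) h; rewrite /rho_end.
by case: pselect => // /(_ h).
Qed.

Lemma rho_end_lin r X Y : X \in g -> Y \in g ->
  rho_end (r *: X + Y) = r *: rho_end X + rho_end Y.
Proof.
move=> Xg Yg; apply: lin_end_ext => v.
rewrite addEv scaleEv !rho_endE ?(supermod_linearl sm) //.
by rewrite memvD ?memvZ.
Qed.

(** A linear retraction onto the trace zero matrices, which makes [rho_a] linear on all matrices. *)
Definition sl_proj (A : M) : M := A - \tr A *: delta_mx ord_max ord_max.

Lemma mxtrace_sl_proj A : \tr (sl_proj A) = 0.
Proof. by rewrite linearB linearZ /= mxtrace_delta eqxx mulr1 subrr. Qed.

Lemma sl_proj_lin : linear sl_proj.
Proof.
by move=> r A B; rewrite /sl_proj linearP /= scalerDl scalerBr scalerA opprD addrACA.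
Qed.

Lemma sl_proj_id A : \tr A = 0 -> sl_proj A = A.
Proof. by move=> A0; rewrite /sl_proj A0 scale0r subr0. Qed.

Definition rho_a (A : M) : E := rho_end (pblock (sl_proj A) 0 0).
Definition rho_b (B : M) : E := rho_end (pblock 0 (B + B^T) 0).
Definition rho_c (C : M) : E := rho_end (pblock 0 0 (C - C^T)).

Let sym0 : (0 : M) = 0^T. Proof. by rewrite trmx0. Qed.
Let alt0 : (0 : M) = - 0^T. Proof. by rewrite trmx0 oppr0. Qed.
Let symD (B : M) : B + B^T = (B + B^T)^T.
Proof. by rewrite linearD /= trmxK addrC. Qed.
Let altB (C : M) : C - C^T = - (C - C^T)^T.
Proof. by rewrite linearB /= trmxK opprB. Qed.

Lemma pblock_a_in A : pblock (sl_proj A) 0 0 \in g.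
Proof. by apply: periplectic_even => //; apply: mxtrace_sl_proj. Qed.
Lemma pblock_b_in B : pblock 0 (B + B^T) 0 \in g.
Proof. exact: periplectic_odd. Qed.
Lemma pblock_c_in C : pblock 0 0 (C - C^T) \in g.
Proof. exact: periplectic_odd. Qed.

Lemma rho_a_linear : linear rho_a.
Proof.
move=> r A B; rewrite /rho_a sl_proj_lin -rho_end_lin ?pblock_a_in //.
by rewrite -pblock_lin !scaler0 !addr0.
Qed.

Lemma rho_b_linear : linear rho_b.
Proof.
move=> r A B; rewrite /rho_b -rho_end_lin ?pblock_b_in //.
by rewrite -pblock_lin !scaler0 !addr0 linearP /= scalerDr addrACA.
Qed.

Lemma rho_c_linear : linear rho_c.
Proof.
move=> r A B; rewrite /rho_c -rho_end_lin ?pblock_c_in //.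
by rewrite -pblock_lin !scaler0 !addr0 linearP /= scalerBr opprD addrACA.
Qed.

HB.instance Definition _ := GRing.isLinear.Build _ _ _ _ rho_a rho_a_linear.
HB.instance Definition _ := GRing.isLinear.Build _ _ _ _ rho_b rho_b_linear.
HB.instance Definition _ := GRing.isLinear.Build _ _ _ _ rho_c rho_c_linear.

Fact even_proj_linear : linear (fun v : V => (v.1, 0) : V).
Proof. by move=> r u v; congr (_, _); rewrite /= scaler0 addr0. Qed.
Definition even_proj : E := LinEnd _ even_proj_linear.

Lemma homog_a A : pblock (sl_proj A) 0 0 \in homog g false.
Proof.
by apply/(homog_periplecticP two); exists (sl_proj A), 0, 0; rewrite mxtrace_sl_proj.
Qed.
Lemma homog_b B : pblock 0 (B + B^T) 0 \in homog g true.
Proof. by apply/(homog_periplecticP two); exists 0, (B + B^T), 0; rewrite linear0. Qed.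
Lemma homog_c C : pblock 0 0 (C - C^T) \in homog g true.
Proof. by apply/(homog_periplecticP two); exists 0, 0, (C - C^T); rewrite linear0. Qed.

Lemma rho_end_br X Y i j : X \in homog g i -> Y \in homog g j ->
  rho_end (sbracket X Y) = rho_end X * rho_end Y - (-1) ^+ (i && j) *: (rho_end Y * rho_end X).
Proof.
move=> Xi Yj; have [Xg Yg] : X \in g /\ Y \in g.
  by move: Xi Yj; rewrite !memv_cap => /andP [-> _] /andP [-> _].
apply: lin_end_ext => v; rewrite addEv oppEv scaleEv !mulEv !rho_endE //.
  exact: (supermod_bracket sm).
move/(homog_periplecticP two): Xi => [A [B [C [-> A0 hB hC]]]].
move/(homog_periplecticP two): Yj => [A' [B' [C' [-> A'0 hB' hC']]]].
by case: (i); case: (j); rewrite sbracket_pblock // bracket_in_periplectic.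
Qed.

Lemma rho_end0 : rho_end 0 = 0.
Proof.
have := rho_end_lin 1 (mem0v g) (mem0v g); rewrite scaler0 addr0 scale1r => /eqP.
by rewrite -subr_eq subrr eq_sym => /eqP.
Qed.

Lemma rho_rep : periplectic_rep rho_a rho_b rho_c.
Proof.
have ev X Y j : X \in homog g false -> Y \in homog g j ->
    rho_end X * rho_end Y - rho_end Y * rho_end X = rho_end (sbracket X Y).
  by move=> Xe Yj; rewrite (rho_end_br Xe Yj) scale1r.
have od X Y : X \in homog g true -> Y \in homog g true ->
    rho_end X * rho_end Y + rho_end Y * rho_end X = rho_end (sbracket X Y).
  by move=> Xe Yj; rewrite (rho_end_br Xe Yj) expr1 scaleN1r opprK.
have trT (X Y : M) : (X * Y)^T = Y^T * X^T by exact: trmx_mul.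
have trN (X : M) : (- X)^T = - X^T by exact: linearN.
have simp := (mulr0, mul0r, addr0, add0r, subr0, trmx0, oppr0, sub0r).
split.
- move=> A A' A0 A'0; rewrite (ev _ _ _ (homog_a A) (homog_a A')) sbracket_pblock //.
  rewrite !sl_proj_id // !simp; congr (rho_end (pblock _ _ _)).
  by rewrite sl_proj_id // mxtraceM_comm.
- move=> A B A0; rewrite (ev _ _ _ (homog_a A) (homog_b B)) sbracket_pblock //.
  by rewrite sl_proj_id // !simp symD_act.
- move=> A C A0; rewrite (ev _ _ _ (homog_a A) (homog_c C)) sbracket_pblock //.
  rewrite sl_proj_id // !simp (_ : - rho_c _ = rho_c (- (A^T * C + C * A))).
    rewrite altB_act /rho_c; congr (rho_end (pblock _ _ _)).
    by rewrite opprB trN opprK addrC.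
  exact/esym/linearN.
- move=> B B'; rewrite (od _ _ (homog_b B) (homog_b B')) sbracket_pblock // !simp.
  by rewrite pblock0 rho_end0.
- move=> C C'; rewrite (od _ _ (homog_c C) (homog_c C')) sbracket_pblock // !simp.
  by rewrite pblock0 rho_end0.
- move=> B C; rewrite (od _ _ (homog_b B) (homog_c C)) sbracket_pblock // !simp.
  by congr (rho_end (pblock _ _ _)); rewrite sl_proj_id ?mxtrace_symM_alt.
- by move=> B; rewrite [LHS]/(rho_end (pblock 0 (B^T + B^T^T) 0)) trmxK addrC.
move=> C; rewrite (_ : - rho_c C = rho_c (- C)); last exact/esym/linearN.
rewrite [LHS]/(rho_end (pblock 0 0 (C^T - C^T^T))).
by rewrite [RHS]/(rho_end (pblock 0 0 (- C - (- C)^T))) trN trmxK opprK addrC.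
Qed.

(** Halving the odd blocks undoes the symmetrization in [rho_b] and the skew-symmetrization in
    [rho_c]. *)
Lemma rho_end_decomp X : X \in g -> exists A B C, \tr A = 0 /\
  rho_end X = rho_a A + rho_b B + rho_c C.
Proof.
move/(periplecticP two) => [A [B [C [-> A0 hB hC]]]].
exists A, (2%:R^-1 *: B), (2%:R^-1 *: C); split=> //.
rewrite /rho_a /rho_b /rho_c sl_proj_id //.
have half (Y : M) : 2%:R^-1 *: Y + 2%:R^-1 *: Y = Y.
  by rewrite -scalerDr -mulr2n -scaler_nat scalerA mulVf ?scale1r.
have tZ r (Y : M) : (r *: Y)^T = r *: Y^T by exact: linearZ.
rewrite !tZ -hB half -scalerN -hC half.
have e1 := pblock_lin 1 A 0 0 0 B C; have e2 := pblock_lin 1 0 B 0 0 0 C.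
rewrite !scaler0 !scale1r !addr0 !add0r in e1 e2.
have bg : pblock 0 B 0 \in g by apply: periplectic_odd.
have cg : pblock 0 0 C \in g by apply: periplectic_odd.
have ag : pblock A 0 0 \in g by apply: periplectic_even.
rewrite e1 e2 -[pblock A 0 0]scale1r rho_end_lin ?memvD // scale1r.
by rewrite -[pblock 0 B 0]scale1r rho_end_lin // !scale1r addrA.
Qed.

Lemma rho_graded_irreducible : graded_irreducible rho_a rho_b rho_c even_proj.
Proof.
have par X i v : X \in homog g i -> even_proj (rho_end X v)
    = rho_end X (if i then v - even_proj v else even_proj v).
  move=> Xi; have Xg : X \in g by move: Xi; rewrite memv_cap => /andP [].
  pose v0' : V := (v.1, 0); pose v1' : V := (0, v.2).
  have ev : v = v0' + v1' by rewrite /v0' /v1'; case: (v) => x y; congr (_, _); rewrite ?addr0 ?add0r.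
  have e0 : even_proj v = v0' by [].
  have e1 : v - even_proj v = v1' by rewrite e0 {1}ev addrC addKr.
  have p0 := @supermod_parity _ _ _ _ _ _ _ sm i false v0' X Xi (erefl _).
  have p1 := @supermod_parity _ _ _ _ _ _ _ sm i true v1' X Xi (erefl _).
  rewrite -!rho_endE // in p0 p1.
  have proj0 w : w.1 = 0 -> even_proj w = 0 by move=> /= ->.
  have proj1 w : w.2 = 0 -> even_proj w = w by case: w => x y /= ->.
  rewrite e1 e0 {1}ev !appDE; case: i Xi p0 p1 {e0 e1} => Xi p0 p1.
    by rewrite (proj0 _ p0) (proj1 _ p1) add0r.
  by rewrite (proj1 _ p0) (proj0 _ p1) addr0.
split.
- exact: rho_rep.
- by apply: lin_end_ext => v.
- by move=> A; apply: lin_end_ext => v; rewrite !mulEv (par _ _ _ (homog_a A)).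
- move=> B; apply: lin_end_ext => v; rewrite addEv !mulEv (par _ _ _ (homog_b B)).
  by rewrite appBE subrK.
- move=> B; apply: lin_end_ext => v; rewrite addEv !mulEv (par _ _ _ (homog_c B)).
  by rewrite appBE subrK.
move=> W W0 Wl Wa Wb Wc Wp; case: irr => _ _; apply.
have WD u v : W u -> W v -> W (u + v) by move=> Wu Wv; rewrite -[u]scale1r; apply: Wl.
split=> // [v Wv|X Xg v Wv].
  have e : v = even_proj v + (0, v.2).
    by case: (v) => x y; congr (_, _); rewrite /= ?addr0 ?add0r.
  split; first exact: Wp.
  have -> : (0, v.2) = - 1 *: even_proj v + v.
    by rewrite scaleN1r [X in _ = _ + X]e addKr.
  by apply: Wl => //; apply: Wp.
rewrite -rho_endE //; have [A [B [C [A0 ->]]]] := rho_end_decomp Xg.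
by rewrite !addEv; apply: (WD); [apply: (WD)|]; auto.
Qed.
End FromSupermodule.

Lemma irreducible_supermodule_dim (k : closedFieldType) (p n : nat) (V0 V1 : lmodType k)
    (rho : 'M[k]_(n.+1 + n.+1) -> V0 * V1 -> V0 * V1) :
  p \in [pchar k] -> (2 < p)%N -> irreducible_supermodule (periplectic k n.+1) rho ->
  exists2 d, has_dim (V0 * V1)%type d & (d <= kw_bound p n)%N.
Proof.
move=> chark p_gt2 irr; have [_ [v0 nz] _] := irr.
have two := pchar_two chark p_gt2.
exact: (graded_irreducible_dim chark p_gt2 (rho_graded_irreducible nz two irr)).
Qed.

(** * The lower bound *)

Section Drop.
Variables (k : fieldType) (d : nat).
Notation E := 'M[k]_d.+1.
Notation T := 'cV[k]_d.+1.
Implicit Types (K : {vspace T}) (x y : E) (v : T).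

Definition mx_ker x : {vspace T} := lker (linfun (mulmx x)).

Lemma mx_kerP x v : (v \in mx_ker x) = (x *m v == 0).
Proof. by rewrite memv_ker lfunE. Qed.

Lemma actM x y v : (x * y) *m v = x *m (y *m v).
Proof. by rewrite -mulmxE -mulmxA. Qed.

Lemma act1 v : (1 : E) *m v = v.
Proof. exact: mul1mx. Qed.

Definition stable K x : Prop := forall v, v \in K -> x *m v \in K.

Lemma stableM K x y : stable K x -> stable K y -> stable K (x * y).
Proof. by move=> hx hy v vK; rewrite actM; apply/hx/hy. Qed.

Lemma stableX K x m : stable K x -> stable K (x ^+ m).
Proof.
move=> hx; elim: m => [|m IH]; last by rewrite exprS; apply: stableM.
by rewrite expr0 => v vK; rewrite act1.
Qed.

Lemma stableD K x y : stable K x -> stable K y -> stable K (x + y).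
Proof. by move=> hx hy v vK; rewrite mulmxDl memvD ?hx ?hy. Qed.

Lemma stableZ K r x : stable K x -> stable K (r *: x).
Proof. by move=> hx v vK; rewrite -scalemxAl memvZ ?hx. Qed.

(* The kernels of the powers of x grow by at least the dimension of ker x in each
   of the first r steps, since x ^+ i maps onto the kernel. *)
Lemma dim_drop K x r :
  (forall i v, (i < r)%N -> v \in K -> x *m v = 0 ->
     exists2 u, u \in K & x ^+ i *m u = v) ->
  (r * \dim (K :&: mx_ker x) <= \dim K)%N.
Proof.
move=> lift; suff /(_ r (leqnn r)) h : forall i, (i <= r)%N ->
    (i * \dim (K :&: mx_ker x) <= \dim (K :&: mx_ker (x ^+ i)))%N.
  by apply: leq_trans h _; apply/dimvS/capvSl.
elim=> [|i IH] lt_ir; first by rewrite mul0n.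
have f := limg_ker_dim (linfun (mulmx (x ^+ i))) (K :&: mx_ker (x ^+ i.+1)).
rewrite -f mulSn addnC leq_add //.
  apply: leq_trans (IH (ltnW lt_ir)) _; apply/dimvS/subvP => v.
  rewrite !memv_cap !mx_kerP => /andP [-> /eqP e].
  by rewrite exprS actM e mulmx0 eqxx.
apply/dimvS/subvP => v; rewrite memv_cap mx_kerP => /andP [vK /eqP xv].
have [u uK xu] := lift i v lt_ir vK xv.
apply/memv_imgP; exists u; last by rewrite lfunE.
by rewrite memv_cap uK mx_kerP exprS actM xu xv eqxx.
Qed.

Lemma nilpotent_ker_neq0 K x m :
  stable K x -> x ^+ m = 0 -> K != 0%VS -> (K :&: mx_ker x)%VS != 0%VS.
Proof.
move=> Kx xm; rewrite -!subv0; apply: contra => /subvP h; apply/subvP => v vK.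
have {xm} : x ^+ m *m v = 0 by rewrite xm mul0mx.
elim: m => [|m IH]; first by rewrite expr0 act1 => ->; rewrite mem0v.
move=> e; apply: IH; have := h (x ^+ m *m v).
rewrite memv_cap (stableX m Kx vK) mx_kerP -actM -exprS e eqxx /= memv0.
by move/(_ isT)/eqP.
Qed.

Section Pair.
Variables (p : nat) (K : {vspace T}) (x y u u' : E) (s : k).
Hypothesis chark : p \in [pchar k].
Hypotheses (Kx : stable K x) (Ky : stable K y) (Ku' : stable K u').
Hypotheses (uu' : u * u' = 1) (s0 : s != 0).
Hypothesis xu : forall v, v \in K -> x *m (u *m v) = u *m (x *m v).

Let u'u : u' * u = 1. Proof. exact: mulmx1C. Qed.

Let xu' v : v \in K -> x *m (u' *m v) = u' *m (x *m v).
Proof.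
move=> vK; have := xu (Ku' vK); rewrite -(actM u u') uu' act1 => ->.
by rewrite -(actM u' u) u'u act1.
Qed.

(** A vector v of the kernel is the image of s^-1 y u^-1 v: the other term of the anticommutator
    disappears since x commutes with u^-1. *)
Lemma odd_drop :
  (forall v, v \in K -> x *m (y *m v) + y *m (x *m v) = s *: (u *m v)) ->
  (2 * \dim (K :&: mx_ker x) <= \dim K)%N.
Proof.
move=> br; apply: dim_drop => -[|[|//]] v _ vK xv.
  by exists v => //; rewrite expr0 act1.
exists (s^-1 *: (y *m (u' *m v))); first by rewrite memvZ // Ky // Ku'.
rewrite expr1 -scalemxAr; have := br _ (Ku' vK).
rewrite xu' // xv !mulmx0 addr0 => ->.
by rewrite -actM uu' act1 scalerA mulVf // scale1r.
Qed.

(** The operator z = s^-1 y u^-1 satisfies the Weyl relation x z = z x + 1 on [K]. Hence x^i z^i v =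
    i! v for v in the kernel of x, and i! is invertible for i < p. *)
Lemma even_drop :
  (forall v, v \in K -> x *m (y *m v) - y *m (x *m v) = s *: (u *m v)) ->
  (p * \dim (K :&: mx_ker x) <= \dim K)%N.
Proof.
move=> br; pose z := s^-1 *: (y * u').
have Kz : stable K z by apply/stableZ/stableM.
have xz v : v \in K -> x *m (z *m v) = z *m (x *m v) + v.
  move=> vK; rewrite /z -!scalemxAl !actM -scalemxAr.
  have := br _ (Ku' vK); rewrite xu' // => /eqP; rewrite subr_eq => /eqP ->.
  by rewrite -(actM u u') uu' act1 scalerDr scalerA mulVf // scale1r addrC.
have xzi i v : v \in K -> x *m v = 0 -> x *m (z ^+ i *m v) = i%:R *: (z ^+ i.-1 *m v).
  move=> vK xv; elim: i => [|i IH]; first by rewrite expr0 act1 xv scale0r.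
  rewrite exprS actM xz; last exact: stableX.
  rewrite IH -scalemxAr -actM; case: i {IH} => [|i]; first by rewrite scale0r add0r scale1r.
  by rewrite -exprS /= -[in RHS]natr1 scalerDl scale1r.
have fact i v : v \in K -> x *m v = 0 -> x ^+ i *m (z ^+ i *m v) = i`!%:R *: v.
  move=> vK xv; elim: i => [|i IH]; first by rewrite !expr0 !act1 scale1r.
  by rewrite exprSr actM xzi // -scalemxAr IH scalerA -natrM factS.
apply: dim_drop => i v lt_ip vK xv.
exists (i`!%:R^-1 *: (z ^+ i *m v)); first by rewrite memvZ // stableX.
rewrite -scalemxAr fact // scalerA mulVf ?scale1r //.
rewrite -(dvdn_pcharf chark); elim: i lt_ip => [|i IH] lt_ip.
  by rewrite fact0 dvdn1 neq_ltn prime_gt1 ?orbT // (pcharf_prime chark).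
rewrite factS Euclid_dvdM ?(pcharf_prime chark) // negb_or IH ?(ltnW lt_ip) // andbT.
by apply/negP => /(dvdn_leq (ltn0Sn i)); rewrite leqNgt lt_ip.
Qed.
End Pair.
End Drop.

(** * Whittaker vectors for the lowering operators *)

Section Whittaker.
Variables (k : fieldType) (p n d : nat).
Notation E := 'M[k]_d.+1.
Notation M := 'M[k]_n.+1.
Notation E_ i j := (delta_mx i j : M).
Variables (a b c : {linear M -> E}) (Tn : E) (W : {vspace 'cV[k]_d.+1}).
Hypothesis chark : p \in [pchar k].
Hypothesis two : 2%:R != 0 :> k.
Hypothesis rep : periplectic_rep a b c.
Hypothesis a_pth : forall i j : 'I_n.+1, (j < i)%N ->
  a (E_ i j) ^+ p = (i == j.+1 :> nat)%:R *: 1.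
Hypothesis Wa : forall A, \tr A = 0 -> stable W (a A).
Hypothesis Wb : forall B, stable W (b B).
Hypothesis Wc : forall C, stable W (c C).
Hypothesis WT : stable W Tn.
(* Tn replaces a (E_ ord_max ord_max), which is not the image of an element of sl. *)
Hypothesis Tn_br : forall A, \tr A = 0 ->
  a A * Tn - Tn * a A = a (A * E_ ord_max ord_max - E_ ord_max ord_max * A).
Hypothesis Tn_c : forall v : 'cV[k]_d.+1,
  (forall C, c C *m v = 0) -> forall C, c C *m (Tn *m v) = 0.

(* Columns from left to right; in a column odd operators come first, rows from
   bottom to top. *)
Definition rnk (o : bool) (i j : nat) : nat := ((j.*2 + ~~ o) * n.+1 + (n - i))%N.

Lemma rnk_col o i j o' i' j' : (j' < j)%N -> (rnk o' i' j' < rnk o i j)%N.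
Proof.
move=> lt; rewrite /rnk; apply: (@leq_trans ((j'.*2 + ~~ o').+1 * n.+1)).
  by rewrite mulSn addnC ltn_add2r ltnS leq_subr.
by apply: leq_trans (leq_addr _ _); rewrite leq_mul2r; lia.
Qed.

Lemma rnk_odd i i' j : (rnk true i' j < rnk false i j)%N.
Proof. by rewrite /rnk /= addn0 addn1 mulSn; lia. Qed.

Lemma rnk_row o (i i' : 'I_n.+1) j : (i < i')%N -> (rnk o i' j < rnk o i j)%N.
Proof. by rewrite /rnk ltn_add2l; have := ltn_ord i'; lia. Qed.

Lemma rnk_inv o (i : 'I_n.+1) j o' (i' : 'I_n.+1) j' : (rnk o' i' j' < rnk o i j)%N ->
  [\/ (j' < j)%N, [/\ j' = j, o' & ~~ o] | [/\ j' = j, o' = o & (i < i')%N]].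
Proof.
move=> lt; case: (ltngtP j' j) => [l|l|e]; first by constructor 1.
  by have := rnk_col o' i' o i l; rewrite ltnNge ltnW.
subst j'; case: (boolP o') => ho'; case: (boolP o) => ho.
- constructor 3; split=> //; rewrite ltnNge; apply/negP; rewrite leq_eqVlt.
  case/predU1P => [e|l]; first by move: lt; rewrite -e /rnk ho ho' ltnn.
  by have := rnk_row true j l; rewrite ltnNge ltnW //; move: lt; rewrite ho ho'.
- by constructor 2.
- by have := rnk_odd i' i j; rewrite ltnNge ltnW //; move: lt; rewrite ho (negPf ho').
constructor 3; split=> //; rewrite ltnNge; apply/negP; rewrite leq_eqVlt.
case/predU1P => [e|l]; first by move: lt; rewrite -e /rnk (negPf ho) (negPf ho') ltnn.
by have := rnk_row false j l; rewrite ltnNge ltnW //; move: lt; rewrite (negPf ho) (negPf ho').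
Qed.

(** Whittaker conditions for the lowering operators of rank below [r]. The eigenvalue 1 on the
    subdiagonal and 0 elsewhere is the only one compatible with [a_pth]. *)
Definition good (r : nat) (v : 'cV[k]_d.+1) : Prop :=
  [/\ v \in W,
      forall i j : 'I_n.+1, (j < i)%N -> (rnk true i j < r)%N -> c (E_ i j) *m v = 0
    & forall i j : 'I_n.+1, (j < i)%N -> (rnk false i j < r)%N ->
        a (E_ i j) *m v = (i == j.+1 :> nat)%:R *: v].

Lemma act_ev (S T U : E) (v : 'cV_d.+1) :
  S * T - T * S = U -> S *m (T *m v) = T *m (S *m v) + U *m v.
Proof. by move=> <-; rewrite mulmxBl -!actM addrC subrK. Qed.

Lemma act_od (S T U : E) (v : 'cV_d.+1) :
  S * T + T * S = U -> S *m (T *m v) = U *m v - T *m (S *m v).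
Proof. by move=> <-; rewrite mulmxDl -!actM addrK. Qed.

Lemma tr_low (i j : 'I_n.+1) : (j < i)%N -> \tr (E_ i j) = 0.
Proof. by move=> lt; rewrite mxtrace_delta -val_eqE gtn_eqF. Qed.

Lemma lin_comb (f : {linear M -> E}) r s X Y (v : 'cV_d.+1) :
  f (r *: X + s *: Y) *m v = r *: (f X *m v) + s *: (f Y *m v).
Proof. by rewrite linearD !linearZ /= mulmxDl -!scalemxAl. Qed.

Lemma c_opp i j (v : 'cV_d.+1) : c (E_ i j) *m v = - (c (E_ j i) *m v).
Proof. by rewrite -[E_ i j]trmxK trmx_delta (rep_cT rep) mulNmx. Qed.

Lemma c_diag i (v : 'cV_d.+1) : c (E_ i i) *m v = 0.
Proof. by rewrite (rep_c_diag rep two) mul0mx. Qed.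

Lemma c_a_act (A : M) i j (v : 'cV_d.+1) : \tr A = 0 ->
  c (E_ i j) *m (a A *m v) = a A *m (c (E_ i j) *m v)
     + c (A^T * E_ i j + E_ i j * A) *m v.
Proof.
move=> A0; apply: act_ev; rewrite -[RHS]opprK -(rep_ac rep _ A0) opprB //.
Qed.

Section Step.
Variables (o : bool) (i0 l : 'I_n.+1) (r : nat) (v : 'cV[k]_d.+1).
Hypotheses (lt_li : (l < i0)%N) (er : r = rnk o i0 l) (gv : good r v).

Let vW : v \in W. Proof. by case: gv. Qed.

Let cv (i j : 'I_n.+1) : (j < i)%N -> (j < l)%N -> c (E_ i j) *m v = 0.
Proof. by move=> lt ltj; case: gv => _ h _; apply: h; rewrite // er rnk_col. Qed.

Let av (i j : 'I_n.+1) : (j < i)%N -> (j < l)%N -> i != j.+1 :> nat -> a (E_ i j) *m v = 0.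
Proof.
move=> lt ltj ne; case: gv => _ _ h; rewrite h ?er ?rnk_col //.
by rewrite (negPf ne) scale0r.
Qed.

Let cv_sym (i j : 'I_n.+1) : (j < l)%N -> c (E_ i j) *m v = 0.
Proof.
move=> ltj; case: (ltngtP j i) => [lt|lt|/val_inj ->]; last exact: c_diag.
  exact: cv.
by rewrite c_opp cv ?oppr0 //; apply: ltn_trans ltj.
Qed.

(** A bracket with an earlier operator is zero or, up to sign, an operator of an earlier column, not
    on the subdiagonal if even, or a diagonal [c]; all of these act by zero. *)
Lemma good_a_low (i1 : 'I_n.+1) : (l < i1)%N -> good r (a (E_ i1 l) *m v).
Proof.
move=> lt1; have t1 := tr_low lt1; case: (gv) => _ hc ha; split.
- exact: Wa.
- move=> i j lt_ji; rewrite er => lt_r; have lejl : (j <= l)%N.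
    by case: (rnk_inv lt_r) => [|[->]|[->]] //; apply: ltnW.
  rewrite c_a_act // hc ?er // mulmx0 add0r trmx_delta !delta_mulE lin_comb.
  have -> : (j == i1) = false by apply/negP => /eqP e; move: lt1; rewrite -e ltnNge lejl.
  rewrite scale0r addr0; move: lejl; rewrite leq_eqVlt => /predU1P [/val_inj ->|ltj].
    by rewrite c_diag scaler0.
  by rewrite cv_sym ?scaler0.
move=> i j lt_ji lt_r; have lejl : (j <= l)%N.
  by move: lt_r; rewrite er => /rnk_inv [|[->]|[->]] //; apply: ltnW.
rewrite (act_ev _ (rep_aa rep (tr_low lt_ji) t1)) (ha _ _ lt_ji lt_r) -scalemxAr !delta_mulE.
have -> : (j == i1) = false by apply/negP => /eqP e; move: lt1; rewrite -e ltnNge lejl.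
rewrite scale0r sub0r linearN /= linearZ /= mulNmx -scalemxAl.
case: (l =P i) => [e|_]; last by rewrite scale0r subr0.
have ltj : (j < l)%N by rewrite e.
by rewrite (@av i1 j) ?scaler0 ?subr0 //; lia.
Qed.

Let col_le o' (i j : 'I_n.+1) : (rnk o' i j < r)%N -> (j <= l)%N.
Proof. by rewrite er => /rnk_inv [/ltnW|[->]|[->]]. Qed.

Let col_lt o' (i j : 'I_n.+1) : o' = o -> (rnk o' i j < r)%N -> (i <= i0)%N -> (j < l)%N.
Proof.
move=> eo; rewrite er => /rnk_inv [//|[_ ho]|[_ _ lt]].
  by rewrite -eo ho.
by rewrite leqNgt lt.
Qed.

Lemma good_c : o -> good r (c (E_ i0 l) *m v).
Proof.
move=> odd_o; case: (gv) => _ hc ha; split; first exact: Wc.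
  move=> i j lt_ji lt_r.
  by rewrite (act_od _ (rep_cc rep _ _)) (hc _ _ lt_ji lt_r) mulmx0 mul0mx subrr.
move=> i j lt_ji lt_r; have ltj : (j < l)%N.
  by move: lt_r; rewrite er => /rnk_inv [|[_ //]|[_]] //; rewrite odd_o.
rewrite (act_ev _ (rep_ac rep _ (tr_low lt_ji))) (ha _ _ lt_ji lt_r) -scalemxAr.
rewrite trmx_delta !delta_mulE mulNmx lin_comb (c_opp j l).
rewrite (@cv_sym l j) // (@cv_sym i0 j) //.
by rewrite oppr0 !scaler0 addr0 oppr0 addr0.
Qed.

Variable l1 : 'I_n.+1.
Hypothesis el1 : l1 = l.+1 :> nat.

Let lt_l1 : (l < l1)%N. Proof. by rewrite el1. Qed.
Let le_l1i : (l1 <= i0)%N. Proof. by rewrite el1. Qed.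
Let neq_le (j m : 'I_n.+1) : (j <= l)%N -> (l1 <= m)%N -> (m == j) = false.
Proof. by move=> h1 h2; apply/negP => /eqP e; move: h2; rewrite e el1 ltnNge h1. Qed.

Lemma bc_expand (x y i j : 'I_n.+1) :
  (E_ x y + (E_ x y)^T) * (E_ i j - (E_ i j)^T)
    = ((y == i)%:R *: E_ x j + (x == i)%:R *: E_ y j)
      - ((y == j)%:R *: E_ x i + (x == j)%:R *: E_ y i).
Proof. by rewrite !trmx_delta mulrBr !mulrDl !delta_mulE. Qed.

(** The partner of c(E_{i0,l}). With an earlier odd operator of a column j < l the bracket involves
    E_{i0,j} and E_{l1,j}, which lie strictly below the subdiagonal and act by zero. In column l
    itself only rows below [i0] have been imposed, and for these no term arises; this is the reason
    for going from bottom to top. *)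
Lemma good_b : o -> good r (b (E_ i0 l1) *m v).
Proof.
move=> odd_o; case: (gv) => _ hc ha; split; first exact: Wb.
  move=> i j lt_ji lt_r; have lejl := col_le lt_r.
  rewrite (act_od _ (etrans (addrC _ _) (rep_bc rep _ _))) (hc _ _ lt_ji lt_r) mulmx0 subr0.
  rewrite bc_expand (neq_le lejl (leqnn l1)) (neq_le lejl le_l1i) !scale0r addr0 subr0 lin_comb.
  case: (ltngtP j l) lejl => // [ltj _|/val_inj ej _].
    rewrite !av ?scaler0 ?addr0 //; try by lia.
  have lt_i : (i0 < i)%N.
    rewrite ltnNge; apply/negP => le; have := col_lt (esym odd_o) lt_r le.
    by rewrite ej ltnn.
  have -> : (l1 == i) = false by apply/negP => /eqP e; move: lt_i; rewrite -e ltnNge le_l1i.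
  have -> : (i0 == i) = false by apply/negP => /eqP e; move: lt_i; rewrite -e ltnn.
  by rewrite !scale0r addr0.
move=> i j lt_ji lt_r; have lejl := col_le lt_r.
rewrite (act_ev _ (rep_ab rep _ (tr_low lt_ji))) (ha _ _ lt_ji lt_r) -scalemxAr.
rewrite trmx_delta !delta_mulE [j == i0]eq_sym (neq_le lejl (leqnn l1)) (neq_le lejl le_l1i).
rewrite !scale0r addr0.
by rewrite linear0 mul0mx addr0.
Qed.

(** The bracket with an odd condition of column j is c(E_{i0,j}), where j = l may occur. It acts by
    zero because the odd operators of a column precede its even ones. *)
Lemma good_a_up : ~~ o -> (l1 < i0)%N -> good r (a (E_ l1 i0) *m v).
Proof.
move=> even_o lt_i0; case: (gv) => _ hc ha.
have t0 : \tr (E_ l1 i0) = 0 by rewrite mxtrace_delta -val_eqE ltn_eqF.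
split; first exact: Wa.
  move=> i j lt_ji lt_r; have lejl := col_le lt_r.
  rewrite c_a_act // (hc _ _ lt_ji lt_r) mulmx0 add0r trmx_delta !delta_mulE lin_comb.
  rewrite [j == l1]eq_sym (neq_le lejl (leqnn _)) scale0r addr0.
  rewrite (hc i0 j) ?scaler0 //; first by apply: leq_ltn_trans lt_li.
  rewrite er (negPf even_o); move: lejl; rewrite leq_eqVlt => /predU1P [/val_inj ->|ltj].
    exact: rnk_odd.
  exact: rnk_col.
move=> i j lt_ji lt_r; have lejl := col_le lt_r.
rewrite (act_ev _ (rep_aa rep (tr_low lt_ji) t0)) (ha _ _ lt_ji lt_r) -scalemxAr !delta_mulE.
rewrite [j == l1]eq_sym (neq_le lejl (leqnn _)) scale0r sub0r linearN /= linearZ /=.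
rewrite mulNmx -scalemxAl; case: (i0 =P i) => [e|_]; last by rewrite scale0r subr0.
have ltj : (j < l)%N.
  by apply: col_lt lt_r _; [rewrite (negPf even_o) | rewrite -e].
by rewrite (@av l1 j) ?scaler0 ?subr0 //; lia.
Qed.

Lemma good_diag : ~~ o -> i0 = l1 -> (l1 < n)%N ->
  good r (a (E_ l1 l1 - E_ ord_max ord_max) *m v).
Proof.
move=> even_o e0 lt_l1n; case: (gv) => _ hc ha.
have t0 : \tr (E_ l1 l1 - E_ ord_max ord_max) = 0.
  by rewrite linearB /= !mxtrace_delta !eqxx subrr.
split; first exact: Wa.
  move=> i j lt_ji lt_r.
  rewrite c_a_act // (hc _ _ lt_ji lt_r) mulmx0 add0r linearB /= !trmx_delta.
  rewrite mulrBl mulrBr !delta_diag_mulE !delta_mul_diagE -!scalerBl -scalerDl.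
  by rewrite linearZ /= -scalemxAl (hc _ _ lt_ji lt_r) scaler0.
move=> i j lt_ji lt_r; have lejl := col_le lt_r.
rewrite (act_ev _ (rep_aa rep (tr_low lt_ji) t0)) (ha _ _ lt_ji lt_r) -scalemxAr.
rewrite mulrBl mulrBr !delta_diag_mulE !delta_mul_diagE -!scalerBl.
rewrite linearZ /= -scalemxAl (ha _ _ lt_ji lt_r).
rewrite (neq_le lejl (leqnn _)) (neq_le lejl) ?leq_ord // subrr sub0r.
case: (@eqP _ (val i) j.+1) => [/= ei|_]; last by rewrite !scale0r scaler0 addr0.
have {}ei : (i : nat) = j.+1 := ei.
have -> : (l1 == i) = false.
  apply/negP => /eqP e; have ltj : (j < l)%N.
    by apply: col_lt lt_r _; [rewrite (negPf even_o) | rewrite e0 e].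
  by move: ei; rewrite -e; lia.
have -> : (ord_max == i) = false.
  by apply/negP => /eqP e; move: ei; rewrite -e /=; lia.
by rewrite subrr oppr0 scale0r addr0.
Qed.

(** This case belongs to the last column having lowering operators. All odd ones have then been
    imposed, so every [c C] kills [v] and [Tn_c] applies. *)
Lemma good_Tn : ~~ o -> i0 = l1 -> l1 = ord_max -> good r (Tn *m v).
Proof.
move=> even_o e0 e1; case: (gv) => _ hc ha.
have en : n = l.+1 by rewrite -el1 e1.
have all_c C : c C *m v = 0.
  rewrite (rep_lin_sum c C) mulmx_suml big1 // => i _; rewrite mulmx_suml big1 // => j _.
  rewrite -scalemxAl; suff -> : c (E_ i j) *m v = 0 by rewrite scaler0.
  have low (x y : 'I_n.+1) : (y < x)%N -> c (E_ x y) *m v = 0.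
    move=> lt; apply: hc => //; rewrite er (negPf even_o).
    have : (y <= l)%N by have := ltn_ord x; lia.
    rewrite leq_eqVlt => /predU1P [/val_inj ->|]; [exact: rnk_odd | exact: rnk_col].
  by case: (ltngtP j i) => [/low //|/low h|/val_inj ->]; rewrite ?c_diag // c_opp h oppr0.
split; first exact: WT.
  by move=> i j _ _; apply: Tn_c.
move=> i j lt_ji lt_r; have lejl := col_le lt_r.
rewrite (act_ev _ (Tn_br (tr_low lt_ji))) (ha _ _ lt_ji lt_r) -scalemxAr.
rewrite delta_diag_mulE delta_mul_diagE -scalerBl (neq_le lejl) ?leq_ord // sub0r.
rewrite linearZ /= -scalemxAl; case: (ord_max =P i) => [e|_]; last first.
  by rewrite oppr0 scale0r addr0.
have ltj : (j < l)%N.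
  by apply: col_lt lt_r _; [rewrite (negPf even_o) | rewrite e0 e1 e].
by rewrite (@av i j) ?scaler0 ?addr0 // -e /=; lia.
Qed.
End Step.

Definition step_op (t : neg_index n) : E :=
  let: (o, ij) := t in let: (i, j) := val ij in
  if o then c (E_ i j) else a (E_ i j) - (i == j.+1 :> nat)%:R *: 1.

Definition step_rank (t : neg_index n) : nat := rnk t.1 (val t.2).1 (val t.2).2.

Definition whittaker (r : nat) : {vspace 'cV[k]_d.+1} :=
  (W :&: \bigcap_(t : neg_index n | (step_rank t < r)%N) mx_ker (step_op t))%VS.

Lemma step_op_even (i j : 'I_n.+1) (v : 'cV_d.+1) :
  ((a (E_ i j) - (i == j.+1 :> nat)%:R *: 1 : E) *m v == 0)
    = (a (E_ i j) *m v == (i == j.+1 :> nat)%:R *: v).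
Proof. by rewrite mulmxBl -scalemxAl act1 subr_eq0. Qed.

Lemma whittakerP r v : reflect (good r v) (v \in whittaker r).
Proof.
rewrite memv_cap; apply: (iffP andP) => [[vW /subv_bigcapP h]|[vW hc ha]]; split=> //.
- move=> i j lt lt_r; have := h (true, exist _ (i, j) lt) lt_r.
  by rewrite -memvE mx_kerP => /eqP.
- move=> i j lt lt_r; have := h (false, exist _ (i, j) lt) lt_r.
  by rewrite -memvE mx_kerP step_op_even => /eqP.
apply/subv_bigcapP => -[o [[i j] lt]] /= lt_r; rewrite -memvE mx_kerP /=.
case: o lt_r => lt_r; first by apply/eqP; apply: hc.
by rewrite step_op_even; apply/eqP; apply: ha.
Qed.

Let p_pr : prime p := pcharf_prime chark.

Lemma a_low_inv (l1 l : 'I_n.+1) : l1 = l.+1 :> nat ->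
  a (E_ l1 l) * a (E_ l1 l) ^+ p.-1 = 1.
Proof.
move=> e; rewrite -exprS prednK ?prime_gt0 // a_pth ?e ?eqxx //.
by rewrite scale1r.
Qed.

Lemma whittaker_odd_step (i l : 'I_n.+1) (lt : (l < i)%N) :
  let K := whittaker (rnk true i l) in
  [/\ 2 * \dim (K :&: mx_ker (c (E_ i l))) <= \dim K & K != 0%VS ->
    (K :&: mx_ker (c (E_ i l)))%VS != 0%VS]%N.
Proof.
move=> K; have lt1 : (l.+1 < n.+1)%N by apply: leq_ltn_trans lt _.
pose l1 := Ordinal lt1; have el1 : l1 = l.+1 :> nat by [].
have gK v : v \in K -> good (rnk true i l) v by move/whittakerP.
have Kx : stable K (c (E_ i l)).
  by move=> v /gK gv; apply/whittakerP; apply: (good_c (o := true) erefl gv).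
have Ky : stable K (b (E_ i l1)).
  by move=> v /gK gv; apply/whittakerP; apply: (good_b (o := true) lt erefl gv el1).
have Ku : stable K (a (E_ l1 l)).
  by move=> v /gK gv; apply/whittakerP; apply: (good_a_low (o := true) lt erefl gv); rewrite el1.
have c2 : c (E_ i l) ^+ 2 = 0 by rewrite expr2 (rep_c2 rep two).
split; last exact: nilpotent_ker_neq0 c2.
have tr1 : \tr (E_ l1 l) = 0 by apply: tr_low; rewrite el1.
have ne (x : 'I_n.+1) : (l < x)%N -> (x == l) = false.
  by move=> h; apply/negP => /eqP e; rewrite e ltnn in h.
(* The scalar is 1, or 2 when [i] is [l1], where B + B^T doubles a diagonal entry. *)
apply: (odd_drop (y := b (E_ i l1)) (s := 1 + (l1 == i)%:R)
  Ky (stableX p.-1 Ku) (a_low_inv el1)).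
- by case: (l1 == i); rewrite ?addr0 ?oner_eq0 //.
- move=> v _; rewrite c_a_act // trmx_delta !delta_mulE [l == l1]eq_sym ne ?el1 //.
  by rewrite scale0r addr0 linearZ /= -scalemxAl c_diag scaler0 addr0.
move=> v _; have /(congr1 (fun T : E => T *m v)) := rep_bc rep (E_ i l1) (E_ i l).
rewrite mulmxDl !actM addrC => ->; rewrite bc_expand !ne ?el1 // eqxx !scale0r addr0 subr0.
rewrite lin_comb scalerDl addrC; congr (_ + _).
by case: eqP => [->|_]; rewrite ?scale0r.
Qed.

(** The partner of E_{i,l} is modelled on E_{l1,i}, whose bracket with it is - E_{l1,l}. For
    [l1 < i] this unit will do; for [i = l1] it is diagonal and is corrected by the last diagonal
    unit to have trace zero, unless it is that unit, and then [Tn] stands in. *)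
Lemma even_partner (i l l1 : 'I_n.+1) : (l < i)%N -> l1 = l.+1 :> nat ->
  exists2 y : E, stable (whittaker (rnk false i l)) y
    & a (E_ i l) * y - y * a (E_ i l) = - a (E_ l1 l).
Proof.
move=> lt el1; have lt1 : (l < l1)%N by rewrite el1.
have ti := tr_low lt; have nel : (l == l1) = false.
  by apply/negP => /eqP e; rewrite -e ltnn in lt1.
have : (l1 <= i)%N by rewrite el1.
rewrite leq_eqVlt => /predU1P [/val_inj e|lt_i]; last first.
  exists (a (E_ l1 i)).
    by move=> v /whittakerP gv; apply/whittakerP; apply: (good_a_up (o := false) lt erefl gv el1).
  rewrite (rep_aa rep ti); last by rewrite mxtrace_delta -val_eqE ltn_eqF.
  by rewrite !delta_mulE nel eqxx scale0r scale1r sub0r linearN.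
have : (l1 <= n)%N := leq_ord l1; rewrite leq_eqVlt => /predU1P [en|lt_n].
  have e1 : l1 = ord_max by apply: val_inj.
  exists Tn.
    by move=> v /whittakerP gv; apply/whittakerP; apply: (good_Tn (o := false) lt erefl gv el1).
  by rewrite Tn_br // !delta_mulE -e -e1 nel eqxx scale0r scale1r sub0r linearN.
exists (a (E_ l1 l1 - E_ ord_max ord_max)).
  by move=> v /whittakerP gv; apply/whittakerP; apply: (good_diag (o := false) lt erefl gv el1).
rewrite (rep_aa rep ti); last by rewrite linearB /= !mxtrace_delta !eqxx subrr.
rewrite mulrBl mulrBr !delta_mulE -e nel eqxx.
have -> : (l == ord_max) = false.
  by apply/negP => /eqP e'; move: lt_n; rewrite el1 e' /= ltnNge leqnSn.
have -> : (ord_max == l1) = false.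
  by apply/negP => /eqP e'; move: lt_n; rewrite -e' /= ltnn.
by rewrite !scale0r scale1r !subr0 sub0r linearN.
Qed.

Lemma whittaker_even_step (i l : 'I_n.+1) (lt : (l < i)%N) :
  let K := whittaker (rnk false i l) in
  let x : E := a (E_ i l) - (i == l.+1 :> nat)%:R *: 1 in
  [/\ p * \dim (K :&: mx_ker x) <= \dim K & K != 0%VS -> (K :&: mx_ker x)%VS != 0%VS]%N.
Proof.
move=> K x; have lt1 : (l.+1 < n.+1)%N by apply: leq_ltn_trans lt _.
pose l1 := Ordinal lt1; have el1 : l1 = l.+1 :> nat by [].
have tr1 : \tr (E_ l1 l) = 0 by apply: tr_low; rewrite el1.
have low (i1 : 'I_n.+1) : (l < i1)%N -> stable K (a (E_ i1 l)).
  move=> lt' v /whittakerP gv.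
  by apply/whittakerP; apply: (good_a_low (o := false) lt erefl gv).
have [y Ky xy] := even_partner lt el1.
have Kx : stable K x.
  by apply: stableD; [apply: low | rewrite -scaleNr; apply: stableZ => v vK; rewrite act1].
have Ku : stable K (a (E_ l1 l)) by apply: low; rewrite el1.
(* Frobenius for a difference of commuting elements, whose p-th powers agree by [a_pth]. *)
have xp : x ^+ p = 0.
  have charE : p \in [pchar E] by rewrite pchar_lalg.
  have cm : GRing.comm (a (E_ i l)) ((i == l.+1 :> nat)%:R *: 1).
    by rewrite /GRing.comm -scalerAl -scalerAr mul1r mulr1.
  rewrite /x -(pFrobenius_autE charE) (pFrobenius_autB_comm charE cm) !(pFrobenius_autE charE).
  rewrite a_pth // exprZn expr1n; case: (_ == _); rewrite ?expr1n ?subrr //.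
  by rewrite expr0n eqn0Ngt prime_gt0 // subrr.
split; last exact: nilpotent_ker_neq0 xp.
have tri := tr_low lt.
apply: (even_drop (y := y) (s := - 1) chark Ky (stableX p.-1 Ku) (a_low_inv el1)).
- by rewrite oppr_eq0 oner_eq0.
- move=> v _; rewrite !mulmxBl -!scalemxAl !act1 mulmxBr -scalemxAr; congr (_ - _).
  rewrite (act_ev _ (rep_aa rep tri tr1)) !delta_mulE.
  have -> : (l == l1) = false by apply/negP => /eqP e; move: el1; rewrite -e; lia.
  have -> : (l == i) = false by apply/negP => /eqP e; rewrite e ltnn in lt.
  by rewrite !scale0r subrr linear0 mul0mx addr0.
move=> v _; rewrite !mulmxBl -!scalemxAl !act1 mulmxBr -scalemxAr opprB addrA subrK.
by rewrite -!actM -mulmxBl xy mulNmx scaleN1r.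
Qed.

Lemma whittaker_step (t : neg_index n) :
  let K := whittaker (step_rank t) in let K' := (K :&: mx_ker (step_op t))%VS in
  [/\ neg_bound p t * \dim K' <= \dim K & K != 0%VS -> K' != 0%VS]%N.
Proof.
case: t => [[] [[i l] lt]]; [exact: whittaker_odd_step | exact: whittaker_even_step].
Qed.

Lemma step_rank_inj : injective step_rank.
Proof.
move=> [o [[i j] lt]] [o' [[i' j'] lt']]; rewrite /step_rank /rnk /= => e.
have small (x : 'I_n.+1) : (n - x < n.+1)%N by rewrite ltnS leq_subr.
have := congr1 (divn^~ n.+1) e; rewrite !divnMDl // !divn_small // !addn0 => eq.
have := congr1 (modn^~ n.+1) e; rewrite !modnMDl !modn_small // => er.
have eo : o = o'.
  by have := congr1 odd eq; rewrite !oddD !odd_double; case: (o); case: (o').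
have ej : j = j' by apply: val_inj; move: eq; rewrite eo => /addIn/double_inj.
have ei : i = i'.
  by apply: val_inj => /=; have := leq_ord i; have := leq_ord i'; move: er; lia.
by subst; congr (_, exist _ _ _); apply: bool_irrelevance.
Qed.

(** Ranks being distinct, each increment of [r] imposes at most one new condition, and
    [whittaker_step] controls its cost. *)
Lemma whittaker_chain r : W != 0%VS -> whittaker r != 0%VS /\
  ((\prod_(t : neg_index n | (step_rank t < r)%N) neg_bound p t) * \dim (whittaker r)
     <= \dim W)%N.
Proof.
move=> W0; elim: r => [|r [K0 IH]].
  by rewrite /whittaker !big_pred0 // capvf mul1n.
case: (pickP (fun t : neg_index n => step_rank t == r)) => [t /eqP et|none]; last first.
  have e (t : neg_index n) : (step_rank t < r.+1)%N = (step_rank t < r)%N.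
    by rewrite ltnS leq_eqVlt none.
  by rewrite /whittaker !(eq_bigl _ _ e).
have e (t' : neg_index n) : (step_rank t' < r.+1)%N = (t' == t) || (step_rank t' < r)%N.
  by rewrite ltnS leq_eqVlt -et (inj_eq step_rank_inj).
have P F : (\prod_(t' : neg_index n | (step_rank t' < r.+1)%N) F t'
    = F t * \prod_(t' : neg_index n | (step_rank t' < r)%N) F t')%N.
  rewrite (bigD1 t) /=; last by rewrite et ltnS.
  congr (_ * _)%N; apply: eq_bigl => t'; rewrite e; case: eqP => [->|] //=.
    by rewrite et ltnn.
  by rewrite andbT.
have eK : whittaker r.+1 = (whittaker r :&: mx_ker (step_op t))%VS.
  rewrite /whittaker (bigD1 t) /=; last by rewrite et ltnS.
  rewrite -[RHS]capvA [(_ :&: mx_ker (step_op t))%VS]capvC; congr (_ :&: (_ :&: _))%VS.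
  apply: eq_bigl => t'; rewrite e; case: eqP => [->|] //=.
    by rewrite et ltnn.
  by rewrite andbT.
have [h1 h2] := whittaker_step t; rewrite et -eK in h1 h2; split; first exact: h2.
apply: leq_trans IH; rewrite P -mulnA mulnC -mulnA leq_mul2l; apply/orP; right.
by rewrite mulnC.
Qed.

Lemma kw_bound_le_dim : W != 0%VS -> (kw_bound p n <= \dim W)%N.
Proof.
move=> W0; have [K0 h] := whittaker_chain (\max_(t : neg_index n) step_rank t).+1 W0.
apply: leq_trans h; rewrite (eq_bigl xpredT) => [|t]; last first.
  by rewrite ltnS leq_bigmax.
by rewrite leq_pmulr // lt0n dimv_eq0.
Qed.
End Whittaker.

(** * Substitutes for a diagonal element outside sl(n) *)

Section Tn.
Variables (k : fieldType) (n : nat) (E : algType k).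
Notation M := 'M[k]_n.+1.
Notation E_ i j := (delta_mx i j : M).
Variables (a b c : {linear M -> E}).
Hypothesis rep : periplectic_rep a b c.

Let e_m : M := E_ ord_max ord_max.
Let pa (A : M) : E := a (A - \tr A *: e_m).
Let s i j : E := a (sl_delta k i j).

Let pa_lin r A B : pa (r *: A + B) = r *: pa A + pa B.
Proof.
rewrite /pa -linearP; congr (a _).
by rewrite linearP /= scalerDl scalerBr scalerA opprD addrACA.
Qed.

Let paE A : \tr A = 0 -> pa A = a A.
Proof. by move=> A0; rewrite /pa A0 scale0r subr0. Qed.

Let pa_delta i j : pa (E_ i j) = s i j.
Proof. by rewrite /pa mxtrace_delta. Qed.

Let pa_sum I (r : seq I) (F : I -> k) (G : I -> M) :
  pa (\sum_(i <- r) F i *: G i) = \sum_(i <- r) F i *: pa (G i).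
Proof.
elim: r => [|i r IH]; last by rewrite !big_cons pa_lin IH.
by rewrite !big_nil /pa linear0 scale0r subr0 linear0.
Qed.

Let mul_delta_l (X : M) i j : X * E_ i j = \sum_m X m i *: E_ m j.
Proof.
rewrite {1}[X]matrix_sum_delta mulr_suml; apply: eq_bigr => m _.
rewrite mulr_suml (bigD1 i) //= big1 => [|l ne]; rewrite -scalerAl delta_mulE.
  by rewrite eqxx scale1r addr0.
by rewrite (negPf ne) scale0r scaler0.
Qed.

Let mul_delta_r (X : M) i j : E_ i j * X = \sum_m X j m *: E_ i m.
Proof.
apply/matrixP => u v; rewrite -mulmxE mxE (bigD1 j) //= big1 ?addr0 => [|l ne]; last first.
  by rewrite mxE (negPf ne) andbF mul0r.
rewrite mxE eqxx andbT summxE (bigD1 v) //= big1 ?addr0 => [|l ne]; last first.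
  by rewrite !mxE [v == l]eq_sym (negPf ne) andbF mulr0.
by rewrite !mxE eqxx andbT mulrC.
Qed.

Variable X : M.
Hypothesis X0 : \tr X = 0.
Let t : E := a (X * e_m - e_m * X).

(** The formula for the bracket of X with E_ij in gl, corrected on the diagonal by the bracket with
    [e_m]. *)
Let br_s i j : a X * s i j - s i j * a X
  = \sum_m X m i *: s m j - \sum_m X j m *: s i m - (i == j)%:R *: t.
Proof.
rewrite (rep_aa rep X0 (mxtrace_sl_delta k i j)).
have -> : X * sl_delta k i j - sl_delta k i j * X
  = (X * E_ i j - E_ i j * X) - (i == j)%:R *: (X * e_m - e_m * X).
  by rewrite mulrBr mulrBl -scalerAl -scalerAr opprD addrACA -opprD -scalerBr.
rewrite raddfB /= (_ : a (_ *: _) = (i == j)%:R *: t); last exact: linearZ.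
congr (_ - _); rewrite -paE ?mxtraceM_comm // -[X in pa (_ - X)]scale1r -scaleNr addrC.
rewrite pa_lin scaleN1r mul_delta_l mul_delta_r !pa_sum addrC.
by congr (_ - _); apply: eq_bigr => m _; rewrite pa_delta.
Qed.

(* When n + 1 = 0 in k, a 1 is central, and br_casimir shows that casimir is, up to
   the factor -2 a 1, a substitute for a (E_ ord_max ord_max). *)
Definition casimir : E := \sum_i \sum_j s i j * s j i.

Let J : E := \sum_i s i i.

Let JE : J = a (1 - n.+1%:R *: e_m).
Proof.
rewrite /J /s -linear_sum /sl_delta; congr (a _).
under eq_bigr do rewrite eqxx scale1r.
rewrite sumrB sumr_const cardT size_enum_ord scaler_nat; congr (_ - _).
apply/matrixP => i j; rewrite summxE mxE (bigD1 i) //= mxE eqxx big1 ?addr0 => [|l ne].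
  by rewrite eq_sym.
by rewrite mxE eq_sym (negPf ne).
Qed.

(** As for the central element of gl given by the sum of all E_ij E_ji, the main terms cancel in
    pairs. Only the diagonal corrections survive, and the sum of the [s i i] is [z]. *)
Lemma br_casimir (z := a (1 - n.+1%:R *: e_m)) :
  a X * casimir - casimir * a X = - (t * z + z * t).
Proof.
rewrite /z -JE.
rewrite /casimir mulr_sumr mulr_suml -sumrB.
under eq_bigr => i _ do rewrite mulr_sumr mulr_suml -sumrB.
have br i j : a X * (s i j * s j i) - s i j * s j i * a X
  = (\sum_m X m i *: (s m j * s j i) - \sum_m X i m *: (s i j * s j m))
  + (\sum_m X m j *: (s i j * s m i) - \sum_m X j m *: (s i m * s j i))
  - (i == j)%:R *: (t * s j i + s i j * t).
  have -> : a X * (s i j * s j i) - s i j * s j i * a X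
    = (a X * s i j - s i j * a X) * s j i + s i j * (a X * s j i - s j i * a X).
    by rewrite mulrBl mulrBr !mulrA subrKA.
  rewrite !br_s !mulrBl !mulrBr !mulr_suml !mulr_sumr [j == i]eq_sym -scalerAl -scalerAr.
  rewrite addrACA -opprD -scalerDr; congr (_ - _).
  under eq_bigr do rewrite -scalerAl.
  under [X in _ - X + _]eq_bigr do rewrite -scalerAl.
  under [X in _ + (X - _)]eq_bigr do rewrite -scalerAr.
  under [X in _ + (_ - X)]eq_bigr do rewrite -scalerAr.
  by rewrite addrACA [X in _ + X]addrC addrACA.
under eq_bigr => i _ do (under eq_bigr => j _ do rewrite br; rewrite sumrB big_split !sumrB /=).
rewrite sumrB big_split !sumrB /=.
have -> : \sum_i \sum_j \sum_m X m i *: (s m j * s j i)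
  = \sum_i \sum_j \sum_m X i m *: (s i j * s j m).
  under eq_bigr do rewrite exchange_big /=.
  rewrite exchange_big /=; apply: eq_bigr => i _.
  by rewrite exchange_big.
have -> : \sum_i \sum_j \sum_m X m j *: (s i j * s m i)
  = \sum_i \sum_j \sum_m X j m *: (s i m * s j i).
  by apply: eq_bigr => i _; rewrite exchange_big.
rewrite !subrr addr0 add0r; congr (- _).
rewrite /J mulr_sumr mulr_suml -big_split; apply: eq_bigr => i _ /=.
rewrite (bigD1 i) //= big1 ?addr0 => [|j /negPf ne]; first by rewrite eqxx scale1r.
by rewrite eq_sym ne scale0r.
Qed.

End Tn.

Section TnExists.
Variables (k : fieldType) (p n : nat) (E : algType k).
Notation M := 'M[k]_n.+1.
Variables (a b c : {linear M -> E}).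
Hypothesis two : 2%:R != 0 :> k.
Hypothesis p0 : (0 < p)%N.
Hypothesis rep : periplectic_rep a b c.
Hypothesis a1 : n.+1%:R = 0 :> k -> a 1 ^+ p - a 1 = 1.
Let e_m : M := delta_mx ord_max ord_max.

(** If n + 1 is nonzero in k, subtracting a scalar matrix from [e_m] gives trace zero. Otherwise
    [a 1] commutes with all [a A], and by [a1] its inverse is a 1^(p-1) - 1, which removes the
    factor [a 1] from [br_casimir]. The closure clause says that [Tn] lies in the algebra generated
    by the [a A], so that it inherits their stability properties. *)
Lemma trace_zero_projection : exists Tn : E,
  (forall A, \tr A = 0 -> a A * Tn - Tn * a A = a (A * e_m - e_m * A)) /\
  forall P : E -> Prop, P 1 -> (forall A, \tr A = 0 -> P (a A)) ->
    (forall x y, P x -> P y -> P (x + y)) -> (forall x y, P x -> P y -> P (x * y)) ->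
    (forall r x, P x -> P (r *: x)) -> P Tn.
Proof.
have [N0|N0] := eqVneq (n.+1%:R : k) 0.
  have tr1 : \tr (1 : M) = 0 by rewrite mxtrace1.
  have comm1 A : \tr A = 0 -> GRing.comm (a 1) (a A).
    move=> A0; apply/eqP; rewrite -subr_eq0 (rep_aa rep tr1 A0).
    by rewrite mul1r mulr1 subrr linear0.
  pose K := a 1 ^+ p.-1 - 1.
  have cK A : \tr A = 0 -> GRing.comm (a A) K.
    move=> A0; apply: commrB; last exact: commr1.
    by apply: commrX; apply/commr_sym/comm1.
  have Ka : K * a 1 = 1 by rewrite mulrBl -exprSr prednK // mul1r a1.
  exists (- 2%:R^-1 *: (K * casimir a)); split=> [A A0|P P1 Pa PD PM PZ].
    rewrite -scalerAr -scalerAl -scalerBr mulrA -[a A * K]/(_) cK // -!mulrA -mulrBr.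
    rewrite (br_casimir rep A0) N0 scale0r subr0.
    rewrite -(comm1 _ (mxtraceM_comm A e_m)) mulrN mulrDr mulrA Ka mul1r -mulr2n.
    by rewrite -scaler_nat -scaleNr scalerA mulrNN mulVf ?scale1r.
  have PX x m : P x -> P (x ^+ m).
    by move=> Px; elim: m => [|m IH] //; rewrite exprS; apply: PM.
  have Ps i j : P (a (sl_delta k i j)) by apply/Pa/mxtrace_sl_delta.
  have P0 : P 0 by rewrite -(scale0r 1); apply: PZ.
  apply/PZ/PM.
    apply: (PD _ _); first by apply/PX/Pa.
    by rewrite -scaleN1r; apply: PZ.
  rewrite /casimir; elim/big_ind: _ => // i _; elim/big_ind: _ => // j _.
  exact: PM.
exists (- n.+1%:R^-1 *: a (1 - n.+1%:R *: e_m)).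
have t0 : \tr (1 - n.+1%:R *: e_m) = 0.
  by rewrite linearB linearZ /= mxtrace1 mxtrace_delta eqxx mulr1 subrr.
split=> [A A0|P P1 Pa PD PM PZ]; last by apply/PZ/Pa.
rewrite -scalerAr -scalerAl -scalerBr (rep_aa rep) //.
rewrite mulrBr mulrBl mulr1 mul1r opprD addrACA subrr add0r -scalerAr -scalerAl.
rewrite -opprD -scalerBr -scaleNr (_ : a (_ *: _) = - n.+1%:R *: a (A * e_m - e_m * A)); last exact: linearZ.
by rewrite scalerA mulrNN mulVf // scale1r.
Qed.
End TnExists.

(** * Tensor products *)

Section TensorAlgebra.
Variables (k : fieldType) (d e : nat).

(* The predecessor makes the size of 'M_d.+1 *t 'M_e.+1 a syntactic successor. *)
Definition tens_size := (d.+1 * e.+1).-1.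
Notation T := 'M[k]_tens_size.+1.
Definition tens_left (A : 'M[k]_d.+1) : T := A *t (1%:M : 'M_e.+1).
Definition tens_right (B : 'M[k]_e.+1) : T := (1%:M : 'M_d.+1) *t B.

Lemma tens_comm A B : GRing.comm (tens_left A) (tens_right B).
Proof.
rewrite /GRing.comm -!mulmxE.
transitivity (A *t B : T).
  by rewrite [LHS](tensmx_mul A 1%:M 1%:M B) mulmx1 mul1mx.
by rewrite [RHS](tensmx_mul 1%:M B A 1%:M) mulmx1 mul1mx.
Qed.

Lemma tens11 : (1%:M : 'M[k]_d.+1) *t (1%:M : 'M_e.+1) = 1 :> T.
Proof.
apply/matrixP => i j; rewrite !mxE -natrM mulnb -xpair_eqE -!surjective_pairing.
by rewrite (can_eq (@mxtens_unindexK _ _)).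
Qed.

Fact tens_left_linear : linear tens_left.
Proof. by move=> r A B; apply/matrixP=> i j; rewrite !mxE mulrDl mulrA. Qed.
Fact tens_right_linear : linear tens_right.
Proof. by move=> r A B; apply/matrixP=> i j; rewrite !mxE mulrDr mulrCA. Qed.

Fact tens_left_monoid : monoid_morphism tens_left.
Proof.
split=> [|A B]; first exact: tens11.
by rewrite -!mulmxE [RHS](tensmx_mul A (1%:M : 'M_e.+1) B (1%:M : 'M_e.+1)) mulmx1.
Qed.
Fact tens_right_monoid : monoid_morphism tens_right.
Proof.
split=> [|A B]; first exact: tens11.
by rewrite -!mulmxE [RHS](tensmx_mul (1%:M : 'M_d.+1) A (1%:M : 'M_d.+1) B) mulmx1.
Qed.

HB.instance Definition _ := GRing.isLinear.Build k _ _ _ tens_left tens_left_linear.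
HB.instance Definition _ := GRing.isLinear.Build k _ _ _ tens_right tens_right_linear.
HB.instance Definition _ := GRing.isMonoidMorphism.Build _ _ tens_left tens_left_monoid.
HB.instance Definition _ := GRing.isMonoidMorphism.Build _ _ tens_right tens_right_monoid.
End TensorAlgebra.

Section WeylPair.
Variables (k : fieldType) (p : nat).
Hypothesis chark : p \in [pchar k].

Lemma strictly_lower_nilpotent q (N : 'M[k]_q.+1) :
  (forall i j : 'I_q.+1, (i <= j)%N -> N i j = 0) -> N ^+ q.+1 = 0.
Proof.
move=> lN; have h m (i j : 'I_q.+1) : (i < j + m)%N -> (N ^+ m) i j = 0.
  elim: m i j => [|m IH] i j ij; first by rewrite expr0 mxE -val_eqE /= ltn_eqF // -[val j]addn0.
  rewrite exprSr -mulmxE mxE big1 // => l _; have [lj|jl] := leqP l j.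
    by rewrite lN // mulr0.
  rewrite IH ?mul0r //; apply: leq_trans ij _.
  by rewrite addnS -addSn leq_add2r.
apply/matrixP => i j; rewrite h ?mxE //.
by apply: leq_trans (ltn_ord i) _; rewrite leq_addl.
Qed.

(** Multiplication by x and d/dx on k[x]/(x^p). At the last basis vector the commutation relation
    holds because p = 0 in k. *)
Lemma weyl_pair : exists q (X D : 'M[k]_q.+1),
  [/\ D * X - X * D = 1, X ^+ p = 0 & D ^+ p = 0].
Proof.
have p0 : (0 < p)%N by rewrite prime_gt0 // (pcharf_prime chark).
exists p.-1.
pose X : 'M[k]_p.-1.+1 := \matrix_(i, j) (i == j.+1 :> nat)%:R.
pose D : 'M[k]_p.-1.+1 := \matrix_(i, j) ((j == i.+1 :> nat)%:R * j%:R).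
exists X, D; split.
- apply/matrixP => i j; rewrite -!mulmxE !mxE.
  have -> : \sum_l D i l * X l j = (i == j)%:R * i.+1%:R.
    rewrite (eq_bigr (fun l : 'I_p.-1.+1 => if l == i.+1 :> nat then (i == j)%:R * i.+1%:R else 0)).
      rewrite -big_mkcond /=; case: (ltnP i.+1 p.-1.+1) => hi.
        by rewrite (big_pred1 (Ordinal hi)).
      rewrite big_pred0 => [|l]; last by rewrite ltn_eqF // (leq_trans _ hi).
      have -> : i.+1 = p by rewrite -[RHS](prednK p0); apply/eqP; rewrite eqn_leq ltn_ord hi.
      by rewrite (pcharf0 chark) mulr0.
    move=> l _; rewrite !mxE; case: (l =P i.+1 :> nat) => [->|_]; last by rewrite !mul0r.
    by rewrite eqSS mul1r mulrC val_eqE.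
  have -> : \sum_l X i l * D l j = (i == j)%:R * i%:R.
    have [ei|ei] := posnP i.
      by rewrite ei mulr0 big1 // => l _; rewrite mxE ei mul0r.
    have hi : (i.-1 < p.-1.+1)%N by apply: leq_ltn_trans (ltn_ord i); apply: leq_pred.
    rewrite (bigD1 (Ordinal hi)) //= big1 ?addr0 => [|l ne]; last first.
      rewrite mxE -(prednK ei) eqSS eq_sym; case: (l =P i.-1 :> nat) => [e|_]; last by rewrite mul0r.
      by case/eqP: ne; apply: val_inj.
    rewrite !mxE /= (prednK ei) eqxx mul1r eq_sym val_eqE.
    by case: eqP => [->|]; rewrite ?mul0r.
  by rewrite -mulrBr -natrB // subSnn mulr1.
- rewrite -[X in _ ^+ X](prednK p0); apply: strictly_lower_nilpotent => i j ij.
  by rewrite mxE ltn_eqF.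
have trX m : (D ^+ m)^T = D^T ^+ m.
  elim: m => [|m IH]; first by rewrite !expr0 trmx1.
  by rewrite exprS exprSr -!mulmxE trmx_mul IH.
rewrite -[X in _ ^+ X](prednK p0) -[_ ^+ _]trmxK trX strictly_lower_nilpotent ?linear0 // => i j ij.
by rewrite !mxE ltn_eqF ?mul0r.
Qed.
End WeylPair.

(** * Weyl-Clifford systems *)

(* z o s i is the creation (s) or annihilation (~~ s) operator of the i-th boson
   (o = false) or fermion (o = true); G is the fermion parity. *)
Record weyl_clifford (k : fieldType) (p m : nat) (E : algType k)
    (z : bool -> bool -> nat -> E) (G : E) : Prop := WeylClifford {
  wc_rel : forall o s i o' s' j, (i < m)%N -> (j < m)%N ->
    z o s i * z o' s' j - (-1) ^+ (o && o') *: (z o' s' j * z o s i)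
      = ([&& i == j, o == o' & s != s']%:R * (-1) ^+ (s && ~~ o)) *: 1;
  wc_par : forall o s i, (i < m)%N -> G * z o s i = (-1) ^+ o *: (z o s i * G);
  wc_par2 : G * G = 1;
  wc_nil : forall s i, (i < m)%N -> z false s i ^+ p = 0
}.

Section WeylClifford.
Variables (k : fieldType) (p : nat).
Hypothesis chark : p \in [pchar k].

(** A Weyl pair tensored with 2 by 2 matrices: the off-diagonal units form the fermion, and the
    diagonal matrix with entries 1, -1 is the parity. *)
Lemma weyl_clifford1 : exists r (z : bool -> bool -> nat -> 'M[k]_r.+1) G,
  weyl_clifford p 1 z G.
Proof.
have [q [X [D [DX Xp Dp]]]] := weyl_pair chark.
pose e (i j : 'I_2) : 'M[k]_2 := delta_mx i j.
have eM i j l m : e i j * e l m = (j == l)%:R *: e i m by exact: delta_mulE.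
have e1 : e 0 0 + e 1 1 = 1.
  by apply/matrixP => [[[|[|i]] // hi] [[|[|j]] // hj]]; rewrite !mxE ?addr0 ?add0r.
exists (tens_size q 1).
exists (fun o s _ => if o then tens_right q (if s then e 0 1 else e 1 0)
                     else tens_left 1 (if s then X else D)).
exists (tens_right q (e 0 0 - e 1 1)); split.
- move=> o s i o' s' j; rewrite !ltnS !leqn0 => /eqP-> /eqP->.
  rewrite eqxx /=; case: o; case: o' => /=.
  + rewrite expr1 scaleN1r opprK -!rmorphM -rmorphD /= andbF expr0 mulr1.
    case: s; case: s' => /=; rewrite !eM /= ?scale0r ?addr0 ?scale1r ?rmorph0 //.
    * by rewrite e1 rmorph1.
    * by rewrite addrC e1 rmorph1.
  + by rewrite expr0 scale1r tens_comm subrr mul0r scale0r.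
  + by rewrite expr0 scale1r tens_comm subrr mul0r scale0r.
  rewrite expr0 scale1r andbT -!rmorphM -rmorphB /=.
  case: s; case: s' => /=; rewrite ?subrr ?raddf0 ?mul0r ?scale0r //.
    by rewrite -(opprB (D * X)) DX raddfN /= rmorph1 mul1r expr1 scaleN1r.
  by rewrite DX rmorph1 mul1r expr0 scale1r.
- move=> o s i _; case: o; last by rewrite expr0 scale1r tens_comm.
  rewrite expr1 scaleN1r -!rmorphM -rmorphN /=; congr (tens_right q _).
  by case: s; rewrite (mulrBl _ (e 0 0)) (mulrBr _ (e 0 0)) !eM /= !(scale0r, scale1r, subr0, sub0r, opprK).
- rewrite -rmorphM -(rmorph1 (@tens_right k q 1)) mulrBl !mulrBr !eM /= !(scale0r, scale1r, subr0, sub0r, opprK).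
  congr (tens_right q _).
  exact: e1.
by move=> s i _; rewrite -rmorphXn /=; case: s; rewrite ?Xp ?Dp rmorph0.
Qed.

(** Jordan-Wigner construction: the new fermion is multiplied by the parity of the old factor, which
    makes it anticommute with the old fermions. *)
Lemma weyl_clifford_exists m : exists r (z : bool -> bool -> nat -> 'M[k]_r.+1) G,
  weyl_clifford p m z G.
Proof.
elim: m => [|m [q [z [G wz]]]].
  have [r [z [G wz]]] := weyl_clifford1; exists r, z, G.
  by split=> //; exact: wc_par2 wz.
have [r [u [S wu]]] := weyl_clifford1.
pose L : {lrmorphism 'M[k]_q.+1 -> 'M[k]_((tens_size q r).+1)} := @tens_left k q r.
pose R : {lrmorphism 'M[k]_r.+1 -> 'M[k]_((tens_size q r).+1)} := @tens_right k q r.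
have LM A B : L (A * B) = L A * L B by exact: rmorphM.
have RM A B : R (A * B) = R A * R B by exact: rmorphM.
have LZ c A : L (c *: A) = c *: L A by exact: linearZ.
have RZ c A : R (c *: A) = c *: R A by exact: linearZ.
have LR A B : L A * R B = R B * L A := tens_comm A B.
pose z' o s i := if (i < m)%N then L (z o s i) else L (G ^+ o) * R (u o s 0%N).
exists (tens_size q r), z', (L G * R S).
have cGo (o : bool) : GRing.comm G (G ^+ o) by apply: commrX.
have mulLR A B A' B' : L A * R B * (L A' * R B') = L (A * A') * R (B * B').
  by rewrite mulrA -[L A * R B * L A']mulrA -LR mulrA -LM -mulrA -RM.
have cross (o s : bool) i (o' s' : bool) : (i < m)%N ->
  L (z o s i) * (L (G ^+ o') * R (u o' s' 0%N))
    = (-1) ^+ (o && o') *: (L (G ^+ o') * R (u o' s' 0%N) * L (z o s i)).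
  move=> im; rewrite mulrA -[in RHS]mulrA -LR mulrA scalerAl -!LM -LZ /=.
  congr (L _ * _); case: o' => /=; last by rewrite andbF !expr0 mulr1 mul1r scale1r.
  rewrite andbT expr1 (wc_par wz) // scalerA -expr2 sqrr_sign scale1r.
  by [].
split.
- move=> o s i o' s' j; rewrite !ltnS /z' => im jm.
  case: ltnP => im'; case: ltnP => jm'.
  + by rewrite -!LM -LZ -rmorphB /= (wc_rel wz) // -/(L _) LZ rmorph1.
  + rewrite cross // subrr [i == j]ltn_eqF ?mul0r ?scale0r //.
    exact: leq_trans jm'.
  + rewrite cross // scalerA [o' && o]andbC -expr2 sqrr_sign scale1r subrr eq_sym.
    by rewrite [j == i]ltn_eqF ?mul0r ?scale0r //; exact: leq_trans im'.
  have -> : i == j by rewrite eqn_leq !(leq_trans im, leq_trans jm).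
  rewrite !mulLR -[G ^+ o' * _]exprD -[G ^+ o * _]exprD addnC scalerAr -mulrBr.
  rewrite -RZ -rmorphB (wc_rel wu) // eqxx /=; case: eqP => [<-|_].
    rewrite addnn -mul2n exprM expr2 (wc_par2 wz) expr1n rmorph1 mul1r.
    by rewrite RZ rmorph1.
  by rewrite mul0r !scale0r raddf0 mulr0.
- move=> o s i; rewrite ltnS /z' => im; case: ltnP => im'.
    rewrite -mulrA -LR mulrA -LM (wc_par wz) // LZ -scalerAl LM.
    by rewrite mulrA.
  by rewrite !mulLR (wc_par wu) // RZ -scalerAr cGo.
- by rewrite mulLR (wc_par2 wz) (wc_par2 wu) !rmorph1 mulr1.
move=> s i; rewrite ltnS /z' => im; case: ltnP => im'.
  by rewrite -rmorphXn (wc_nil wz) // rmorph0.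
by rewrite expr0 rmorph1 mul1r -rmorphXn (wc_nil wu) // rmorph0.
Qed.
End WeylClifford.

Section EulerPower.
Variables (k : fieldType) (p : nat) (E : algType k) (x d : E).
Hypothesis chark : p \in [pchar k].
Hypothesis dx : d * x - x * d = 1.

(** The p elements of the prime field are distinct roots of the monic polynomial X^p - X. *)
Lemma prod_XsubC_nat_pchar : \prod_(i < p) ('X - (i%:R)%:P) = 'X^p - 'X :> {poly k}.
Proof.
have p_pr := pcharf_prime chark.
pose rs := [seq i%:R : k | i <- iota 0 p].
have szP : size ('X^p - 'X : {poly k}) = p.+1.
  by rewrite size_polyDl size_polyXn // size_polyN size_polyX ltnS prime_gt1.
have mP : 'X^p - 'X \is @monic k.
  by rewrite monicE lead_coefDl ?lead_coefXn // size_polyXn size_polyN size_polyX ltnS prime_gt1.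
have := @all_roots_prod_XsubC k ('X^p - 'X) rs.
rewrite szP size_map size_iota (monicP mP) scale1r => -> //.
- by rewrite big_map -[in RHS](subn0 p) -/(index_iota 0 p) big_mkord.
- apply/allP => _ /mapP [i _ ->]; rewrite rootE !hornerE.
  by rewrite -(pFrobenius_autE chark) pFrobenius_aut_nat subrr.
rewrite uniq_rootsE map_inj_in_uniq ?iota_uniq // => i j.
rewrite !mem_iota !add0n /= => ip jp; wlog ij : i j ip jp / (i <= j)%N => [hw|].
  by case/orP: (leq_total i j) => ij e; [|symmetry]; apply: hw => //; symmetry.
move=> e; apply/eqP; rewrite eqn_leq ij -subn_eq0 -leqn0 leqNgt /=; apply/negP => ji.
have : (j - i)%:R == 0 :> k by rewrite natrB // e subrr.
rewrite -(dvdn_pcharf chark) => /(dvdn_leq ji).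
by rewrite leqNgt (leq_ltn_trans (leq_subr _ _) jp).
Qed.

(* x ^+ m * d ^+ m is the value at x * d of the product of the 'X - i for i < m. *)
Lemma weyl_euler_pow : (x * d) ^+ p = x * d + x ^+ p * d ^+ p.
Proof.
have dX m : d ^+ m * x = x * d ^+ m + m%:R *: d ^+ m.-1.
  elim: m => [|m IH]; first by rewrite expr0 mul1r mulr1 scale0r addr0.
  have dx' : d * x = x * d + 1 by rewrite -dx addrC subrK.
  rewrite exprSr -mulrA dx' mulrDr mulr1 mulrA IH mulrDl -scalerAl -mulrA -exprSr -addrA.
  congr (_ + _); case: m {IH} => [|m]; first by rewrite scale0r add0r scale1r.
  by rewrite /= -exprSr -[m.+2%:R]natr1 scalerDl scale1r.
pose H : {poly k} -> E := horner_alg (x * d).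
have HM u v : H (u * v) = H u * H v by exact: rmorphM.
have HB u v : H (u - v) = H u - H v by exact: rmorphB.
have HX : H 'X = x * d by exact: horner_algX.
have HC (c : k) : H c%:P = c *: 1 by exact: horner_algC.
have fall m : x ^+ m * d ^+ m = H (\prod_(i < m) ('X - (i%:R)%:P)).
  elim: m => [|m IH]; first by rewrite big_ord0 mulr1 HC scale1r.
  rewrite big_ord_recr HM -IH HB HX HC /=.
  rewrite exprSr [d ^+ _]exprSr -mulrA [x * _]mulrA.
  have -> : x * d ^+ m = d ^+ m * x - m%:R *: d ^+ m.-1 by rewrite dX addrK.
  rewrite -mulrA mulrBl (mulrBr (d ^+ m)) -mulrA; congr (_ * (_ - _)).
  rewrite -scalerAl -scalerAr mulr1; case: m {IH} => [|m]; first by rewrite !scale0r.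
  by rewrite -exprSr.
rewrite fall prod_XsubC_nat_pchar HB HX (_ : H _ = (x * d) ^+ p); last by rewrite -HX; exact: rmorphXn.
by rewrite addrC subrK.
Qed.
End EulerPower.

(** * Oscillator representations *)

Section LinearClosure.
Variables (k : fieldType) (U : lmodType k) (V W : algType k).
Lemma linear_fun_sub (f g : U -> V) : linear f -> linear g -> linear (fun x => f x - g x).
Proof. by move=> lf lg r x y; rewrite lf lg scalerBr opprD addrACA. Qed.
Lemma linear_fun_add (f g : U -> V) : linear f -> linear g -> linear (fun x => f x + g x).
Proof. by move=> lf lg r x y; rewrite lf lg scalerDr addrACA. Qed.
Lemma linear_fun_mull (c : V) (f : U -> V) : linear f -> linear (fun x => c * f x).
Proof. by move=> lf r x y; rewrite lf mulrDr scalerAr. Qed.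
Lemma linear_fun_mulr (c : V) (f : U -> V) : linear f -> linear (fun x => f x * c).
Proof. by move=> lf r x y; rewrite lf mulrDl scalerAl. Qed.
Lemma linear_fun_comp (h : {linear V -> W}) (f : U -> V) :
  linear f -> linear (fun x => h (f x)).
Proof. by move=> lf r x y; rewrite lf linearP. Qed.
Lemma linear_fun_id : linear (fun x : U => x).
Proof. by []. Qed.
End LinearClosure.

Section MatrixExtension.
Variables (k : fieldType) (n : nat) (E : algType k).
Notation M := 'M[k]_n.+1.
Notation E_ i j := (delta_mx i j : M).

Lemma linear_fun_tr (f : M -> M) : linear f -> linear (fun x => (f x)^T).
Proof. by move=> lf r x y; rewrite lf linearP. Qed.

Definition mx_ext (f : 'I_n.+1 -> 'I_n.+1 -> E) (A : M) : E :=
  \sum_i \sum_j A i j *: f i j.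

Fact mx_ext_linear f : linear (mx_ext f).
Proof.
move=> r A B; rewrite /mx_ext scaler_sumr -big_split; apply: eq_bigr => i _ /=.
rewrite scaler_sumr -big_split; apply: eq_bigr => j _ /=.
by rewrite !mxE scalerDl scalerA.
Qed.
HB.instance Definition _ f := GRing.isLinear.Build k M E _ (mx_ext f) (mx_ext_linear f).

Lemma mx_ext_delta f i j : mx_ext f (E_ i j) = f i j.
Proof.
rewrite /mx_ext (bigD1 i) //= [X in _ + X]big1 ?addr0 => [|l ne]; last first.
  by rewrite big1 // => m _; rewrite mxE (negPf ne) scale0r.
rewrite (bigD1 j) //= big1 ?addr0 => [|l ne]; first by rewrite mxE !eqxx scale1r.
by rewrite mxE (negPf ne) andbF scale0r.
Qed.

Lemma linear_fun_ext (f g : M -> E) : linear f -> linear g ->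
  (forall i j, f (E_ i j) = g (E_ i j)) -> f =1 g.
Proof.
move=> lf lg fg A.
pose f' : {linear M -> E} := HB.pack f (GRing.isLinear.Build k M E _ f lf).
pose g' : {linear M -> E} := HB.pack g (GRing.isLinear.Build k M E _ g lg).
rewrite -[f A]/(f' A) -[g A]/(g' A) !rep_lin_sum.
by apply: eq_bigr => i _; apply: eq_bigr => j _; rewrite [f' _]fg.
Qed.

Lemma bilinear_delta_ext (F : M -> M -> E) :
  (forall B, linear (F^~ B)) -> (forall A, linear (F A)) ->
  (forall i j l m, F (E_ i j) (E_ l m) = 0) -> forall A B, F A B = 0.
Proof.
move=> lF rF F0 A B.
have l0 : linear (fun _ : M => 0 : E) by move=> r x y; rewrite scaler0 addr0.
apply: (linear_fun_ext (f := F^~ B) (lF B) l0) => i j.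
exact: (linear_fun_ext (rF (E_ i j)) l0).
Qed.

(* G is the parity operator; w and z record the p-character. *)
Record parity_rep (p : nat) (a b c : {linear M -> E}) (G : E) (w : k)
    (z : 'I_n.+1 -> 'I_n.+1 -> k) : Prop := ParityRep {
  parity_rep_rep : periplectic_rep a b c;
  parity_sqr : G * G = 1;
  parity_a : forall A, GRing.comm G (a A);
  parity_b : forall B, G * b B = - (b B * G);
  parity_c : forall C, G * c C = - (c C * G);
  parity_pth : forall i j : 'I_n.+1, (j < i)%N -> a (E_ i j) ^+ p = z i j *: 1;
  parity_one : a 1 ^+ p = a 1 + w *: 1
}.

End MatrixExtension.

Section Column.
Variables (k : fieldType) (n : nat) (E : algType k).
Notation M := 'M[k]_n.+1.
Notation E_ i j := (delta_mx i j : M).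
Notation I := 'I_n.+1.
Variables (X D H K : I -> E).
Hypothesis two : 2%:R != 0 :> k.
Hypothesis XX : forall i j, GRing.comm (X i) (X j).
Hypothesis DD : forall i j, GRing.comm (D i) (D j).
Hypothesis DX : forall i j, D i * X j - X j * D i = (i == j)%:R *: 1.
Hypothesis XH : forall i j, GRing.comm (X i) (H j).
Hypothesis XK : forall i j, GRing.comm (X i) (K j).
Hypothesis DH : forall i j, GRing.comm (D i) (H j).
Hypothesis DK : forall i j, GRing.comm (D i) (K j).
Hypothesis HH : forall i j, H i * H j + H j * H i = 0.
Hypothesis KK : forall i j, K i * K j + K j * K i = 0.
Hypothesis HK : forall i j, H i * K j + K j * H i = (i == j)%:R *: 1.

Let ea i j := X i * D j - K j * H i.
Let eb i j := X i * H j + X j * H i.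
Let ec i j := D j * K i - D i * K j.

Let sub4 (x y z t : E) : (x - y) - (z - t) = (x - z) - (y - t).
Proof. by rewrite !opprD !opprK addrACA. Qed.
Let br (x y : E) := x * y - y * x.
Let brM x y z : br x (y * z) = br x y * z + y * br x z.
Proof. by rewrite /br mulrBl mulrBr !mulrA subrKA. Qed.
Let brD x y z : br x (y + z) = br x y + br x z.
Proof. by rewrite /br mulrDr mulrDl opprD addrACA. Qed.
Let brB x y z : br x (y - z) = br x y - br x z.
Proof. by rewrite /br mulrBr mulrBl sub4. Qed.
Let brN x y : br x y = - br y x.
Proof. by rewrite /br opprB. Qed.
Let comm0 x y : GRing.comm x y -> br x y = 0.
Proof. by rewrite /br => ->; rewrite subrr. Qed.
Let anti (x y r : E) : x * y + y * x = r -> x * y = r - y * x.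
Proof. by move=> <-; rewrite addrK. Qed.
Let brA (x y z : E) (r s : k) : x * y + y * x = r *: 1 -> x * z + z * x = s *: 1 ->
  br x (y * z) = r *: z - s *: y.
Proof.
move=> /anti xy /anti xz; rewrite /br mulrA xy mulrBl -!mulrA xz mulrBr opprB addrC.
by rewrite -!scalerAl -scalerAr mul1r mulr1 addrCA addKr.
Qed.

(** The operators [ea] act by brackets on X and H as on a standard basis, and on D and K as on the
    dual one. Since [br] is a derivation, their brackets with all quadratic operators follow. *)
Let ea_X i j l : br (ea i j) (X l) = (j == l)%:R *: X i.
Proof.
rewrite brN brB !brM (comm0 (XX l i)) (comm0 (XK l j)) (comm0 (XH l i)).
by rewrite !(mul0r, mulr0, add0r, addr0, subr0) -mulrN -brN /br DX -scalerAr mulr1.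
Qed.
Let ea_D i j l : br (ea i j) (D l) = - ((l == i)%:R *: D j).
Proof.
rewrite brN brB !brM (comm0 (DD l j)) (comm0 (DK l j)) (comm0 (DH l i)).
by rewrite !(mul0r, mulr0, add0r, addr0, subr0) /br DX -scalerAl mul1r.
Qed.
Let ea_H i j l : br (ea i j) (H l) = (j == l)%:R *: H i.
Proof.
rewrite brN brB brM (comm0 (commr_sym (XH i l))) (comm0 (commr_sym (DH j l))).
rewrite mul0r mulr0 addr0 sub0r opprK (brA (HK l j) (s := 0)) ?HH ?scale0r //.
by rewrite subr0 eq_sym.
Qed.
Let ea_K i j l : br (ea i j) (K l) = - ((l == i)%:R *: K j).
Proof.
rewrite brN brB brM (comm0 (commr_sym (XK i l))) (comm0 (commr_sym (DK j l))).
rewrite mul0r mulr0 addr0 sub0r opprK (brA (r := 0) (s := (l == i)%:R)) ?KK ?scale0r ?sub0r //.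
by rewrite addrC HK eq_sym.
Qed.

Let ea_ea i j l m : br (ea i j) (ea l m) = (j == l)%:R *: ea i m - (m == i)%:R *: ea l j.
Proof.
rewrite [ea l m]/ea brB !brM ea_X ea_D ea_H ea_K mulrN mulNr.
by rewrite -!scalerAl -!scalerAr [X in _ - X]addrC sub4 -!scalerBr.
Qed.

Let ea_eb i j l m : br (ea i j) (eb l m) = (j == l)%:R *: eb i m + (j == m)%:R *: eb l i.
Proof.
rewrite [eb l m]/eb brD !brM !ea_X !ea_H -!scalerAl -!scalerAr.
rewrite [X in _ + X]addrC addrACA -!scalerDr; congr (_ + _ *: _).
Qed.

Let ea_ec i j l m :
  br (ea i j) (ec l m) = - ((l == i)%:R *: ec j m + (m == i)%:R *: ec l j).
Proof.
rewrite [ec l m]/ec brB !brM !ea_D !ea_K !mulrN !mulNr -!scalerAl -!scalerAr.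
rewrite [X in _ - X]addrC sub4 -!opprD -!scalerBr addrC.
by [].
Qed.

Let ac_pair (u v x y : E) : GRing.comm u x -> GRing.comm u y -> GRing.comm v x ->
  GRing.comm v y -> GRing.comm u v -> x * y + y * x = 0 ->
  u * x * (v * y) + v * y * (u * x) = 0.
Proof.
move=> ux uy vx vy uv xy.
rewrite -mulrA (mulrA x) -vx -[v * y * _]mulrA (mulrA y) -uy !mulrA -uv -!mulrA.
by rewrite -mulrDr -mulrDr xy !mulr0.
Qed.

Let antic (x y : E) := x * y + y * x = 0.
Let anticC x y : antic x y -> antic y x.
Proof. by rewrite /antic addrC. Qed.
Let anticD x y z : antic x y -> antic x z -> antic x (y + z).
Proof. by rewrite /antic mulrDl mulrDr addrACA => -> ->; rewrite addr0. Qed.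
Let anticB x y z : antic x y -> antic x z -> antic x (y - z).
Proof. by rewrite /antic mulrBl mulrBr addrACA -opprD => -> ->; rewrite subr0. Qed.

Let eb_eb i j l m : eb i j * eb l m + eb l m * eb i j = 0.
Proof. by apply: anticD; apply/anticC/anticD; apply: ac_pair. Qed.

Let ec_ec i j l m : ec i j * ec l m + ec l m * ec i j = 0.
Proof. by apply: anticB; apply/anticC/anticB; apply: ac_pair. Qed.

Let XH_DK i j l m : X i * H j * (D m * K l) + D m * K l * (X i * H j)
  = (j == l)%:R *: (X i * D m) + (i == m)%:R *: (K l * H j).
Proof.
have -> : X i * H j * (D m * K l) = X i * D m * (H j * K l).
  by rewrite -mulrA (mulrA (H j)) -DH !mulrA.
have -> : D m * K l * (X i * H j) = D m * X i * (K l * H j).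
  by rewrite -mulrA (mulrA (K l)) -XK !mulrA.
rewrite (anti (HK j l)) mulrBr -scalerAr mulr1.
have -> : D m * X i = (i == m)%:R *: 1 + X i * D m by rewrite eq_sym -DX subrK.
by rewrite mulrDl -scalerAl mul1r [X in _ + X]addrC subrKA.
Qed.

Let eb_ec i j l m : eb i j * ec l m + ec l m * eb i j
  = ((j == l)%:R *: ea i m - (j == m)%:R *: ea i l)
    + ((i == l)%:R *: ea j m - (i == m)%:R *: ea j l).
Proof.
have acDB (x y z t : E) : (x + y) * (z - t) + (z - t) * (x + y)
    = ((x * z + z * x) - (x * t + t * x)) + ((y * z + z * y) - (y * t + t * y)).
  rewrite (mulrDl x y) (mulrDr _ x y) !mulrBr !mulrBl !opprD !addrA.
  by rewrite [LHS](ACl (1*5*2*6*3*7*4*8)).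
rewrite /eb /ec acDB !XH_DK /ea !scalerBr !opprD !opprK !addrA.
by rewrite [LHS](ACl (1*8*3*6*5*4*7*2)).
Qed.

Variables (p : nat) (G : E) (x y : I -> k).
Hypothesis chark : p \in [pchar k].
Hypothesis GG : G * G = 1.
Hypothesis GX : forall i, GRing.comm G (X i).
Hypothesis GD : forall i, GRing.comm G (D i).
Hypothesis GH : forall i, G * H i = - (H i * G).
Hypothesis GK : forall i, G * K i = - (K i * G).
Hypothesis Xp : forall i, X i ^+ p = x i *: 1.
Hypothesis Dp : forall i, D i ^+ p = y i *: 1.

(* Differential operators in n + 1 even variables X_i and n + 1 odd variables K_i,
   with derivatives D_i and H_i. *)
Definition column_a : {linear M -> E} := mx_ext (fun i j => X i * D j - K j * H i).
Definition column_b : {linear M -> E} := mx_ext (fun i j => X i * H j + X j * H i).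
Definition column_c : {linear M -> E} := mx_ext (fun i j => D j * K i - D i * K j).

Let a_delta i j : column_a (E_ i j) = ea i j. Proof. exact: mx_ext_delta. Qed.
Let b_delta i j : column_b (E_ i j) = eb i j. Proof. exact: mx_ext_delta. Qed.
Let c_delta i j : column_c (E_ i j) = ec i j. Proof. exact: mx_ext_delta. Qed.

Ltac linear_fun := repeat first [apply: linear_fun_id | apply: linear_fun_sub
  | apply: linear_fun_add | apply: linear_fun_mull | apply: linear_fun_mulr
  | apply: linear_fun_comp | apply: linear_fun_tr].

Lemma column_rep : periplectic_rep column_a column_b column_c.
Proof.
have aZ r i j : column_a (r *: E_ i j) = r *: ea i j by rewrite linearZ /= a_delta.
have bZ r i j : column_b (r *: E_ i j) = r *: eb i j by rewrite linearZ /= b_delta.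
have cZ r i j : column_c (r *: E_ i j) = r *: ec i j by rewrite linearZ /= c_delta.
have aB A B : column_a (A - B) = column_a A - column_a B by exact: linearB.
have aD A B : column_a (A + B) = column_a A + column_a B by exact: linearD.
have bD A B : column_b (A + B) = column_b A + column_b B by exact: linearD.
have cD A B : column_c (A + B) = column_c A + column_c B by exact: linearD.
split.
- move=> A B _ _; apply/eqP; rewrite -subr_eq0; apply/eqP; move: A B.
  apply: bilinear_delta_ext => [B|A|i j l m]; [by linear_fun | by linear_fun |].
  by rewrite !a_delta -/(br (ea i j) (ea l m)) ea_ea !delta_mulE aB !aZ subrr.
- move=> A B _; apply/eqP; rewrite -subr_eq0; apply/eqP; move: A B.
  apply: bilinear_delta_ext => [B|A|i j l m]; [by linear_fun | by linear_fun |].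
  rewrite a_delta b_delta -/(br (ea i j) (eb l m)) ea_eb trmx_delta !delta_mulE bD !bZ.
  by rewrite [m == j]eq_sym subrr.
- move=> A B _; apply/eqP; rewrite -addr_eq0; apply/eqP; move: A B.
  apply: bilinear_delta_ext => [B|A|i j l m]; [by linear_fun | by linear_fun |].
  rewrite a_delta c_delta -/(br (ea i j) (ec l m)) ea_ec trmx_delta !delta_mulE cD !cZ.
  by rewrite [i == l]eq_sym addNr.
- apply: bilinear_delta_ext => [B|A|i j l m]; [by linear_fun | by linear_fun |].
  by rewrite !b_delta eb_eb.
- apply: bilinear_delta_ext => [B|A|i j l m]; [by linear_fun | by linear_fun |].
  by rewrite !c_delta ec_ec.
- move=> A B; apply/eqP; rewrite -subr_eq0; apply/eqP; move: A B.
  apply: bilinear_delta_ext => [B|A|i j l m]; [by linear_fun | by linear_fun |].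
  rewrite b_delta c_delta eb_ec !trmx_delta mulrDl !mulrBr !delta_mulE aD !aB !aZ.
  by rewrite subrr.
- apply: linear_fun_ext => [||i j]; [by linear_fun | by linear_fun |].
  by rewrite trmx_delta !b_delta /eb addrC.
move=> C; apply/eqP; rewrite -addr_eq0; apply/eqP; move: C.
apply: linear_fun_ext => [||i j]; [by linear_fun | by move=> ? ? ?; rewrite scaler0 addr0 |].
by rewrite trmx_delta !c_delta /ec addrC subrKA subrr.
Qed.

Let charE : p \in [pchar E]. Proof. by rewrite pchar_lalg. Qed.
Let p_pr : prime p := pcharf_prime chark.

Let ea_comm i j : GRing.comm (X i * D j) (K j * H i).
Proof. by apply: commrM; apply/commr_sym/commrM; apply/commr_sym. Qed.

Let ea_pow i j : ea i j ^+ p = (X i * D j) ^+ p - (K j * H i) ^+ p.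
Proof.
by rewrite -!(pFrobenius_autE charE) pFrobenius_autB_comm //; apply: ea_comm.
Qed.

Let H2 i : H i * H i = 0. Proof. exact/(rep_sqr0 two)/HH. Qed.

(** [K i * H i] is idempotent, and for distinct indices [K j * H i] has square zero. *)
Let KHp i j : (K j * H i) ^+ p = (i == j)%:R *: (K j * H i).
Proof.
have KH2 : K j * H i * (K j * H i) = (i == j)%:R *: (K j * H i).
  rewrite -mulrA (mulrA (H i)) (anti (HK i j)) mulrBl -[K j * H i * H i]mulrA H2 mulr0 subr0.
  by rewrite -scalerAl mul1r -scalerAr.
rewrite -(prednK (prime_gt0 p_pr)); have : (0 < p.-1)%N by rewrite -subn1 subn_gt0 prime_gt1.
elim: p.-1 => // -[|m] IH _; first by rewrite expr2.
by rewrite exprS IH // -scalerAr KH2 scalerA -natrM mulnb andbb.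
Qed.

(** The two terms of [ea i j] commute, so the p-th power splits. For distinct indices X_i and D_j
    commute as well, which leaves x_i y_j. On the diagonal [weyl_euler_pow] returns X_i D_i together
    with x_i y_i, whence the value of w. *)
Lemma column_parity_rep :
  parity_rep p column_a column_b column_c G (\sum_i x i * y i) (fun i j => x i * y j).
Proof.
split=> //; first exact: column_rep.
- move=> A; apply/eqP; rewrite -subr_eq0; apply/eqP; move: A.
  apply: linear_fun_ext => [||i j]; [by linear_fun | by move=> ? ? ?; rewrite scaler0 addr0 |].
  rewrite a_delta /ea mulrBr mulrBl !mulrA GX GK mulNr -!mulrA GD GH mulrN !mulrA opprK.
  by rewrite subrr.
- move=> A; apply/eqP; rewrite -addr_eq0; apply/eqP; move: A.
  apply: linear_fun_ext => [||i j]; [by linear_fun | by move=> ? ? ?; rewrite scaler0 addr0 |].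
  rewrite b_delta /eb mulrDr mulrDl !mulrA !GX -!mulrA !GH !mulrN.
  by rewrite -opprD addNr.
- move=> A; apply/eqP; rewrite -addr_eq0; apply/eqP; move: A.
  apply: linear_fun_ext => [||i j]; [by linear_fun | by move=> ? ? ?; rewrite scaler0 addr0 |].
  rewrite c_delta /ec mulrBr mulrBl !mulrA !GD -!mulrA !GK !mulrN.
  by rewrite -opprB opprK addrC [X in X - _]addrC subrr.
- move=> i j ij; have ne : (i == j) = false by apply/eqP => e; rewrite e ltnn in ij.
  rewrite a_delta ea_pow KHp ne scale0r subr0.
  rewrite exprMn_comm; last first.
    by apply/eqP; rewrite -subr_eq0 -opprB DX [j == i]eq_sym ne scale0r oppr0.
  by rewrite Xp Dp -scalerAl -scalerAr mulr1 scalerA.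
have -> : column_a 1 = \sum_i ea i i.
  rewrite /column_a /mx_ext; apply: eq_bigr => i _; rewrite (bigD1 i) //= big1 => [|j ne].
    by rewrite mxE eqxx scale1r addr0.
  by rewrite mxE eq_sym (negPf ne) scale0r.
have -> : (\sum_i ea i i) ^+ p = \sum_i ea i i ^+ p.
  elim: (index_enum _) => [|i r IH]; first by rewrite !big_nil expr0n eqn0Ngt prime_gt0.
  rewrite !big_cons -IH -!(pFrobenius_autE charE) pFrobenius_autD_comm //.
  apply: commr_sum => j _; apply/eqP; rewrite -subr_eq0 -/(br _ _) ea_ea.
  rewrite [j == i]eq_sym; case: (i =P j) => [->|_]; last by rewrite !scale0r subrr.
  by rewrite subrr.
rewrite scaler_suml -big_split; apply: eq_bigr => i _ /=.
rewrite ea_pow KHp eqxx scale1r (weyl_euler_pow chark); last first.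
  by rewrite DX eqxx scale1r.
by rewrite Xp Dp -scalerAl -scalerAr mulr1 scalerA addrAC.
Qed.
End Column.

(** * Tensor products of superspaces *)

Section ParityRepSum.
Variables (k : fieldType) (n p : nat) (E1 E2 E : algType k).
Notation M := 'M[k]_n.+1.
Variables (L : {lrmorphism E1 -> E}) (R : {lrmorphism E2 -> E}).
Hypothesis LR : forall x y, GRing.comm (L x) (R y).
Hypothesis chark : p \in [pchar k].
Variables (a1 b1 c1 : {linear M -> E1}) (G1 : E1) (w1 : k) (z1 : 'I_n.+1 -> 'I_n.+1 -> k).
Variables (a2 b2 c2 : {linear M -> E2}) (G2 : E2) (w2 : k) (z2 : 'I_n.+1 -> 'I_n.+1 -> k).
Hypothesis rep1 : parity_rep p a1 b1 c1 G1 w1 z1.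
Hypothesis rep2 : parity_rep p a2 b2 c2 G2 w2 z2.

Definition sum_a (A : M) : E := L (a1 A) + R (a2 A).
(** The sign rule: an odd operator of the second factor passes the first factor at the cost of its
    parity [G1]. *)
Definition sum_b (A : M) : E := L (b1 A) + L G1 * R (b2 A).
Definition sum_c (A : M) : E := L (c1 A) + L G1 * R (c2 A).

Fact sum_a_linear : linear sum_a.
Proof. by move=> r A B; rewrite /sum_a !linearP scalerDr addrACA. Qed.
Fact sum_b_linear : linear sum_b.
Proof. by move=> r A B; rewrite /sum_b !linearP scalerDr mulrDr -scalerAr addrACA. Qed.
Fact sum_c_linear : linear sum_c.
Proof. by move=> r A B; rewrite /sum_c !linearP scalerDr mulrDr -scalerAr addrACA. Qed.
HB.instance Definition _ := GRing.isLinear.Build k M E _ sum_a sum_a_linear.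
HB.instance Definition _ := GRing.isLinear.Build k M E _ sum_b sum_b_linear.
HB.instance Definition _ := GRing.isLinear.Build k M E _ sum_c sum_c_linear.

Let LM x y : L x * L y = L (x * y). Proof. by rewrite [RHS]rmorphM. Qed.
Let RM x y : R x * R y = R (x * y). Proof. by rewrite [RHS]rmorphM. Qed.
Let LD x y : L x + L y = L (x + y). Proof. by rewrite [RHS]raddfD. Qed.
Let RD x y : R x + R y = R (x + y). Proof. by rewrite [RHS]raddfD. Qed.
Let LB x y : L x - L y = L (x - y). Proof. by rewrite [RHS]raddfB. Qed.
Let RB x y : R x - R y = R (x - y). Proof. by rewrite [RHS]raddfB. Qed.
Let LN x : - L x = L (- x). Proof. by rewrite [RHS]raddfN. Qed.
Let RN x : - R x = R (- x). Proof. by rewrite [RHS]raddfN. Qed.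
Let L0 : L 0 = 0. Proof. exact: raddf0. Qed.
Let R0 : R 0 = 0. Proof. exact: raddf0. Qed.
Let LRM x y x' y' : L x * R y * (L x' * R y') = L (x * x') * R (y * y').
Proof. by rewrite -LM -RM -!mulrA (mulrA (R y)) -LR !mulrA. Qed.
Let LRMl x y x' : L x * R y * L x' = L (x * x') * R y.
Proof. by rewrite -LM -!mulrA LR. Qed.
Let LRMr x x' y' : L x * (L x' * R y') = L (x * x') * R y'.
Proof. by rewrite -LM !mulrA. Qed.
Let RLM y x' y' : R y * (L x' * R y') = L x' * R (y * y').
Proof. by rewrite -RM !mulrA LR. Qed.
Let LRMR x y y' : L x * R y * R y' = L x * R (y * y').
Proof. by rewrite -RM !mulrA. Qed.

Let GG1 := parity_sqr rep1.
Let sub4 (x y z t : E) : (x + y) - (z + t) = (x - z) + (y - t).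
Proof. by rewrite opprD addrACA. Qed.

Let acD (x y z t : E) : (x + y) * (z + t) + (z + t) * (x + y)
  = (x * z + z * x) + (y * t + t * y) + ((x * t + t * x) + (y * z + z * y)).
Proof.
by rewrite (mulrDl x y) (mulrDl z t) !mulrDr !addrA [LHS](ACl (1*5*4*8*2*7*3*6)).
Qed.

Let cross x y : G1 * x = - (x * G1) -> L x * (L G1 * R y) + L G1 * R y * L x = 0.
Proof. by move=> Gx; rewrite LRMr LRMl -mulrDl LD Gx subrr L0 mul0r. Qed.

Let sum_anti (f1 g1 : {linear M -> E1}) (f2 g2 : {linear M -> E2}) B C e1 e2 :
  (forall B, G1 * f1 B = - (f1 B * G1)) -> (forall B, G1 * g1 B = - (g1 B * G1)) ->
  f1 B * g1 C + g1 C * f1 B = e1 -> f2 B * g2 C + g2 C * f2 B = e2 ->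
  (L (f1 B) + L G1 * R (f2 B)) * (L (g1 C) + L G1 * R (g2 C))
   + (L (g1 C) + L G1 * R (g2 C)) * (L (f1 B) + L G1 * R (f2 B)) = L e1 + R e2.
Proof.
move=> Gf Gg <- <-; rewrite acD cross // [X in _ + (_ + X)]addrC cross // !addr0.
by rewrite !LRM GG1 -mulrDr !LM RD LD rmorph1 mul1r.
Qed.

Let brD (x y z t : E) : (x + y) * (z + t) - (z + t) * (x + y)
  = (x * z - z * x) + (y * t - t * y) + ((x * t - t * x) + (y * z - z * y)).
Proof.
by rewrite (mulrDl x y) (mulrDl z t) !mulrDr !opprD !addrA [LHS](ACl (1*5*4*8*2*7*3*6)).
Qed.

Let sum_br A (f1 : {linear M -> E1}) (f2 : {linear M -> E2}) B e1 e2 :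
  a1 A * f1 B - f1 B * a1 A = e1 -> a2 A * f2 B - f2 B * a2 A = e2 ->
  sum_a A * (L (f1 B) + L G1 * R (f2 B)) - (L (f1 B) + L G1 * R (f2 B)) * sum_a A
  = L e1 + L G1 * R e2.
Proof.
move=> <- <-; rewrite brD !LM LB RLM LRMR -mulrBr RB LRMr LRMl (parity_a rep1) subrr add0r.
by rewrite LR subrr addr0.
Qed.

Let charE : p \in [pchar E]. Proof. by rewrite pchar_lalg. Qed.

Let sum_pow x y : (L x + R y) ^+ p = L (x ^+ p) + R (y ^+ p).
Proof.
have -> : L (x ^+ p) = L x ^+ p by exact: rmorphXn.
have -> : R (y ^+ p) = R y ^+ p by exact: rmorphXn.
by rewrite -!(pFrobenius_autE charE) pFrobenius_autD_comm //; apply: LR.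
Qed.

Let L1 : L 1 = 1. Proof. exact: rmorph1. Qed.
Let R1 : R 1 = 1. Proof. exact: rmorph1. Qed.
Let LZ r x : L (r *: x) = r *: L x. Proof. exact: linearZ. Qed.
Let RZ r x : R (r *: x) = r *: R x. Proof. exact: linearZ. Qed.

(** The operators of the two factors commute in [sum_a], so p-th powers, and with them the
    p-characters, add up. *)
Lemma parity_rep_sum :
  parity_rep p sum_a sum_b sum_c (L G1 * R G2) (w1 + w2) (fun i j => z1 i j + z2 i j).
Proof.
have [ra rb] := (parity_rep_rep rep1, parity_rep_rep rep2).
split.
- split.
  + move=> A B A0 B0; rewrite /sum_a brD !LM !RM LB RB (rep_aa ra) // (rep_aa rb) //.
    by rewrite LR subrr add0r -LR subrr addr0.
  + by move=> A B A0; apply: sum_br; [exact: (rep_ab ra) | exact: (rep_ab rb)].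
  + move=> A B A0; rewrite /sum_c (sum_br (rep_ac ra _ A0) (rep_ac rb _ A0)).
    by rewrite -LN -RN mulrN -opprD.
  + move=> B C; rewrite /sum_b (sum_anti (parity_b rep1) (parity_b rep1) (rep_bb ra _ _) (rep_bb rb _ _)).
    by rewrite L0 R0 addr0.
  + move=> B C; rewrite /sum_c (sum_anti (parity_c rep1) (parity_c rep1) (rep_cc ra _ _) (rep_cc rb _ _)).
    by rewrite L0 R0 addr0.
  + move=> B C; exact: (sum_anti (parity_b rep1) (parity_c rep1) (rep_bc ra _ _) (rep_bc rb _ _)).
  + by move=> B; rewrite /sum_b /= /sum_b (rep_bT ra) (rep_bT rb).
  + by move=> B; rewrite /= /sum_c (rep_cT ra) (rep_cT rb) -LN -RN mulrN opprD.
- by rewrite LRM GG1 (parity_sqr rep2) L1 R1 mulr1.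
- move=> A; rewrite /GRing.comm /= /sum_a mulrDr mulrDl LRMl LRMr LRMR RLM.
  by rewrite (parity_a rep1) (parity_a rep2).
- move=> B; rewrite /= /sum_b mulrDr mulrDl LRMl LRMr !LRM.
  rewrite (parity_b rep1) (parity_b rep2) -LN -RN mulNr mulrN opprD.
  by [].
- move=> B; rewrite /= /sum_c mulrDr mulrDl LRMl LRMr !LRM.
  rewrite (parity_c rep1) (parity_c rep2) -LN -RN mulNr mulrN opprD.
  by [].
- move=> i j ij; rewrite /= /sum_a sum_pow (parity_pth rep1 ij) (parity_pth rep2 ij).
  by rewrite LZ RZ L1 R1 scalerDl.
rewrite /= /sum_a sum_pow (parity_one rep1) (parity_one rep2) -LD -RD LZ RZ L1 R1 scalerDl.
by rewrite addrACA.
Qed.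
End ParityRepSum.

Section Oscillator.
Variables (k : fieldType) (n p : nat).
Notation M := 'M[k]_n.+1.
Hypothesis chark : p \in [pchar k].
Hypothesis two : 2%:R != 0 :> k.

Definition has_parity_rep (w : k) (z : 'I_n.+1 -> 'I_n.+1 -> k) : Prop :=
  exists r (a b c : {linear M -> 'M[k]_r.+1}) G, parity_rep p a b c G w z.

(** Translating creation and annihilation operators by scalars keeps the commutation relations and
    changes their p-th powers from 0 to x_i^p and y_i^p. *)
Lemma column_exists (x y : 'I_n.+1 -> k) :
  has_parity_rep (\sum_i x i ^+ p * y i ^+ p) (fun i j => x i ^+ p * y j ^+ p).
Proof.
have [r [z [G wz]]] := weyl_clifford_exists chark n.+1.
have rel o s (i : 'I_n.+1) o' s' (j : 'I_n.+1) := wc_rel wz o s o' s' (ltn_ord i) (ltn_ord j).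
have charE : p \in [pchar 'M[k]_r.+1] by rewrite pchar_lalg.
have cm (i j : 'I_n.+1) s o' s' : o' || (s == s') -> GRing.comm (z false s i) (z o' s' j).
  move=> h; apply/eqP; rewrite -subr_eq0.
  have := rel false s i o' s' j; rewrite expr0 scale1r => ->.
  by case: o' h => [_|/eqP ->]; rewrite ?eqxx ?andbF /= mul0r scale0r.
have an (i j : 'I_n.+1) s s' :
    z true s i * z true s' j + z true s' j * z true s i = ((i == j) && (s != s'))%:R *: 1.
  have := rel true s i true s' j; rewrite expr1 scaleN1r opprK => ->.
  by rewrite andbF expr0 mulr1 val_eqE.
have cs (u : 'M[k]_r.+1) (t : k) : GRing.comm u (t *: 1).
  by rewrite /GRing.comm -scalerAl -scalerAr mulr1 mul1r.
have sc (u : 'M[k]_r.+1) (t : k) : GRing.comm (t *: 1) u by apply/commr_sym.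
have pw s (i : 'I_n.+1) (t : k) : (z false s i + t *: 1) ^+ p = t ^+ p *: 1.
  rewrite -(pFrobenius_autE charE) pFrobenius_autD_comm ?cs // !(pFrobenius_autE charE).
  by rewrite (wc_nil wz) ?ltn_ord // add0r exprZn expr1n.
pose X (i : 'I_n.+1) := z false true i + x i *: 1; pose D (i : 'I_n.+1) := z false false i + y i *: 1.
exists r.
exists (column_a (fun i : 'I_n.+1 => X i) (fun i => D i) (fun i => z true false i) (fun i => z true true i)).
exists (column_b (fun i : 'I_n.+1 => X i) (fun i => z true false i)).
exists (column_c (fun i : 'I_n.+1 => D i) (fun i => z true true i)), G.
apply: column_parity_rep => //.
- by move=> i j; apply: commrD => //; apply/commr_sym/commrD => //; apply: cm.
- by move=> i j; apply: commrD => //; apply/commr_sym/commrD => //; apply: cm.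
- move=> i j; have := rel false false i false true j; rewrite expr0 scale1r /= mulr1 !andbT val_eqE => <-.
  rewrite /D /X.
  rewrite !mulrDl !mulrDr -(cs (z false true j)) -(cs (z false false i)) -(cs (y i *: 1)).
  by rewrite !opprD !addrA [LHS](ACl ((1*5)*(2*7)*(3*6)*(4*8))) /= !subrr !addr0.
- by move=> i j; apply/commr_sym/commrD => //; apply/commr_sym/cm.
- by move=> i j; apply/commr_sym/commrD => //; apply/commr_sym/cm.
- by move=> i j; apply/commr_sym/commrD => //; apply/commr_sym/cm.
- by move=> i j; apply/commr_sym/commrD => //; apply/commr_sym/cm.
- by move=> i j; rewrite an eqxx andbF scale0r.
- by move=> i j; rewrite an eqxx andbF scale0r.
- by move=> i j; rewrite an andbT.
- exact: wc_par2 wz.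
- by move=> i; apply: commrD => //; have := wc_par wz false true (ltn_ord i); rewrite expr0 scale1r.
- by move=> i; apply: commrD => //; have := wc_par wz false false (ltn_ord i); rewrite expr0 scale1r.
- by move=> i; rewrite (wc_par wz) ?ltn_ord // expr1 scaleN1r.
- by move=> i; rewrite (wc_par wz) ?ltn_ord // expr1 scaleN1r.
- by move=> i; apply: pw.
by move=> i; apply: pw.
Qed.

Lemma has_parity_rep_sum w1 z1 w2 z2 : has_parity_rep w1 z1 -> has_parity_rep w2 z2 ->
  has_parity_rep (w1 + w2) (fun i j => z1 i j + z2 i j).
Proof.
move=> [r1 [a1 [b1 [c1 [G1 h1]]]]] [r2 [a2 [b2 [c2 [G2 h2]]]]].
exists (tens_size r1 r2).
have h := @parity_rep_sum k n p _ _ _ (@tens_left k r1 r2) (@tens_right k r1 r2)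
  (@tens_comm k r1 r2) chark _ _ _ _ _ _ _ _ _ _ _ _ h1 h2.
by do 4!eexists; apply: h.
Qed.

Lemma eq_has_parity_rep w1 z1 w2 z2 : w1 = w2 ->
  (forall i j : 'I_n.+1, (j < i)%N -> z1 i j = z2 i j) ->
  has_parity_rep w1 z1 -> has_parity_rep w2 z2.
Proof.
move=> <- ez [r [a [b [c [G h]]]]]; exists r, a, b, c, G.
by case: h => *; split=> // i j ij; rewrite -ez // ; auto.
Qed.

(** The columns contribute p-characters of rank one: the pair (m+1, m) of coordinate vectors gives
    one subdiagonal entry. The initial pair (0, 0) has no entry below the diagonal; it is there to
    set [w] to 1, from which [trace_zero_projection] gets its hypothesis. *)
Lemma parity_rep_exists : has_parity_rep 1 (fun i j => (i == j.+1 :> nat)%:R).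
Proof.
have p0 : (0 < p)%N by rewrite prime_gt0 // (pcharf_prime chark).
have pb (b : bool) : b%:R ^+ p = b%:R :> k by case: b; rewrite ?expr1n // expr0n eqn0Ngt p0.
have column (l m : nat) := column_exists (fun i => (i == l :> nat)%:R) (fun i => (i == m :> nat)%:R).
suff h m : has_parity_rep 1 (fun i j => ((i == j.+1 :> nat) && (j < m)%N)%:R).
  by apply: (eq_has_parity_rep (erefl 1) _ (h n.+1)) => i j _; rewrite ltn_ord andbT.
elim: m => [|m IH].
  apply: (eq_has_parity_rep _ _ (column 0%N 0%N)) => [|i j ij].
    rewrite big_ord_recl big1 ?addr0 => [|i _]; first by rewrite !expr1n mulr1.
    by rewrite !pb mul0r.
  by rewrite andbF !pb -natrM mulnb gtn_eqF // (leq_ltn_trans _ ij).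
apply: (eq_has_parity_rep _ _ (has_parity_rep_sum IH (column m.+1 m))) => [|i j ij].
  rewrite big1 ?addr0 // => i _; rewrite !pb -natrM mulnb.
  by case: eqP => //= ->; rewrite gtn_eqF.
rewrite !pb -natrM mulnb -natrD ltnS; congr (_%:R).
case: (ltngtP j m) => [jm|jm|->]; rewrite ?(andbF, andbT, addn0) //.
Qed.
End Oscillator.

(** * Irreducible modules of maximal dimension *)

Section PropSubspaces.
Variables (k : fieldType) (V : vectType k).

Lemma prop_vspace (Q : V -> Prop) : Q 0 ->
  (forall (r : k) x y, Q x -> Q y -> Q (r *: x + y)) ->
  exists U : {vspace V}, forall x, x \in U <-> Q x.
Proof.
move=> Q0 Ql.
pose P d := `[< exists2 U : {vspace V}, \dim U = d & forall x, x \in U -> Q x >].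
have exP : exists d, P d.
  exists 0%N; apply/asboolP; exists 0%VS; rewrite ?dimv0 // => x.
  by rewrite memv0 => /eqP ->.
have ubP d : P d -> (d <= \dim {:V})%N.
  by move=> /asboolP [U <- _]; rewrite dimvS ?subvf.
case: (ex_maxnP exP ubP) => d /asboolP [U dU UQ] maxd; exists U => x; split; first exact: UQ.
move=> Qx; apply: contraT => xU.
suff /maxd le_d : P (\dim (<[x]> + U)).
  have : (U == <[x]> + U)%VS by rewrite eqEdim addvSr dU.
  by move/eqP => e; case/negP: xU; rewrite e; apply: (subvP (addvSl _ _)); apply: memv_line.
apply/asboolP; exists (<[x]> + U)%VS => // y /memv_addP [_ /vlineP [r ->] [u uU ->]].
by apply: Ql => //; apply: UQ.
Qed.

Lemma minimal_vspace (P : {vspace V} -> Prop) (U : {vspace V}) : P U -> U != 0%VS ->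
  exists W : {vspace V}, [/\ P W, W != 0%VS
    & forall W', P W' -> W' != 0%VS -> (W' <= W)%VS -> W' = W].
Proof.
move=> PU U0.
pose Q d := `[< exists W, [/\ P W, W != 0%VS & \dim W = d] >].
have exQ : exists d, Q d by exists (\dim U); apply/asboolP; exists U.
case: (ex_minnP exQ) => d /asboolP [W [PW W0 dW]] mind; exists W; split=> // W' PW' W'0 sW.
apply/eqP; rewrite eqEdim sW dW; apply: mind; apply/asboolP.
by exists W'.
Qed.
End PropSubspaces.

(** * The action of p(n) on a minimal stable subspace *)

Section Operators.
Variables (k : fieldType) (n : nat) (E : algType k).
Notation M := 'M[k]_n.+1.
Notation g := (periplectic k n.+1).
Variables (a b c : {linear M -> E}) (G : E).
Hypothesis two : 2%:R != 0 :> k.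
Hypothesis rep : periplectic_rep a b c.
Hypothesis Ga : forall A, GRing.comm G (a A).
Hypothesis Gb : forall B, G * b B = - (b B * G).
Hypothesis Gc : forall C, G * c C = - (c C * G).

(** The halves compensate for [b B] encoding B + B^T and [c C] encoding C - C^T. *)
Definition rep_op (X : 'M[k]_(n.+1 + n.+1)) : E :=
  a (ulsubmx X) + 2%:R^-1 *: b (ursubmx X) + 2%:R^-1 *: c (dlsubmx X).

Lemma rep_opE A B C : rep_op (pblock A B C) = a A + 2%:R^-1 *: b B + 2%:R^-1 *: c C.
Proof. by rewrite /rep_op !(block_mxKul, block_mxKur, block_mxKdl). Qed.

Lemma rep_op_linear : linear rep_op.
Proof.
move=> r X Y; rewrite /rep_op /ulsubmx /ursubmx /dlsubmx !linearP /=.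
by rewrite !scalerDr !addrA [LHS](ACl (1*3*5*2*4*6)).
Qed.

Lemma rep_op_even A : rep_op (pblock A 0 0) = a A.
Proof. by rewrite rep_opE (linear0 b) (linear0 c) !scaler0 !addr0. Qed.

Lemma rep_op_odd B C : rep_op (pblock 0 B C) = 2%:R^-1 *: (b B + c C).
Proof. by rewrite rep_opE (linear0 a) add0r scalerDr. Qed.

Lemma rep_op_parity i X : X \in homog g i -> G * rep_op X = (-1) ^+ i *: (rep_op X * G).
Proof.
move=> /(homog_periplecticP two) [A [B [C [-> _ _ _]]]]; case: i.
  rewrite rep_op_odd -scalerAr -scalerAl expr1 scaleN1r -scalerN mulrDr mulrDl Gb Gc.
  by rewrite opprD.
by rewrite rep_op_even expr0 scale1r Ga.
Qed.

Lemma rep_op_bracket i j X Y : X \in homog g i -> Y \in homog g j ->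
  rep_op (sbracket X Y) = rep_op X * rep_op Y - (-1) ^+ (i && j) *: (rep_op Y * rep_op X).
Proof.
have sym0 : (0 : M) = 0^T by rewrite trmx0.
have alt0 : (0 : M) = - 0^T by rewrite trmx0 oppr0.
move=> /(homog_periplecticP two) [A [B [C [-> A0 hB hC]]]].
move=> /(homog_periplecticP two) [A' [B' [C' [-> A'0 hB' hC']]]].
have bN U : b (- U) = - b U by exact: linearN.
have cN U : c (- U) = - c U by exact: linearN.
have aD U V : a (U + V) = a U + a V by exact: linearD.
have bc B1 C1 : B1 = B1^T -> C1 = - C1^T -> b B1 * c C1 + c C1 * b B1 = 2%:R * 2%:R *: a (B1 * C1).
  move=> hB1 hC1; rewrite (rep_bc rep) -hB1 -hC1 -[B1 + B1]mulr2n -[C1 + C1]mulr2n.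
  by rewrite -!scaler_nat -scalerAl -scalerAr scalerA; exact: linearZ.
case: i; case: j; rewrite ?expr1 ?expr0 ?scaleN1r ?scale1r ?opprK sbracket_pblock //
  ?(mulr0, mul0r, trmx0, addr0, add0r, subr0, sub0r, oppr0).
- rewrite rep_op_even !rep_op_odd -!scalerAl -!scalerAr !scalerA -scalerDr.
  have -> : (b B + c C) * (b B' + c C') + (b B' + c C') * (b B + c C)
    = (b B * c C' + c C' * b B) + (b B' * c C + c C * b B')
      + ((b B * b B' + b B' * b B) + (c C * c C' + c C' * c C)).
    by rewrite !(mulrDl, mulrDr) !addrA [LHS](ACl (2*7*6*3*1*5*4*8)).
  rewrite (rep_bb rep) (rep_cc rep) !addr0 !bc // -scalerDr scalerA -aD.
  by rewrite mulrACA mulVf // mulr1 scale1r.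
- rewrite !rep_op_even !rep_op_odd -!scalerAl -!scalerAr -scalerBr mulrDl mulrDr bN.
  rewrite [in RHS]opprD [in RHS]addrACA -(opprB (a A' * b B)) -(opprB (a A' * c C)).
  by rewrite (rep_ab rep) // (rep_ac rep) // opprK.
- rewrite !rep_op_even !rep_op_odd -!scalerAl -!scalerAr -scalerBr mulrDl mulrDr cN.
  by rewrite [in RHS]opprD addrACA (rep_ab rep) // (rep_ac rep).
by rewrite !rep_op_even (rep_aa rep).
Qed.
End Operators.

Section Submodule.
Variables (k : fieldType) (n r : nat).
Notation M := 'M[k]_n.+1.
Notation E := 'M[k]_r.+1.
Notation T := 'cV[k]_r.+1.
Notation g := (periplectic k n.+1).
Variables (a b c : {linear M -> E}) (G : E) (W : {vspace T}).
Hypothesis two : 2%:R != 0 :> k.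
Hypothesis rep : periplectic_rep a b c.
Hypothesis GG : G * G = 1.
Hypothesis Ga : forall A, GRing.comm G (a A).
Hypothesis Gb : forall B, G * b B = - (b B * G).
Hypothesis Gc : forall C, G * c C = - (c C * G).

Definition rep_stable (U : {vspace T}) : Prop :=
  [/\ stable U G, forall A, \tr A = 0 -> stable U (a A),
      forall B, stable U (b B) & forall C, stable U (c C)].

Hypothesis Wst : rep_stable W.

Definition parity_space (i : bool) : {vspace T} :=
  (W :&: mx_ker (G - ((-1) ^+ i)%:M))%VS.
Notation V := (subvs_of (parity_space false) * subvs_of (parity_space true))%type.

Lemma parity_spaceP i v : v \in parity_space i <-> v \in W /\ G *m v = (-1) ^+ i *: v.
Proof.
rewrite memv_cap mx_kerP mulmxBl mul_scalar_mx subr_eq0.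
by split=> [/andP [-> /eqP ->] | [-> ->]] //; rewrite eqxx.
Qed.

Definition parity_join (v : V) : T := vsval v.1 + vsval v.2.
(** The components are the projections (1 + G)/2 and (1 - G)/2, inverse to [parity_join] on [W]
    only. *)
Definition parity_split (v : T) : V :=
  (vsproj (parity_space false) (2%:R^-1 *: (v + G *m v)),
   vsproj (parity_space true) (2%:R^-1 *: (v - G *m v))).

Lemma parity_join_linear : linear parity_join.
Proof. by move=> s u v; rewrite /parity_join !linearP scalerDr addrACA. Qed.

Lemma parity_split_linear : linear parity_split.
Proof.
move=> s u v; congr (_, _);
  rewrite -[RHS](linearP (vsproj (parity_space _))); congr (vsproj _ _).
  by rewrite mulmxDr -scalemxAr addrACA -scalerDr [LHS]scalerDr !scalerA [_ * s]mulrC.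
by rewrite mulmxDr -scalemxAr opprD addrACA -scalerBr [LHS]scalerDr !scalerA [_ * s]mulrC.
Qed.

Lemma parity_join_mem v : parity_join v \in W.
Proof. by apply: rpredD; [case/parity_spaceP: (subvsP v.1) | case/parity_spaceP: (subvsP v.2)]. Qed.

Lemma parity_splitK v : v \in W -> parity_join (parity_split v) = v.
Proof.
move=> vW; have Gv : G *m v \in W by case: Wst => + _ _ _; apply.
have G2 : G *m (G *m v) = v by rewrite -actM GG act1.
rewrite /parity_join /= !vsprojK; first last.
- apply/parity_spaceP; split; first by rewrite rpredZ // rpredD.
  by rewrite expr0 scale1r -scalemxAr mulmxDr G2 addrC.
- apply/parity_spaceP; split; first by rewrite rpredZ // rpredB.
  by rewrite expr1 scaleN1r -scalemxAr mulmxBr G2 -scalerN opprB.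
by rewrite -scalerDr addrACA subrr addr0 -mulr2n -scaler_nat scalerA mulVf ?scale1r.
Qed.

Lemma parity_join_even v : v.2 = 0 -> G *m parity_join v = parity_join v.
Proof.
move=> v2; rewrite /parity_join v2 linear0 addr0.
by case/parity_spaceP: (subvsP v.1) => _ ->; rewrite expr0 scale1r.
Qed.
Lemma parity_join_odd v : v.1 = 0 -> G *m parity_join v = - parity_join v.
Proof.
move=> v2; rewrite /parity_join v2 linear0 add0r.
by case/parity_spaceP: (subvsP v.2) => _ ->; rewrite expr1 scaleN1r.
Qed.

Lemma parity_joinK v : parity_split (parity_join v) = v.
Proof.
case: v => v0 v1; rewrite /parity_split /parity_join /= mulmxDr.
case/parity_spaceP: (subvsP v0) => _ ->; case/parity_spaceP: (subvsP v1) => _ ->.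
rewrite expr0 expr1 scale1r scaleN1r.
have half u : 2%:R^-1 *: (u + u) = u :> T.
  by rewrite -mulr2n -scaler_nat scalerA mulVf ?scale1r.
congr (_, _); rewrite ?opprD ?opprK addrACA subrr ?(addr0, add0r) half; exact: vsvalK.
Qed.

Lemma parity_splitP i v : v \in parity_space i -> in_parity i (parity_split v).
Proof.
case/parity_spaceP => _; rewrite /parity_split /in_parity; case: i => ->.
  by rewrite expr1 scaleN1r subrr scaler0 linear0.
by rewrite expr0 scale1r subrr scaler0 linear0.
Qed.

Lemma parity_joinP i v : in_parity i v -> parity_join v \in parity_space i.
Proof.
move=> vi; apply/parity_spaceP; split; first exact: parity_join_mem.
by case: i vi => [/parity_join_odd|/parity_join_even] ->; rewrite ?expr1 ?scaleN1r ?expr0 ?scale1r.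
Qed.

Definition sub_action (X : 'M[k]_(n.+1 + n.+1)) (v : V) : V :=
  parity_split (rep_op a b c X *m parity_join v).

Lemma rep_op_stable X : X \in g -> stable W (rep_op a b c X).
Proof.
case: Wst => _ Wa Wb Wc /(periplecticP two) [A [B [C [-> A0 _ _]]]] v vW.
rewrite rep_opE !mulmxDl -!scalemxAl.
by rewrite !rpredD ?rpredZ //; [apply: Wa | apply: Wb | apply: Wc].
Qed.

Lemma sub_action_join X v : X \in g ->
  parity_join (sub_action X v) = rep_op a b c X *m parity_join v.
Proof.
by move=> Xg; rewrite parity_splitK //; apply: rep_op_stable => //; apply: parity_join_mem.
Qed.

Lemma sub_supermodule : supermodule g sub_action.
Proof.
have opD s X Y u : rep_op a b c (s *: X + Y) *m u
    = s *: (rep_op a b c X *m u) + rep_op a b c Y *m u.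
  by rewrite rep_op_linear mulmxDl scalemxAl.
split.
- move=> X _ s u v; rewrite /sub_action -parity_split_linear; congr parity_split.
  by rewrite parity_join_linear mulmxDr scalemxAr.
- by move=> X Y _ _ s v; rewrite /sub_action -parity_split_linear opD.
- move=> i j v X Xi vj; apply: parity_splitP; apply/parity_spaceP; split.
    apply: rep_op_stable; last exact: parity_join_mem.
    by move: Xi; rewrite memv_cap => /andP [].
  rewrite -actM (rep_op_parity two Ga Gb Gc Xi) -scalemxAl actM.
  have [_ ->] := (parity_spaceP j _).1 (parity_joinP vj).
  by rewrite -scalemxAr scalerA -signr_addb.
move=> i j X Y Xi Yj v.
have [Xg Yg] : X \in g /\ Y \in g.
  by move: Xi Yj; rewrite !memv_cap => /andP [-> _] /andP [-> _].
rewrite {1 2 4}/sub_action !sub_action_join // (rep_op_bracket two rep Xi Yj).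
rewrite mulmxBl -scalemxAl !actM.
by rewrite [RHS]addrC -[in RHS]scaleNr -parity_split_linear scaleNr addrC.
Qed.

Hypothesis W0 : W != 0%VS.
Hypothesis Wmin : forall U, rep_stable U -> U != 0%VS -> (U <= W)%VS -> U = W.

(** A graded submodule corresponds to a subspace of [W] stable under the operators, gradedness
    giving stability under [G]; minimality of [W] then decides. *)
Lemma sub_irreducible : irreducible_supermodule g sub_action.
Proof.
have J0 : parity_join 0 = 0 by rewrite /parity_join !linear0 addr0.
have S0 : parity_split 0 = 0.
  by apply/(can_inj parity_joinK) => //; rewrite parity_splitK ?mem0v.
split; first exact: sub_supermodule.
  exists (parity_split (vpick W)); apply/eqP => e.
  have := parity_splitK (memv_pick W); rewrite e J0 => /esym/eqP.
  by rewrite vpick0 (negPf W0).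
move=> Q [Q0 Ql Qg Qs].
have [|s u v [uW Qu] [vW Qv]|U UQ] :=
    @prop_vspace _ _ (fun v => v \in W /\ Q (parity_split v)).
- by rewrite mem0v S0.
- by rewrite rpredD ?rpredZ // parity_split_linear; split=> //; apply: Ql.
have QD u v : Q u -> Q v -> Q (u + v) by move=> Qu Qv; rewrite -[u]scale1r; apply: Ql.
have QZ s u : Q u -> Q (s *: u) by move=> Qu; rewrite -[_ *: _]addr0; apply: Ql.
have Uop X : X \in g -> stable U (rep_op a b c X).
  move=> Xg v /UQ [vW Qv]; apply/UQ; split; first exact: rep_op_stable.
  have := Qs X Xg _ Qv; rewrite /sub_action parity_splitK //.
have Ust : rep_stable U.
  split.
  - move=> v /UQ [vW Qv]; apply/UQ; split; first by case: Wst => + _ _ _; apply.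
    have -> : parity_split (G *m v)
        = ((parity_split v).1, 0) + (-1) *: (0, (parity_split v).2).
      congr (_, _); rewrite /= -actM GG act1.
        by rewrite scaler0 addr0 addrC.
      by rewrite add0r -linearZ /= scaleN1r -scalerN opprB.
    by have [Q1 Q2] := Qg _ Qv; apply/QD/QZ.
  - move=> A A0 v vU; rewrite -(rep_op_even a b c); apply: Uop => //.
    exact: periplectic_even.
  - move=> B v vU; have -> : b B = rep_op a b c (pblock 0 (B + B^T) 0).
      rewrite rep_op_odd (linear0 c) addr0 (linearD b) /= (rep_bT rep) -mulr2n -scaler_nat.
      by rewrite scalerA mulVf ?scale1r.
    apply: Uop => //; apply: periplectic_odd => //; last by rewrite trmx0 oppr0.
    by rewrite linearD /= trmxK addrC.
  - move=> C v vU; have -> : c C = rep_op a b c (pblock 0 0 (C - C^T)).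
      rewrite rep_op_odd (linear0 b) add0r (linearB c) /= (rep_cT rep) opprK -mulr2n -scaler_nat.
      by rewrite scalerA mulVf ?scale1r.
    apply: Uop => //; apply: periplectic_odd => //; first by rewrite trmx0.
    by rewrite linearB /= trmxK opprB.
have [U0|U0] := eqVneq U 0%VS.
  left=> v Qv; have : parity_join v \in U.
    by apply/UQ; rewrite parity_joinK; split=> //; apply: parity_join_mem.
  rewrite U0 memv0 => /eqP jv; rewrite -[v]parity_joinK jv S0.
  by [].
right=> v; have UW : U = W.
  by apply: Wmin => //; apply/subvP => u /UQ [].
rewrite -[v]parity_joinK.
have : parity_join v \in U by rewrite UW parity_join_mem.
by case/UQ.
Qed.
End Submodule.

Lemma dim_image_le (k : fieldType) (V : lmodType k) (d : nat) (T : vectType k)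
    (f : {linear V -> T}) (W : {vspace T}) :
  has_dim V d -> (forall w, w \in W -> exists v, f v = w) -> (\dim W <= d)%N.
Proof.
move=> [h [h' hK h'K]] fW.
have lh : linear h' := can2_linear hK h'K.
pose h1 : {linear 'rV[k]_d -> V} := HB.pack h' (GRing.isLinear.Build _ _ _ _ h' lh).
pose F := linfun (f \o h1).
have sW : (W <= limg F)%VS.
  apply/subvP => w /fW [v <-]; have := memv_img F (memvf (h v)).
  by rewrite lfunE /= [h' _]hK.
apply: leq_trans (dimvS sW) _; have := limg_ker_dim F fullv.
by rewrite dimvf /dim /= mul1n => e; rewrite -[X in (_ <= X)%N]e leq_addl.
Qed.

(** A minimal stable subspace of the oscillator module is irreducible. The upper bound limits its
    dimension, and the Whittaker argument, valid for every nonzero stable subspace, gives the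
    opposite inequality. *)
Lemma irreducible_supermodule_exists (k : closedFieldType) (p n : nat) :
  p \in [pchar k] -> (2 < p)%N ->
  exists (V0 V1 : lmodType k) (rho : 'M[k]_(n.+1 + n.+1) -> V0 * V1 -> V0 * V1),
    irreducible_supermodule (periplectic k n.+1) rho
    /\ has_dim (V0 * V1)%type (kw_bound p n).
Proof.
move=> chark p_gt2; have two := pchar_two chark p_gt2.
have p0 : (0 < p)%N by rewrite (leq_trans _ p_gt2).
have [r [a [b [c [G h]]]]] := parity_rep_exists n chark two.
have rep := parity_rep_rep h.
have [Ga [Gb Gc]] := (parity_a h, (parity_b h, parity_c h)).
have stT : rep_stable a b c G fullv by split=> *; move=> v _; apply: memvf.
have nzT : (fullv : {vspace 'cV[k]_r.+1}) != 0%VS.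
  by rewrite -dimv_eq0 dimvf.
have [W [Wst W0 Wmin]] := minimal_vspace stT nzT.
have irr := sub_irreducible two rep (parity_sqr h) Ga Gb Gc Wst W0 Wmin.
exists _, _, (@sub_action k n r a b c G W); split=> //.
have [d dimd le_d] := irreducible_supermodule_dim chark p_gt2 irr.
suff : (kw_bound p n <= d)%N by move=> ge_d; rewrite (_ : kw_bound p n = d) //; apply/eqP; rewrite eqn_leq ge_d.
have le_W : (\dim W <= d)%N.
  pose J : {linear _ -> _} := HB.pack (@parity_join k r G W)
    (GRing.isLinear.Build _ _ _ _ _ (@parity_join_linear k r G W)).
  apply: (@dim_image_le _ _ _ _ J _ dimd) => w wW.
  by exists (@parity_split k r G W w); apply: (parity_splitK two (parity_sqr h) Wst).
apply: leq_trans le_W.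
have a1 : n.+1%:R = 0 :> k -> a 1 ^+ p - a 1 = 1.
  by move=> _; rewrite (parity_one h) addrC addKr scale1r.
have [Tn [Tn_br Tn_ind]] := trace_zero_projection two p0 rep a1.
have [_ Wa Wb Wc] := Wst.
apply: (kw_bound_le_dim chark two rep (parity_pth h) Wa Wb Wc _ Tn_br _ W0).
- apply: (Tn_ind (stable W)) => //.
  + by move=> v; rewrite act1.
  + by move=> x y Wx Wy; apply: stableD.
  + by move=> x y Wx Wy; apply: stableM.
  by move=> s x Wx; apply: stableZ.
(* The common kernel of the [c C] is stable under the even operators, since their brackets with a
   [c] are again of the form [c]. *)
apply: (Tn_ind (fun x => forall v, (forall C, c C *m v = 0) -> forall C, c C *m (x *m v) = 0)).
- by move=> v cv C; rewrite act1.
- move=> A A0 v cv C; rewrite -actM.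
  have -> : c C * a A = a A * c C + c (A^T * C + C * A).
    by rewrite -[c (_ + _)]opprK -(rep_ac rep) // opprB subrKC.
  by rewrite mulmxDl actM !cv mulmx0 addr0.
- by move=> x y hx hy v cv C; rewrite mulmxDl mulmxDr hx // hy // addr0.
- by move=> x y hx hy v cv C; rewrite actM; apply: hx => C'; apply: hy.
by move=> s x hx v cv C; rewrite -scalemxAl -scalemxAr hx // scaler0.
Qed.

(** * Coadjoint stabilizers *)

Section Codimension.
Variables (k : fieldType) (V : vectType k) (I : finType) (U S : {vspace V}).

Lemma codim_le (l : I -> V -> k^o) : (forall i, linear (l i)) ->
  (forall x, x \in U -> (forall i, l i x = 0) -> x \in S) ->
  (\dim U - \dim S <= #|I|)%N.
Proof.
move=> ll lS; pose F x : 'rV[k]_#|I| := \row_t l (enum_val t) x.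
have lF : linear F by move=> r x y; apply/rowP => t; rewrite !mxE ll.
pose F1 : {linear V -> 'rV[k]_#|I|} := HB.pack F (GRing.isLinear.Build _ _ _ _ F lF).
have sS : (U :&: lker (linfun F1) <= S)%VS.
  apply/subvP => x; rewrite memv_cap memv_ker lfunE => /andP [xU /eqP Fx].
  by apply: lS => // i; have /rowP /(_ (enum_rank i)) := Fx; rewrite !mxE enum_rankK.
rewrite leq_subLR -(limg_ker_dim (linfun F1) U) leq_add ?dimvS //.
by apply: leq_trans (dimvS (subvf _)) _; rewrite dimvf /dim /= mul1n.
Qed.

(** The vectors [e i] are dual to linear forms vanishing on [S], hence independent modulo [S]. *)
Lemma codim_ge (e : I -> V) (l : I -> V -> k^o) : (S <= U)%VS ->
  (forall i, linear (l i)) -> (forall i, e i \in U) ->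
  (forall i j, l i (e j) = (i == j)%:R) -> (forall x, x \in S -> forall i, l i x = 0) ->
  (#|I| <= \dim U - \dim S)%N.
Proof.
move=> SU ll eU le lS.
have eS (c : I -> k) : \sum_i c i *: e i \in S -> forall i, c i = 0.
  move=> /lS S0 i; rewrite -(S0 i).
  pose l1 : {linear V -> k^o} := HB.pack (l i) (GRing.isLinear.Build _ _ _ _ (l i) (ll i)).
  have lZ j : l i (c j *: e j) = c j * (i == j)%:R by rewrite -[LHS]/(l1 _) linearZ /= le.
  rewrite -[RHS]/(l1 _) linear_sum (bigD1 i) //= lZ eqxx mulr1 big1 ?addr0 // => j ne.
  by rewrite lZ eq_sym (negPf ne) mulr0.
pose F (c : 'rV[k]_#|I|) : V := \sum_i c 0 (enum_rank i) *: e i.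
have lF : linear F.
  move=> r x y; rewrite /F scaler_sumr -big_split; apply: eq_bigr => i _ /=.
  by rewrite !mxE scalerDl scalerA.
pose F1 : {linear 'rV[k]_#|I| -> V} := HB.pack F (GRing.isLinear.Build _ _ _ _ F lF).
have F0 c : F c \in S -> c = 0.
  move=> /eS c0; apply/rowP => t; rewrite mxE -(c0 (enum_val t)) enum_valK.
  by [].
have ker0 : lker (linfun F1) = 0%VS.
  apply/eqP; rewrite -subv0; apply/subvP => c; rewrite memv_ker lfunE memv0 => /eqP Fc.
  by rewrite [c]F0 //; rewrite [F c]Fc mem0v.
have dF : \dim (limg (linfun F1)) = #|I|.
  by rewrite limg_dim_eq ?ker0 ?capv0 // dimvf /dim /= mul1n.
have SF : (S :&: limg (linfun F1) = 0)%VS.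
  apply/eqP; rewrite -subv0; apply/subvP => x; rewrite memv_cap => /andP [xS /memv_imgP [c _ xc]].
  by move: xS; rewrite xc lfunE => /F0 ->; rewrite linear0 mem0v.
rewrite -dF leq_subRL ?dimvS // -dimv_disjoint_sum // dimvS // subv_add SU.
apply/subvP => x /memv_imgP [c _ ->]; rewrite lfunE memv_suml // => i _.
by rewrite memvZ.
Qed.
End Codimension.

Section Dual.
Variables (k : fieldType) (n : nat).
Notation M := 'M[k]_n.+1.
Notation E_ i j := (delta_mx i j : M).
Notation g := (periplectic k n.+1).
Hypothesis two : 2%:R != 0 :> k.

Lemma dual_ext_trace (theta : even_dual g) : exists Theta : M,
  forall A B C : M, \tr A = 0 -> dual_ext theta (pblock A B C) = \tr (Theta * A).
Proof.
exists (\matrix_(j, i) dual_ext theta (pblock (sl_delta k i j) 0 0)) => A B C A0.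
have -> : dual_ext theta (pblock A B C) = dual_ext theta (pblock A 0 0).
  by rewrite /dual_ext !gl_proj_pblock.
have lp : linear (fun X : M => pblock X 0 0).
  by move=> r X Y; rewrite -pblock_lin !scaler0 !addr0.
pose f : {linear M -> 'M[k]_(n.+1 + n.+1)} := HB.pack (fun X : M => pblock X 0 0)
  (GRing.isLinear.Build _ _ _ _ _ lp).
pose h : {linear M -> k^o} := dual_ext theta \o f.
have -> : dual_ext theta (pblock A 0 0) = \sum_i \sum_j A i j *: h (sl_delta k i j).
  rewrite -[LHS]/(h A) {1}(sl_sum A0) linear_sum; apply: eq_bigr => i _.
  by rewrite linear_sum; apply: eq_bigr => j _; rewrite linearZ.
rewrite exchange_big /mxtrace; apply: eq_bigr => j _; rewrite -mulmxE mxE; apply: eq_bigr => i _.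
by rewrite mxE mulrC.
Qed.

Lemma dual_exists (Theta : M) : exists theta : even_dual g,
  forall A B C : M, \tr A = 0 -> dual_ext theta (pblock A B C) = \tr (Theta * A).
Proof.
have lt : linear (fun u : subvs_of (homog g false) => \tr (Theta * ulsubmx (vsval u)) : k^o).
  move=> r u v; rewrite /ulsubmx !linearP /= -mulmxE mulmxDr -scalemxAr.
  by rewrite linearP.
pose f : {linear subvs_of (homog g false) -> k^o} := HB.pack
  (fun u : subvs_of (homog g false) => \tr (Theta * ulsubmx (vsval u)) : k^o)
  (GRing.isLinear.Build _ _ _ _ _ lt).
exists (linfun f) => A B C A0.
rewrite /dual_ext gl_proj_pblock lfunE /= vsprojK ?block_mxKul //.
by apply/(homog_periplecticP two); exists A, 0, 0; rewrite trmx0 oppr0.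
Qed.

Section Stab.
Variables (theta : even_dual g) (Theta : M).
Hypothesis thetaE : forall A B C : M, \tr A = 0 ->
  dual_ext theta (pblock A B C) = \tr (Theta * A).

Lemma mxtrace_mul_br (A A' : M) :
  \tr (Theta * (A * A' - A' * A)) = \tr ((Theta * A - A * Theta) * A').
Proof.
rewrite mulrBr mulrBl !linearB /= !mulrA; congr (_ - _).
by rewrite -!mulrA (mxtrace_mulC A (Theta * A')) mulrA.
Qed.

Lemma theta_stab_pblock A B C : \tr A = 0 -> B = B^T -> C = - C^T ->
  pblock A B C \in theta_stab theta <->
  (forall A' B' C' : M, \tr A' = 0 -> B' = B'^T -> C' = - C'^T ->
     \tr ((Theta * A - A * Theta) * A') + \tr (Theta * (B * C' + B' * C)) = 0).
Proof.
move=> A0 hB hC.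
have E A' B' C' : \tr A' = 0 -> B' = B'^T -> C' = - C'^T ->
    dual_ext theta (sbracket (pblock A B C) (pblock A' B' C'))
    = \tr ((Theta * A - A * Theta) * A') + \tr (Theta * (B * C' + B' * C)).
  move=> A'0 hB' hC'; rewrite sbracket_pblock // thetaE.
    by rewrite mulrDr linearD /= mxtrace_mul_br.
  by rewrite mxtraceD mxtraceM_comm add0r mxtraceD !(mxtraceM_sym_alt two) ?addr0.
split=> [/theta_stabP [_ st] A' B' C' A'0 hB' hC'|st].
  rewrite -E // st //; apply/(periplecticP two); by exists A', B', C'.
apply/theta_stabP; split; first by apply/(periplecticP two); exists A, B, C.
move=> Y /(periplecticP two) [A' [B' [C' [-> A'0 hB' hC']]]].
by rewrite E // st.
Qed.

(** The forms are the entries below the diagonal of the conjugate of A and those above the diagonal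
    of the conjugate of [Theta, A]. Where they vanish, A and Theta are triangular together, so their
    commutator has no diagonal either and is zero. *)
Lemma codim_stab_even_le (P P' : M) : P * P' = 1 ->
  (forall i j : 'I_n.+1, (j < i)%N -> (P * Theta * P') i j = 0) ->
  (b_theta theta false <= #|neg_index n|)%N.
Proof.
move=> PP' Tup; have P'P : P' * P = 1 by apply: (mulmx1C PP').
pose cj (X : M) := P * X * P'.
have cjM X Y : cj (X * Y) = cj X * cj Y.
  by rewrite /cj !mulrA -[P * X * P' * P]mulrA P'P mulr1.
have cjB X Y : cj (X - Y) = cj X - cj Y by rewrite /cj mulrBr mulrBl.
have cjI X : cj X = 0 -> X = 0.
  move=> X0; have -> : X = P' * cj X * P by rewrite /cj !mulrA P'P mul1r -mulrA P'P mulr1.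
  by rewrite X0 mulr0 mul0r.
pose br (X : M) := Theta * X - X * Theta.
pose l (t : neg_index n) (X : 'M[k]_(n.+1 + n.+1)) : k^o :=
  let: (i, j) := val t.2 in
  if t.1 then cj (ulsubmx X) i j else cj (br (ulsubmx X)) j i.
rewrite /b_theta; apply: (@codim_le k _ _ _ _ l).
  have lcj (r : k) X Y : cj (r *: X + Y) = r *: cj X + cj Y.
    by rewrite /cj mulrDr mulrDl -scalerAr -scalerAl.
  have lbr (r : k) X Y : br (r *: X + Y) = r *: br X + br Y.
    by rewrite /br mulrDr mulrDl -scalerAr -scalerAl scalerBr opprD addrACA.
  move=> [o [[i j] ij]] r X Y; rewrite /l /ulsubmx !linearP /= ?lbr.
  by case: o; rewrite lcj !mxE.
move=> X /(homog_periplecticP two) [A [B [C [-> A0 hB hC]]]] lX.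
rewrite /homog memv_cap; apply/andP; split; last first.
  by apply/gl_partP; rewrite gl_proj_pblock.
apply/theta_stab_pblock; rewrite ?trmx0 ?oppr0 // => A' B' C' A'0 hB' hC'.
rewrite mul0r mulr0 addr0 mulr0 linear0 addr0.
have lij (o : bool) (i j : 'I_n.+1) (ij : (j < i)%N) := lX (o, exist _ (i, j) ij).
have Aup (i j : 'I_n.+1) : (j < i)%N -> cj A i j = 0.
  by move=> ij; have := lij true i j ij; rewrite /l /= block_mxKul.
have upM (S T : M) (i j : 'I_n.+1) : (forall i j : 'I_n.+1, (j < i)%N -> S i j = 0) ->
    (forall i j : 'I_n.+1, (j < i)%N -> T i j = 0) -> (i <= j)%N ->
    (S * T) j i = S j i * T i i.
  move=> Su Tu ij; rewrite -mulmxE mxE (bigD1 i) //= big1 ?addr0 => [|m mi] //.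
  case: (ltnP m j) => [mj|jm]; first by rewrite Su ?mul0r.
  rewrite [T m i]Tu ?mulr0 // ltn_neqAle (leq_trans ij jm) andbT.
  by rewrite eq_sym val_eqE.
rewrite -/(br A); suff -> : br A = 0 by rewrite mul0r linear0.
apply: cjI; apply/matrixP => i j; rewrite [RHS]mxE; case: (ltnP i j) => ij.
  by have := lij false j i ij; rewrite /l /= block_mxKul.
rewrite cjB !cjM mxE [X in _ + X]mxE (upM (cj Theta) (cj A)) // (upM (cj A) (cj Theta)) //; move: ij; rewrite leq_eqVlt => /orP [/eqP/val_inj->|ij].
  by rewrite mulrC subrr.
have -> : cj Theta i j = 0 by exact: Tup.
by rewrite (Aup _ _ ij) !mul0r subrr.
Qed.

(** The forms are the entries of C below the diagonal and those of the skew-symmetric part of Theta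
    B. Where they vanish, C is zero and Theta B is symmetric, so its product with any skew-symmetric
    C' has trace zero. *)
Lemma codim_stab_odd_le : (b_theta theta true <= #|neg_index n|)%N.
Proof.
pose l (t : neg_index n) (X : 'M[k]_(n.+1 + n.+1)) : k^o :=
  let: (i, j) := val t.2 in
  if t.1 then dlsubmx X i j else (Theta * ursubmx X) i j - (Theta * ursubmx X) j i.
rewrite /b_theta; apply: (@codim_le k _ _ _ _ l).
  move=> [[] [[i j] ij]] r X Y; rewrite /l /ursubmx /dlsubmx !linearP /=; first by rewrite !mxE.
  have ent (S T : M) i' j' : (r *: S + T) i' j' = r * S i' j' + T i' j' by rewrite !mxE.
  by rewrite mulrDr -scalerAr !ent opprD addrACA -mulrBr.
move=> X /(homog_periplecticP two) [A [B [C [-> A0 hB hC]]]] lX.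
rewrite /homog memv_cap; apply/andP; split; last first.
  by apply/gl_partP; rewrite gl_proj_pblock.
have lij (o : bool) (i j : 'I_n.+1) (ij : (j < i)%N) := lX (o, exist _ (i, j) ij).
have C0 : C = 0.
  have Cl (i j : 'I_n.+1) : (j < i)%N -> C i j = 0.
    by move=> ij; have := lij true i j ij; rewrite /l /= block_mxKdl.
  apply/matrixP => i j; rewrite mxE; case: (ltngtP i j) => [ij|ij|/val_inj ->].
  - by rewrite hC !mxE Cl ?oppr0.
  - exact: Cl.
  apply/eqP; have /matrixP /(_ j j) /eqP := hC; rewrite !mxE -addr_eq0 -mulr2n -mulr_natr mulf_eq0.
  by rewrite (negPf two) orbF.
apply/theta_stab_pblock; rewrite ?linear0 // => A' B' C' A'0 hB' hC'.
rewrite mulr0 mul0r subrr mul0r linear0 add0r C0 mulr0 addr0 mulrA.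
apply: (mxtraceM_sym_alt two) => //; apply/matrixP => i j; rewrite [RHS]mxE.
have T (i' j' : 'I_n.+1) : (j' < i')%N -> (Theta * B) i' j' = (Theta * B) j' i'.
  move=> ij; have := lij false i' j' ij; rewrite /l /= block_mxKur => /eqP.
  by rewrite subr_eq0 => /eqP.
by case: (ltngtP i j) => [/T|/T|/val_inj ->].
Qed.

Section Generic.
Hypothesis Tdiag : forall i j, i != j -> Theta i j = 0.
Hypothesis Tinj : injective (fun i => Theta i i).

Let TM (X : M) i j : (Theta * X) i j = Theta i i * X i j.
Proof.
rewrite -mulmxE mxE (bigD1 i) //= big1 ?addr0 // => m mi.
by rewrite Tdiag ?mul0r // eq_sym.
Qed.
Let MT (X : M) i j : (X * Theta) i j = X i j * Theta j j.
Proof.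
by rewrite -mulmxE mxE (bigD1 j) //= big1 ?addr0 // => m mi; rewrite Tdiag ?mulr0.
Qed.

Let stab_sub i : (homog (theta_stab theta) i <= homog g i)%VS.
Proof. by apply: capvS => //; apply: capvSl. Qed.

(** Testing a stabilizer against E_ji gives (Theta_ii - Theta_jj) A_ij = 0, so all off-diagonal
    entries of A vanish. *)
Lemma codim_stab_even_ge : (#|neg_index n| <= b_theta theta false)%N.
Proof.
pose pos (t : neg_index n) := let: (i, j) := val t.2 in if t.1 then (i, j) else (j, i).
have pos_ne t : (pos t).1 != (pos t).2.
  by case: t => [[] [[i j] /= ij]]; rewrite /pos /= neq_ltn ij ?orbT.
have pos_inj : injective pos.
  case=> [o [[i j] ij]] [o' [[i' j'] ij']]; rewrite /pos /= in ij ij' *.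
  by case: o; case: o' => -[ei ej]; subst; rewrite ?(bool_irrelevance ij ij') //; lia.
apply: (@codim_ge k _ _ _ _ (fun t => pblock (E_ (pos t).1 (pos t).2) 0 0)
   (fun t X => ulsubmx X (pos t).1 (pos t).2)) => //.
- by move=> t r X Y; rewrite /ulsubmx !linearP /= !mxE.
- move=> t; apply/(homog_periplecticP two); exists (E_ (pos t).1 (pos t).2), 0, 0.
  by rewrite mxtrace_delta (negPf (pos_ne t)) !trmx0 oppr0.
- by move=> s t; rewrite block_mxKul mxE -xpair_eqE -!surjective_pairing (inj_eq pos_inj).
move=> X; rewrite /homog memv_cap => /andP [Xs /gl_partP Xe] t.
have : X \in homog g false by apply: (subvP (stab_sub false)); rewrite memv_cap Xs; apply/gl_partP.
move=> /(homog_periplecticP two) [A [B [C [eX A0 hB hC]]]]; rewrite eX block_mxKul.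
move: Xs; rewrite eX => /theta_stab_pblock; rewrite trmx0 oppr0 => st.
have := st A0 erefl erefl (E_ (pos t).2 (pos t).1) 0 0.
rewrite mxtrace_delta eq_sym (negPf (pos_ne t)) trmx0 oppr0 !mul0r addr0 mulr0 linear0 addr0.
move=> /(_ erefl erefl erefl); rewrite mxtrace_mul_delta mxE [X in _ + X]mxE TM MT mulrC -mulrBr => /eqP.
by rewrite mulf_eq0 subr_eq0 (inj_eq Tinj) (negPf (pos_ne t)) orbF => /eqP.
Qed.

(** Testing C against E_ij + E_ji and B against E_ij - E_ji gives the factor Theta_ii - Theta_jj
    times the entry, up to sign; so C is zero and B is diagonal on the stabilizer. *)
Lemma codim_stab_odd_ge : (#|neg_index n| <= b_theta theta true)%N.
Proof.
pose e (t : neg_index n) : 'M[k]_(n.+1 + n.+1) := let: (i, j) := val t.2 in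
  if t.1 then pblock 0 0 (E_ i j - E_ j i) else pblock 0 (E_ i j + E_ j i) 0.
pose l (t : neg_index n) (X : 'M[k]_(n.+1 + n.+1)) : k^o := let: (i, j) := val t.2 in
  if t.1 then dlsubmx X i j else ursubmx X i j.
have symE (i j : 'I_n.+1) : E_ i j + E_ j i = (E_ i j + E_ j i)^T.
  by rewrite linearD /= !trmx_delta addrC.
have altE (i j : 'I_n.+1) : E_ i j - E_ j i = - (E_ i j - E_ j i)^T.
  by rewrite linearB /= !trmx_delta opprB.
have sym0 : (0 : M) = 0^T by rewrite trmx0.
have alt0 : (0 : M) = - 0^T by rewrite trmx0 oppr0.
have tr0 : \tr (0 : M) = 0 by rewrite linear0.
apply: (@codim_ge k _ _ _ _ e l) => //.
- by move=> [[] [[i j] ij]] r X Y; rewrite /l /dlsubmx /ursubmx !linearP /= !mxE.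
- move=> [o [[i j] ij]]; apply/(homog_periplecticP two); rewrite /e /=; case: o.
    by exists 0, 0, (E_ i j - E_ j i).
  by exists 0, (E_ i j + E_ j i), 0.
- move=> [o [[i j] ij]] [o' [[i' j'] ij']]; rewrite /l /e /= in ij ij' *.
  have -> : ((o, exist _ (i, j) ij) == (o', exist _ (i', j') ij') :> neg_index n)
      = [&& o == o', i == i' & j == j'] by [].
  have ne : (i == j') && (j == i') = false.
    by apply/andP => -[/eqP ei /eqP ej]; subst; lia.
  case: o; case: o'; rewrite ?(block_mxKdl, block_mxKur) /= !mxE //.
    by rewrite ne subr0.
  by rewrite ne addr0.
move=> X; rewrite /homog memv_cap => /andP [Xs /gl_partP Xe].
have : X \in homog g true by apply: (subvP (stab_sub true)); rewrite memv_cap Xs; apply/gl_partP.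
move=> /(homog_periplecticP two) [A [B [C [eX _ hB hC]]]] [o [[i j] ij]].
have ne : i == j = false by apply/eqP => e'; move: ij; rewrite /= e' ltnn.
rewrite eX /l /=; move: Xs; rewrite eX => /theta_stab_pblock st.
have := st tr0 hB hC 0 _ _ tr0; case: o; rewrite ?(block_mxKdl, block_mxKur) => st1.
  have := st1 _ _ (symE i j) alt0.
  rewrite mulr0 linear0 add0r mulr0 add0r mulrA (mxtrace_mulC _ C : \tr (_ * C) = \tr (C * _)).
  rewrite mulrA mulrDr mxtraceD !mxtrace_mul_delta !MT.
  have -> : C j i = - C i j by rewrite [in LHS]hC !mxE.
  rewrite mulNr addrC -mulrBr => /eqP; rewrite mulf_eq0 subr_eq0 (inj_eq Tinj) [j == i]eq_sym ne orbF.
  by move/eqP.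
have := st1 _ _ sym0 (altE i j).
rewrite mulr0 linear0 add0r mul0r addr0 mulrA mulrBr linearB /= !mxtrace_mul_delta !TM.
have -> : B j i = B i j by rewrite [in LHS]hB mxE.
rewrite -mulrBl => /eqP; rewrite mulf_eq0 subr_eq0 (inj_eq Tinj) [j == i]eq_sym ne => /eqP.
by [].
Qed.
End Generic.
End Stab.
End Dual.

Lemma closed_field_injection (k : closedFieldType) m :
  exists f : 'I_m -> k, injective f.
Proof.
suff [s us <-] : exists2 s : seq k, uniq s & size s = m.
  exists (fun i => nth 0 s i) => i j /eqP.
  by rewrite nth_uniq // => /eqP/val_inj.
elim: m => [|m [s us sm]]; first by exists [::].
(* A root of this polynomial avoids all of [s]; the factor X keeps it nonconstant when [s] is
   empty. *)
have /closed_rootP [x] : size (\prod_(z <- s) ('X - z%:P) * 'X + 1 : {poly k}) != 1%N.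
  rewrite size_MXaddC size_prod_XsubC.
  by case: ifP.
rewrite rootE !hornerE => x0; exists (x :: s); last by rewrite /= sm.
rewrite /= us andbT; apply/negP; rewrite -root_prod_XsubC rootE => /eqP e.
by move: x0; rewrite e mul0r add0r oner_eq0.
Qed.

(** * The maximum over linear forms *)

Section KacWeisfeiler.
Variables (k : closedFieldType) (p n : nat).
Notation g := (periplectic k n.+1).
Hypothesis two : 2%:R != 0 :> k.
Hypothesis p_gt2 : (2 < p)%N.

Lemma card_neg_index : #|neg_index n| = #|low_pair n|.*2.
Proof. by rewrite card_prod card_bool mul2n. Qed.

Lemma kw_boundE : kw_bound p n = (p ^ #|low_pair n| * 2 ^ #|low_pair n|)%N.
Proof.
rewrite /kw_bound -(pair_bigA _ (fun o q => neg_bound p (o, q))) big_bool /=.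
by rewrite !prod_nat_const mulnC.
Qed.

Lemma kw_value_le (theta : even_dual g) : (kw_value p theta <= kw_bound p n)%N.
Proof.
have [Theta thetaE] := dual_ext_trace theta.
have [P [P' [PP' up]]] := upper_triangularizable Theta.
have := codim_stab_even_le two thetaE PP' up.
have := codim_stab_odd_le two thetaE.
rewrite card_neg_index kw_boundE /kw_value => b1 b0; apply: leq_mul.
  by rewrite leq_exp2l ?(ltn_trans _ p_gt2) // -(doubleK #|low_pair n|) half_leq.
by rewrite leq_exp2l // -(uphalf_double #|low_pair n|) uphalf_leq.
Qed.

Lemma kw_value_attained : exists theta : even_dual g, kw_value p theta = kw_bound p n.
Proof.
have [f fI] := closed_field_injection k n.+1.
have [theta thetaE] := dual_exists two (diag_mx (\row_i f i)).
exists theta; apply/eqP; rewrite eqn_leq kw_value_le.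
have Td (i j : 'I_n.+1) : i != j -> diag_mx (\row_i f i) i j = 0.
  by move=> ne; rewrite mxE (negPf ne).
have Ti : injective (fun i => diag_mx (\row_i f i) i i).
  by move=> i j; rewrite !mxE !eqxx !mulr1n; apply: fI.
have := codim_stab_even_ge two thetaE Td Ti.
have := codim_stab_odd_ge two thetaE Td Ti.
rewrite card_neg_index kw_boundE /kw_value => b1 b0; apply: leq_mul.
  by rewrite leq_exp2l ?(ltn_trans _ p_gt2) // -(doubleK #|low_pair n|) half_leq.
by rewrite leq_exp2l // -(uphalf_double #|low_pair n|) uphalf_leq.
Qed.
End KacWeisfeiler.

Theorem corollary5p2 (k : closedFieldType) (p n : nat)
    (char_k : p \in [pchar k]) (p_gt2 : (2 < p)%N) (n_gt0 : (1 <= n)%N) :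
  exists M : nat,
    max_kw_value p (periplectic k n) M /\
    max_irreducible_dim (periplectic k n) M.
Proof.
case: n n_gt0 => // n _; have two := pchar_two char_k p_gt2.
exists (kw_bound p n); split; split.
- exact: kw_value_attained.
- exact: kw_value_le.
- exact: irreducible_supermodule_exists.
by move=> V0 V1 rho; apply: irreducible_supermodule_dim.
Qed.
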